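(* Let $d, n, k$ be positive integers with $d \geq 3$ and $2 \leq n \leq d$. Unless $d = 3$, $n = 3$ and $k \in \{1, 2\}$, there exist two $d$-dimensional convex bodies $K, L \subseteq \mathbb{R}^d$ satisfying $K \subseteq L$ and $\mathbb{E} \mathcal{V}_{K[n]}^k > \mathbb{E} \mathcal{V}_{L[n]}^k$.
   Context: A $d$-dimensional convex body is a compact convex subset of $\mathbb{R}^d$ with nonempty interior. For a $d$-dimensional convex body $K$, $\mathcal{V}_{K[n]}$ denotes the $(n-1)$-dimensional volume of the convex hull of $n$ independent random points, each uniformly distributed on the boundary of $K$ (i.e. according to the normalized surface area measure, that is, normalized $(d-1)$-dimensional Hausdorff measure on the boundary). $\mathbb{E} \mathcal{V}_{K[n]}^k$ denotes the $k$-th moment $\mathbb{E}[(\mathcal{V}_{K[n]})^k]$. *)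

(* Defs.v *)
From HB Require Import structures.
From mathcomp Require Import all_boot all_order all_algebra.
From mathcomp Require Import all_classical all_reals all_analysis.
Import Order.TTheory GRing.Theory Num.Theory.
Import numFieldNormedType.Exports.

Set Implicit Arguments.
Unset Strict Implicit.
Unset Printing Implicit Defensive.

Local Open Scope classical_set_scope.
Local Open Scope ring_scope.

Section hausdorff_definition.
Context {R : realType} {d : nat}.
Local Notation V := 'rV[R]_d.

(* The library norm [`|x|] on row vectors is the sup norm; it induces the
   usual topology, but Hausdorff measure needs Euclidean diameters. *)
Definition enorm (x : V) : R := Num.sqrt (\sum_(i < d) x 0 i ^+ 2).

Definition ediam (A : set V) : \bar R :=
  ereal_sup [set (enorm (x - y))%:E | x in A & y in A].

(* The empty set costs 0 also when m = 0. *)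
Definition hausdorff_cost (m : nat) (A : set V) : \bar R :=
  if A == set0 then 0%E else (ediam A ^+ m)%E.

Definition hausdorff_delta (m : nat) (delta : R) (A : set V) : \bar R :=
  ereal_inf [set (\sum_(i <oo) hausdorff_cost m (F i))%E | F in
    [set F : (set V)^nat |
      (forall i, (ediam (F i) <= delta%:E)%E) /\ A `<=` \bigcup_i F i]].

(* m-dimensional Hausdorff outer measure, without any normalising constant. *)
Definition hausdorff_measure (m : nat) (A : set V) : \bar R :=
  ereal_sup [set hausdorff_delta m delta A | delta in [set e : R | 0 < e]].

End hausdorff_definition.

Section hausdorff_outer_measure.
Context {R : realType} {d : nat}.
Local Notation V := 'rV[R]_d.
Implicit Types (A B X : set V) (m : nat).

Lemma ler_norm_enorm (x : V) : `|x| <= enorm x.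
Proof.
have -> : `|x| = \big[Num.max/0]_ij `|x ij.1 ij.2| by exact: mx_normrE.
apply: bigmax_le => [|[i j] _ /=]; first exact: sqrtr_ge0.
rewrite (ord1 i) -sqrtr_sqr ler_sqrt; last first.
  by apply: sumr_ge0 => k _; exact: sqr_ge0.
by rewrite (bigD1 j)//= lerDl; apply: sumr_ge0 => k _; exact: sqr_ge0.
Qed.

Lemma ediam_ge0 A : A !=set0 -> (0 <= ediam A)%E.
Proof.
move=> [x Ax]; apply: le_ereal_sup_tmp; exists (enorm (x - x))%:E.
  by exists x => //; exists x.
by rewrite lee_fin sqrtr_ge0.
Qed.

Lemma le_ediam A B : A `<=` B -> (ediam A <= ediam B)%E.
Proof.
move=> AB; apply: ereal_sup_le => _ [x Ax [y Ay <-]].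
by exists x; [exact: AB|exists y => //; exact: AB].
Qed.

Lemma hausdorff_cost_ge0 m A : (0 <= hausdorff_cost m A)%E.
Proof.
rewrite /hausdorff_cost; case: ifPn => // /set0P A0.
exact/expe_ge0/ediam_ge0.
Qed.

Lemma hausdorff_cost0 m : hausdorff_cost m (set0 : set V) = 0%E.
Proof. by rewrite /hausdorff_cost eqxx. Qed.

Lemma le_hausdorff_cost m A B :
  A `<=` B -> (hausdorff_cost m A <= hausdorff_cost m B)%E.
Proof.
move=> AB; have [->|A0] := eqVneq A set0.
  by rewrite hausdorff_cost0 hausdorff_cost_ge0.
have /set0P A0' := A0.
have B0 : B != set0 by apply/set0P; case: A0' => x /AB; exists x.
rewrite /hausdorff_cost (negbTE A0) (negbTE B0).
have := le_ediam AB; have := ediam_ge0 A0'.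
elim: m => [|m IH] dA AB'; first by rewrite !expe0.
by rewrite !expeS lee_pmul ?expe_ge0//; exact: IH.
Qed.

(* Giving sets of diameter > delta infinite cost turns [hausdorff_delta] into
   an instance of [mu_ext], over the sigma-algebra of all sets. *)
Let allsets := g_sigma_algebraType [set: set V].

Let bounded_cost m delta (A : set allsets) : \bar R :=
  if (ediam A <= delta%:E)%E then hausdorff_cost m A else +oo%E.

Let bounded_cost_ge0 m delta A : (0 <= bounded_cost m delta A)%E.
Proof. by rewrite /bounded_cost; case: ifPn => // _; exact: hausdorff_cost_ge0. Qed.

Let ediam0 : ediam (set0 : set V) = -oo%E.
Proof.
rewrite /ediam [X in ereal_sup X](_ : _ = set0) ?ereal_sup0//.
by apply/seteqP; split => // ? [].
Qed.

Let bounded_cost0 m delta : bounded_cost m delta set0 = 0%E.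
Proof. by rewrite /bounded_cost ediam0 leNye hausdorff_cost0. Qed.

Let hausdorff_deltaE m delta A :
  hausdorff_delta m delta A = mu_ext (bounded_cost m delta) A.
Proof.
apply/eqP; rewrite eq_le; apply/andP; split.
  apply: le_ereal_inf_tmp => _ [F [_ AF] <-].
  have [Fd|] := pselect (forall i, (ediam (F i : set V) <= delta%:E)%E).
    apply: ereal_inf_lbound; exists F; first by split.
    by apply: eq_eseriesr => i _; rewrite /bounded_cost Fd.
  move=> /existsNP[i /negP Fi].
  rewrite (eseries_pinfty (k := i)) ?leey//.
  - by move=> n _; rewrite -ltNye (lt_le_trans _ (bounded_cost_ge0 _ _ _)).
  - by rewrite /bounded_cost (negbTE Fi).
apply: le_ereal_inf => _ [F [Fd AF] <-]; exists F.
  by split => // i; exact: sub_sigma_algebra.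
by apply: eq_eseriesr => i _; rewrite /bounded_cost Fd.
Qed.

Lemma hausdorff_delta_ge0 m delta A : (0 <= hausdorff_delta m delta A)%E.
Proof. by rewrite hausdorff_deltaE; exact: mu_ext_ge0. Qed.

Lemma hausdorff_delta0 m delta : hausdorff_delta m delta (set0 : set V) = 0%E.
Proof. by rewrite hausdorff_deltaE; exact: mu_ext0. Qed.

Lemma hausdorff_delta_le m delta :
  {homo (@hausdorff_delta R d m delta) : A B / A `<=` B >-> (A <= B)%E}.
Proof. by move=> A B AB; rewrite !hausdorff_deltaE; exact: le_mu_ext. Qed.

Lemma hausdorff_delta_sigma_subadditive m delta :
  sigma_subadditive (@hausdorff_delta R d m delta).
Proof.
move=> F; rewrite hausdorff_deltaE; under eq_eseriesr do rewrite hausdorff_deltaE.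
exact: mu_ext_sigma_subadditive.
Qed.

Lemma hausdorff_delta_le_measure m delta A : 0 < delta ->
  (hausdorff_delta m delta A <= hausdorff_measure m A)%E.
Proof. by move=> d0; apply: ereal_sup_ubound; exists delta. Qed.

Lemma hausdorff_measure0 m : hausdorff_measure m (set0 : set V) = 0%E.
Proof.
apply/eqP; rewrite eq_le; apply/andP; split.
  by apply: ge_ereal_sup => _ [e e0 <-]; rewrite hausdorff_delta0.
by rewrite -(hausdorff_delta0 m 1); exact: hausdorff_delta_le_measure.
Qed.

Lemma hausdorff_measure_ge0 m A : (0 <= hausdorff_measure m A)%E.
Proof.
apply: (le_trans (hausdorff_delta_ge0 m 1 A)).
exact: hausdorff_delta_le_measure.
Qed.

Lemma le_hausdorff_measure m :
  {homo (@hausdorff_measure R d m) : A B / A `<=` B >-> (A <= B)%E}.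
Proof.
move=> A B AB; apply: ge_ereal_sup => _ [e e0 <-].
exact: le_trans (hausdorff_delta_le _ _ AB) (hausdorff_delta_le_measure _ _ e0).
Qed.

Lemma hausdorff_measure_sigma_subadditive m :
  sigma_subadditive (@hausdorff_measure R d m).
Proof.
move=> F; apply: ge_ereal_sup => _ [e e0 <-].
apply: (le_trans (hausdorff_delta_sigma_subadditive _ _ _)).
apply: lee_nneseries => i _; last exact: hausdorff_delta_le_measure.
by move=> _; exact: hausdorff_delta_ge0.
Qed.

HB.instance Definition _ m := isOuterMeasure.Build R V (@hausdorff_measure R d m)
  (hausdorff_measure0 m) (hausdorff_measure_ge0 m) (@le_hausdorff_measure m)
  (@hausdorff_measure_sigma_subadditive m).

End hausdorff_outer_measure.

(* Hausdorff measure is additive on positively separated sets, so Borel sets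
   are Caratheodory measurable for it. *)
Section hausdorff_borel.
Context {R : realType} {d : nat}.
Local Notation V := 'rV[R]_d.
Implicit Types (A B X : set V) (m : nat).

Lemma hausdorff_delta_separated m (e1 e2 e : R) A B :
  0 < e -> (forall x y, A x -> B y -> e <= `|x - y|) ->
  0 < e1 -> 0 < e2 ->
  (hausdorff_delta m e1 A + hausdorff_delta m e2 B <=
   hausdorff_measure m (A `|` B))%E.
Proof.
move=> e0 sep e10 e20.
pose t := Num.min (e / 2) (Num.min e1 e2).
have t0 : 0 < t by rewrite !lt_min e10 e20 divr_gt0.
have te : t < e by rewrite gt_min ltr_pdivrMr// ltr_pMr// ltr1n.
have te1 : t <= e1 by rewrite !ge_min lexx orbT.
have te2 : t <= e2 by rewrite !ge_min lexx !orbT.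
apply: (le_trans _ (hausdorff_delta_le_measure m (A `|` B) t0)).
apply: le_ereal_inf_tmp => _ [F [Fd ABF] <-].
apply: (@le_trans _ _ (\sum_(i <oo) hausdorff_cost m (F i `&` A) +
                      \sum_(i <oo) hausdorff_cost m (F i `&` B))%E).
  apply: leeD; apply: ereal_inf_lbound.
    exists (fun i => F i `&` A) => //; split => [i|x Ax].
      by rewrite (le_trans (le_ediam (@subIsetl _ _ _)))// (le_trans (Fd i)).
    by have [i _ Fix] := ABF x (or_introl Ax); exists i.
  exists (fun i => F i `&` B) => //; split => [i|x Bx].
    by rewrite (le_trans (le_ediam (@subIsetl _ _ _)))// (le_trans (Fd i)).
  by have [i _ Fix] := ABF x (or_intror Bx); exists i.
rewrite -nneseriesD; [|by move=> *; exact: hausdorff_cost_ge0..].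
apply: lee_nneseries => [i _ _|i _].
  by rewrite adde_ge0// hausdorff_cost_ge0.
have [->|/set0P[x [Fx Ax]]] := eqVneq (F i `&` A) set0.
  by rewrite hausdorff_cost0 add0e le_hausdorff_cost.
have [->|/set0P[y [Fy By]]] := eqVneq (F i `&` B) set0.
  by rewrite hausdorff_cost0 adde0 le_hausdorff_cost.
exfalso; have : ((enorm (x - y))%:E <= t%:E)%E.
  apply: le_trans (Fd i); apply: ereal_sup_ubound.
  by exists x => //; exists y.
rewrite lee_fin leNgt => /negP; apply.
rewrite (lt_le_trans te)// (le_trans (sep x y Ax By))//.
exact: ler_norm_enorm.
Qed.

Lemma hausdorff_measure_separated m (e : R) A B :
  0 < e -> (forall x y, A x -> B y -> e <= `|x - y|) ->
  (hausdorff_measure m A + hausdorff_measure m B <=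
   hausdorff_measure m (A `|` B))%E.
Proof.
move=> e0 sep; have [->|Moo] := eqVneq (hausdorff_measure m (A `|` B)) +oo%E.
  by rewrite leey.
have fin X : X `<=` A `|` B -> hausdorff_measure m X \is a fin_num.
  move=> XAB; rewrite ge0_fin_numE ?hausdorff_measure_ge0//.
  by rewrite (le_lt_trans (le_hausdorff_measure m XAB))// ltey.
have finA := fin A (@subsetUl _ A B); have finB := fin B (@subsetUr _ A B).
rewrite -leeBrDr//; apply: ge_ereal_sup => _ [e1 e10 <-].
rewrite leeBrDr// addeC.
have finA1 : hausdorff_delta m e1 A \is a fin_num.
  rewrite ge0_fin_numE ?hausdorff_delta_ge0//.
  rewrite (le_lt_trans (hausdorff_delta_le_measure m A e10))//.
  by rewrite -ge0_fin_numE ?hausdorff_measure_ge0.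
rewrite -leeBrDr//; apply: ge_ereal_sup => _ [e2 e20 <-].
by rewrite leeBrDr// addeC; exact: hausdorff_delta_separated sep e10 e20.
Qed.

Section closed_caratheodory.
Variables (m : nat) (F X : set V).
Hypothesis cF : closed F.

Let H := @hausdorff_measure R d m.

Let far n : set V := [set x | forall y, F y -> n.+1%:R^-1 <= `|x - y|].

Let Xfar n := X `&` far n.

Let shell n := Xfar n.+1 `\` Xfar n.

Let far_subset n p : (n <= p)%N -> far n `<=` far p.
Proof.
move=> np x fx y Fy; apply: le_trans (fx y Fy).
by rewrite lef_pV2 ?posrE// ler_nat.
Qed.

Let shell_far k p x y : (k.+2 <= p)%N -> Xfar k.+1 x -> shell p y ->
  k.+2%:R^-1 - k.+3%:R^-1 <= `|x - y|.
Proof.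
move=> kp [_ fx] [[Xy _]]; rewrite /Xfar/= not_andP => -[//|].
move=> /existsNP[z /not_implyP[Fz /negP]]; rewrite -ltNge => yz.
have {}yz : `|y - z| <= k.+3%:R^-1.
  by rewrite (le_trans (ltW yz))// lef_pV2 ?posrE// ler_nat.
have xz := fx z Fz.
rewrite lerBlDr (le_trans xz)// (_ : x - z = (x - y) + (y - z)); last first.
  by rewrite addrA subrK.
by rewrite (le_trans (ler_normD _ _))// lerD2l.
Qed.

Let gap_gt0 k : 0 < k.+2%:R^-1 - k.+3%:R^-1 :> R.
Proof. by rewrite subr_gt0 ltf_pV2 ?posrE// ltr_nat. Qed.

Let shells (b : bool) n : set V := [set x | exists2 k, (k < n)%N & odd k = b /\ shell k x].

Let sum_shells b n : (\sum_(k < n | odd k == b) H (shell k) <= H (shells b n))%E.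
Proof.
elim: n => [|n IH]; first by rewrite big_ord0 hausdorff_measure_ge0.
rewrite big_mkcond big_ord_recr/= -big_mkcond/=.
have shS : shells b n `<=` shells b n.+1.
  by move=> x [k kn ?]; exists k => //; exact: ltnW.
case: ifPn => [/eqP nb|_]; last first.
  by rewrite adde0 (le_trans IH)//; exact: le_hausdorff_measure.
apply: (le_trans (leeD2r _ IH)).
apply: (@le_trans _ _ (H (shells b n `|` shell n))); last first.
  apply: le_hausdorff_measure => x [/shS//|sx].
  by exists n.
case: n nb {IH} shS => [|[|n]] nb shS.
- rewrite (_ : shells b 0 = set0); last by apply/seteqP; split => // x [].
  by rewrite /H hausdorff_measure0 add0e set0U.
- rewrite (_ : shells b 1 = set0); first by rewrite /H hausdorff_measure0 add0e set0U.
  by apply/seteqP; split => // x [[|//] _ []]; rewrite -nb.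
- apply: (hausdorff_measure_separated m (gap_gt0 n)) => x y [k kn [kb [sx _]]] sy.
  have {}kn : (k <= n)%N.
    move: kn; rewrite ltnS leq_eqVlt => /predU1P[kE|//].
    by move: kb; rewrite kE -nb/= => /esym; case: (odd n).
  apply: (@shell_far n n.+2) => //.
  by case: sx => Xx fx; split => //; apply: far_subset fx.
Qed.

Let shells_sub b n : shells b n `<=` X.
Proof. by move=> x [k _ [_ [[]]]]. Qed.

Let sum_shell_fin : (H X < +oo)%E -> (\sum_(k <oo) H (shell k) < +oo)%E.
Proof.
move=> Xoo; apply: (@le_lt_trans _ _ (H X + H X)%E); last by rewrite lte_add_pinfty.
apply: lime_le.
  by apply: is_cvg_nneseries => *; exact: hausdorff_measure_ge0.
apply: nearW => n; rewrite big_mkord (bigID (fun k : 'I_n => odd k == true))/=.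
apply: leeD.
  by apply: (le_trans (sum_shells true n)); apply: le_hausdorff_measure; exact: shells_sub.
rewrite (eq_bigl (fun k : 'I_n => odd k == false)); last by move=> k; case: odd.
by apply: (le_trans (sum_shells false n)); apply: le_hausdorff_measure; exact: shells_sub.
Qed.

Let out_sub n : X `&` ~` F `<=` Xfar n `|` \bigcup_(k in ~` `I_n) shell k.
Proof.
move=> x [Xx nFx].
have [p fp] : exists p, far p x.
  have : nbhs x (~` F) by apply: open_nbhs_nbhs; split => //; exact: closed_openC.
  rewrite -nbhs_ballE => -[e /= e0 eF].
  have [p] : exists p : nat, p.+1%:R^-1 < e.
    exists (Num.truncn e^-1); rewrite invf_plt ?posrE//.
    by rewrite truncnS_gt.
  move=> pe; exists p => y Fy; rewrite leNgt; apply/negP => xy.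
  apply: (eF y) => //; rewrite -ball_normE/=; exact: lt_trans xy pe.
have [fn|nfn] := pselect (far n x); first by left; split.
right.
have ex : exists q, `[< far q x >] by exists p; apply/asboolP.
case: (ex_minnP ex) => q /asboolP fq minq.
case: q fq minq => [|q] fq minq.
  by exfalso; apply: nfn; exact: far_subset fq.
exists q => /=.
  move=> qn; apply: nfn; exact: far_subset fq.
split; first by split.
move=> [_ fq']; have := minq q (asboolT fq').
by rewrite ltnn.
Qed.

Lemma closed_caratheodory_le :
  (hausdorff_measure m (X `&` F) + hausdorff_measure m (X `&` ~` F) <=
   hausdorff_measure m X)%E.
Proof.
rewrite -/H; have [->|Xoo] := eqVneq (H X) +oo%E; first by rewrite leey.
have {}Xoo : (H X < +oo)%E by rewrite ltey.
have tail : (\sum_(n <= k <oo) H (shell k))%E @[n --> \oo] --> 0%E.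
  apply: nneseries_tail_cvg; first exact: sum_shell_fin.
  by move=> *; exact: hausdorff_measure_ge0.
have tailX : (H X + \sum_(n <= k <oo) H (shell k))%E @[n --> \oo] --> H X.
  rewrite -[X in _ --> X]adde0; apply: cvgeD => //; last exact: cvg_cst.
  by rewrite fin_num_adde_defl.
rewrite -(cvg_lim _ tailX)//; apply: lime_ge; first by apply/cvg_ex; exists (H X).
apply: nearW => n.
apply: (@le_trans _ _ (H (X `&` F) + (H (Xfar n) + \sum_(n <= k <oo) H (shell k)))%E).
  apply: leeD2l; apply: (le_trans (le_hausdorff_measure m (@out_sub n))).
  apply: (le_trans (outer_measureU2 _ _ _)); apply: leeD2l.
  exact: outer_measure_sigma_subadditive_tail.
rewrite addeA leeD2r//.
apply: (@le_trans _ _ (H ((X `&` F) `|` Xfar n))).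
  apply: (@hausdorff_measure_separated m n.+1%:R^-1); first by rewrite invr_gt0.
  by move=> x y [_ Fx] [_ fy]; rewrite distrC; exact: fy.
by apply: le_hausdorff_measure => x [[]|[]].
Qed.

End closed_caratheodory.
End hausdorff_borel.

Section borel_hausdorff_measure.
Context {R : realType} {d : nat}.
Local Notation V := 'rV[R]_d.
Local Notation borel := (g_sigma_algebraType (@open V)).

Lemma borel_caratheodory m (A : set borel) :
  measurable A -> (@hausdorff_measure R d m).-caratheodory A.
Proof.
apply: smallest_sub => [|U oU].
  split; first exact: caratheodory_measurable_set0.
  - by move=> B mB; rewrite setTD; exact: caratheodory_measurable_setC.
  - by move=> F mF; exact: caratheodory_measurable_bigcup.
rewrite -(setCK U); apply: caratheodory_measurable_setC.
apply: le_caratheodory_measurable => X.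
exact/closed_caratheodory_le/open_closedC.
Qed.

Definition borel_hausdorff (m : nat) : set borel -> \bar R := hausdorff_measure m.

Let borel_hausdorff_sigma_additive m : semi_sigma_additive (borel_hausdorff m).
Proof.
move=> F mF tF mUF.
by apply: (@caratheodory_measure_sigma_additive _ _ (@hausdorff_measure R d m));
  [move=> i|exact: tF|]; exact: borel_caratheodory.
Qed.

HB.instance Definition _ m := isMeasure.Build _ borel R (borel_hausdorff m)
  (hausdorff_measure0 m) (hausdorff_measure_ge0 m)
  (@borel_hausdorff_sigma_additive m).

Definition boundary (K : set V) : set V := closure K `\` K°.

Lemma measurable_boundary (K : set V) : measurable (boundary K : set borel).
Proof.
apply: measurableD.
  rewrite -(setCK (closure K)); apply: measurableC; apply: sub_sigma_algebra.
  by rewrite openC; exact: closed_closure.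
by apply: sub_sigma_algebra; exact: open_interior.
Qed.

Definition surface_area (K : set V) : {measure set borel -> \bar R} :=
  mrestr (borel_hausdorff d.-1) (measurable_boundary K).

(* [dirac point] is only a default value, used when the boundary has surface
   area 0 or +oo; this never happens for a convex body of dimension >= 1. *)
Definition uniform_boundary (K : set V) : probability borel R :=
  mnormalize (surface_area K) (dirac point).

End borel_hausdorff_measure.

Section iid.
Context {dis} {T : measurableType dis} {R : realType}.

Definition tuple_cons n (z : T * n.-tuple T) : n.+1.-tuple T :=
  [tuple of z.1 :: z.2].

Lemma measurable_tuple_cons n : measurable_fun [set: T * n.-tuple T] (@tuple_cons n).
Proof. exact: measurable_cons. Qed.

HB.instance Definition _ n :=
  isMeasurableFun.Build _ _ _ _ (@tuple_cons n) (@measurable_tuple_cons n).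

(* The n-fold product of P, i.e. the joint law of n independent P-distributed
   random elements. *)
Fixpoint iid (P : probability T R) (n : nat) : probability (n.-tuple T) R :=
  match n with
  | 0 => dirac [tuple]
  | n'.+1 => distribution (P \x iid P n')%E (@tuple_cons n')
  end.

End iid.

Section random_simplex.
Context {R : realType} {d : nat}.
Local Notation V := 'rV[R]_d.

Definition convex_body (K : set V) : Prop :=
  [/\ compact K, @convex_set R V K & K° !=set0].

Definition convex_hull (A : set V) : set V := smallest (@convex_set R V) A.

(* The cube [0,1]^m x {0}^(d-m). *)
Definition unit_cube (m : nat) : set V :=
  [set x : V | forall i : 'I_d, 0 <= x 0 i <= (i < m)%N%:R].

(* m-dimensional volume for m <= d: m-dimensional Hausdorff measure, scaled
   so that it is 1 on m-dimensional unit cubes. *)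
Definition volume (m : nat) (A : set V) : R :=
  fine (hausdorff_measure m A) / fine (hausdorff_measure m (unit_cube m)).

Definition simplex_volume (n : nat) (x : n.-tuple V) : R :=
  volume n.-1 (convex_hull [set` x]).

Definition moment (n k : nat) (K : set V) : \bar R :=
  'E_(iid (uniform_boundary K) n) [fun x => simplex_volume x ^+ k].

End random_simplex.

(* Main.v *)
Require Import Defs.
From mathcomp Require Import all_boot all_order all_algebra perm.
From mathcomp Require Import all_classical all_reals all_analysis.
From mathcomp Require Import measurable_realfun.
From mathcomp Require Import lra ring zify.
Import Order.TTheory GRing.Theory Num.Theory.
Import numFieldNormedType.Exports.

Set Implicit Arguments.
Unset Strict Implicit.
Unset Printing Implicit Defensive.

Local Open Scope classical_set_scope.
Local Open Scope ring_scope.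

(** Write R^d = R x R^m. Let L be the flat bipyramid |z| + |w|/eps <= 1 over the cube
|z| <= 1 (sup norm), and let K be L with the part w > eps (1 - rho) of its upper tip cut
off. The boundaries of K and L differ only near the apex, where a pyramid surface C
is replaced by its smaller base D. The ratio of the areas of C and D exceeds 1 and depends
only on eps.

In the integral defining the moment, replace the law of L by the law of K in one variable
at a time. If F x is the mean of the k-th power of the volume with that vertex fixed at x
and the others random, the replacement moves mass from near the apex to the rest of the
boundary, so it raises the mean as soon as F (apex) is below the mean of F under L. For
rho small this works with a uniform margin, F being Lipschitz. Now F is convex and L is
symmetric, so the mean of F exceeds F 0; the excess is bounded below as eps tends to 0,
because the midpoint inequality is strict near suitable vertices in the plane w = 0.
Since |apex| = eps, F (apex) is close to F 0.

Convexity of the volume in one vertex, like its Lipschitz bound, comes from the uniqueness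
of translation-invariant measures: Hausdorff measure of linear images scales by a factor
that is multiplicative, equal to 1 for shears and to t for stretching one coordinate by t,
so the volume of a simplex is a constant times the length of the component of
one edge orthogonal to the others. *)

(** F depends on the laws of the other vertices, some already replaced and some not, hence on eps
    and rho. Every estimate of F must therefore hold for all these mixtures at once, with constants
    fixed in this order: the gain [w] and the radius [eta], from the dimension, n and k; the mass
    [beta] of balls of radius [eta], valid for all eps <= eta and all rho; then eps; then the excess
    of the area of C over that of D, which depends on eps; last rho. Rho can come last because the
    areas of C and D both scale as rho^m.

    The vertices near which the midpoint inequality is strict lie in w = 0 because the boundary of a
    flat bipyramid keeps a definite mass there. They include 0, so that moving the reflected vertex
    to 0 flattens the simplex. Its n - 1 orthogonal edges fit in the m-dimensional plane since n <=
    d.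

    No area formula is needed for C: a strict inequality with D is enough. It holds since projection
    does not increase area and the cone is linear over one small cube. *)

(** * Lipschitz maps and Hausdorff measure *)

Section euclidean_norm.
Context {R : realType} {d : nat}.
Implicit Types (x y : 'rV[R]_d).

Lemma enorm_ge0 x : 0 <= enorm x. Proof. exact: sqrtr_ge0. Qed.

Lemma sqr_enorm x : enorm x ^+ 2 = \sum_i x 0 i ^+ 2.
Proof. by rewrite sqr_sqrtr// sumr_ge0// => i _; exact: sqr_ge0. Qed.

Lemma enormZ a x : enorm (a *: x) = `|a| * enorm x.
Proof.
rewrite /enorm -sqrtr_sqr -sqrtrM ?sqr_ge0// mulr_sumr; congr Num.sqrt.
by apply: eq_bigr => i _; rewrite mxE exprMn.
Qed.

Lemma enormN x : enorm (- x) = enorm x.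
Proof. by rewrite -scaleN1r enormZ normrN normr1 mul1r. Qed.

Lemma enorm_distC x y : enorm (x - y) = enorm (y - x).
Proof. by rewrite -enormN opprB. Qed.

Lemma enorm0 : enorm (0 : 'rV[R]_d) = 0.
Proof. by rewrite -(scale0r 0) enormZ normr0 mul0r. Qed.

Lemma enorm_eq0 x : (enorm x == 0) = (x == 0).
Proof.
apply/eqP/eqP => [x0|->]; last exact: enorm0.
have := ler_norm_enorm x; rewrite x0 => /(conj (normr_ge0 x))/andP/le_anti.
by move=> /esym/normr0_eq0.
Qed.

Lemma enorm_gt0 x : (0 < enorm x) = (x != 0).
Proof. by rewrite lt_def enorm_eq0 enorm_ge0 andbT. Qed.

Lemma dotmxE x y : (x *m y^T) 0 0 = \sum_i x 0 i * y 0 i.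
Proof. by rewrite mxE; apply: eq_bigr => i _; rewrite mxE. Qed.

Lemma enormD x y : enorm (x + y) <= enorm x + enorm y.
Proof.
set A := enorm x; set B := enorm y; pose P := \sum_i x 0 i * y 0 i.
have A0 : 0 <= A by exact: enorm_ge0.
have B0 : 0 <= B by exact: enorm_ge0.
(* Cauchy-Schwarz: the sum of squares below equals [2 * (A * B) * (A * B - P)], and if [A * B = 0]
   one of the vectors is zero. *)
have PAB : P <= A * B.
  have : 0 <= \sum_i (B * x 0 i - A * y 0 i) ^+ 2.
    by apply: sumr_ge0 => i _; exact: sqr_ge0.
  have -> : \sum_i (B * x 0 i - A * y 0 i) ^+ 2 = 2 * (A * B) * (A * B - P).
    under eq_bigr => i _ do rewrite sqrrB !exprMn.
    rewrite big_split sumrB -!mulr_sumr -!sqr_enorm -/A -/B/=.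
    rewrite (_ : \sum_i _ = 2 * (A * B) * P); first by ring.
    by rewrite /P mulr_sumr; apply: eq_bigr => i _; ring.
  move=> h; have [AB0|] := ltP 0 (A * B).
    by move: h; rewrite pmulr_rge0 ?subr_ge0// mulr_gt0.
  move=> AB0; have {}AB0 : A * B = 0 by apply/le_anti; rewrite AB0 mulr_ge0.
  rewrite AB0; move/eqP: AB0; rewrite mulf_eq0 !enorm_eq0 => /orP[]/eqP z0.
    by rewrite /P big1// => i _; rewrite z0 mxE mul0r.
  by rewrite /P big1// => i _; rewrite z0 mxE mulr0.
rewrite -(@ler_pXn2r _ 2)// ?nnegrE ?enorm_ge0 ?addr_ge0// sqr_enorm.
rewrite (eq_bigr (fun i => x 0 i ^+ 2 + 2 * (x 0 i * y 0 i) + y 0 i ^+ 2)).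
  rewrite !big_split/= -mulr_sumr -!sqr_enorm -/A -/B -/P sqrrD.
  by rewrite lerD2r lerD2l mulr_natl lerMn2r PAB orbT.
by move=> i _; rewrite mxE sqrrD mulr_natl.
Qed.

Lemma coord_norm_le x i : `|x 0 i| <= `|x|.
Proof.
have -> : `|x| = \big[Num.max/0]_ij `|x ij.1 ij.2| by exact: mx_normrE.
exact: (le_bigmax _ (fun ij : 'I_1 * 'I_d => `|x ij.1 ij.2|) (0, i)).
Qed.

Lemma enorm_le_norm x : enorm x <= d.+1%:R * `|x|.
Proof.
rewrite -(@ler_pXn2r _ 2)// ?nnegrE ?enorm_ge0 ?mulr_ge0// sqr_enorm.
apply: (@le_trans _ _ (\sum_(i < d) `|x| ^+ 2)).
  apply: ler_sum => i _; rewrite -(real_normK (num_real (x 0 i))).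
  by rewrite lerXn2r ?nnegrE ?coord_norm_le.
rewrite sumr_const card_ord exprMn -[leLHS]mulr_natl ler_wpM2r ?sqr_ge0//.
by rewrite -natrX ler_nat expnS expn1; nia.
Qed.

End euclidean_norm.

Section hausdorff_lipschitz.
Context {R : realType}.

Lemma expe_mulr (C : R) (z : \bar R) m : 0 <= C -> (0 <= z)%E ->
  ((C%:E * z) ^+ m = (C ^+ m)%:E * z ^+ m)%E.
Proof.
move=> C0 z0; elim: m => [|m IH]; first by rewrite !expe0 mule1.
by rewrite !expeS IH exprS EFinM muleACA.
Qed.

Lemma le_expe (y z : \bar R) m : (0 <= y)%E -> (y <= z)%E -> (y ^+ m <= z ^+ m)%E.
Proof.
move=> y0 yz; elim: m => [|m IH]; first by rewrite !expe0.
by rewrite !expeS lee_pmul// expe_ge0.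
Qed.

(** A cover of the image under [f] is pulled back to [A] and pushed forward by [g], which multiplies
    diameters by at most [C]. With two parametrisations of one type, the lemma can be applied in
    both directions without inverting a map. *)
Lemma hausdorff_lipschitz m d d' (X : Type) (A : set X) (f : X -> 'rV[R]_d)
    (g : X -> 'rV[R]_d') (C : R) : 0 < C ->
  (forall x y, A x -> A y -> enorm (g x - g y) <= C * enorm (f x - f y)) ->
  (hausdorff_measure m (g @` A) <= (C ^+ m)%:E * hausdorff_measure m (f @` A))%E.
Proof.
move=> C0 gf; apply: ge_ereal_sup => _ [e e0 <-].
have eC : 0 < e / C by rewrite divr_gt0.
apply: (@le_trans _ _ ((C ^+ m)%:E * hausdorff_delta m (e / C) (f @` A))%E); last first.
  by apply: lee_wpmul2l; [rewrite lee_fin exprn_ge0// ltW|exact: hausdorff_delta_le_measure].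
pose G F : set 'rV[R]_d' := g @` (A `&` f @^-1` F).
have GF F : G F !=set0 -> F !=set0 by move=> [_ [x [_ Fx] _]]; exists (f x).
have dG F : (ediam (G F) <= C%:E * ediam F)%E.
  apply: ge_ereal_sup => _ [_ [x [Ax Fx] <-]] [_ [y [Ay Fy] <-]] <-.
  apply: (@le_trans _ _ (C%:E * (enorm (f x - f y))%:E)%E).
    by rewrite -EFinM lee_fin; exact: gf.
  rewrite lee_wpmul2l ?lee_fin ?(ltW C0)//.
  by apply: ereal_sup_ubound; exists (f x) => //; exists (f y).
rewrite -lee_pdivrMl ?exprn_gt0//; apply: le_ereal_inf_tmp => _ [F [Fd AF] <-].
rewrite lee_pdivrMl ?exprn_gt0// -nneseriesZl; last first.
  by move=> *; exact: hausdorff_cost_ge0.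
apply: (@le_trans _ _ (\sum_(i <oo) hausdorff_cost m (G (F i)))%E).
  apply: ereal_inf_lbound; exists (G \o F) => //; split.
    move=> i /=; apply: (le_trans (dG _)).
    by rewrite -lee_pdivlMl// -EFinM mulrC; exact: Fd.
  move=> _ [x Ax <-]; have [i _ Fi] : (\bigcup_i F i) (f x) by apply: AF; exists x.
  by exists i => //; exists x.
apply: lee_nneseries => [i _ _|i _]; first exact: hausdorff_cost_ge0.
rewrite /hausdorff_cost; case: eqVneq => [_|/set0P G0].
  by case: ifPn => [_|/set0P F0];
    rewrite ?mule0// mule_ge0 ?expe_ge0 ?ediam_ge0// lee_fin exprn_ge0// ltW.
have F0 := GF _ G0; rewrite ifF; last by apply/negbTE/set0P.
rewrite -expe_mulr ?(ltW C0) ?ediam_ge0//.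
exact/le_expe/dG/ediam_ge0.
Qed.

Lemma hausdorff_isometry m d d' (X : Type) (A : set X) (f : X -> 'rV[R]_d)
    (g : X -> 'rV[R]_d') :
  (forall x y, A x -> A y -> enorm (g x - g y) = enorm (f x - f y)) ->
  hausdorff_measure m (g @` A) = hausdorff_measure m (f @` A).
Proof.
move=> gf; apply/eqP; rewrite eq_le; apply/andP; split.
  have := @hausdorff_lipschitz m d d' X A f g 1 ltr01.
  by rewrite expr1n mul1e; apply => x y Ax Ay; rewrite mul1r gf.
have := @hausdorff_lipschitz m d' d X A g f 1 ltr01.
by rewrite expr1n mul1e; apply => x y Ax Ay; rewrite mul1r gf.
Qed.

Lemma hausdorff_similarity m d d' (X : Type) (A : set X) (f : X -> 'rV[R]_d)
    (g : X -> 'rV[R]_d') (C : R) : 0 < C ->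
  (forall x y, A x -> A y -> enorm (g x - g y) = C * enorm (f x - f y)) ->
  hausdorff_measure m (g @` A) = ((C ^+ m)%:E * hausdorff_measure m (f @` A))%E.
Proof.
move=> C0 gf; apply/eqP; rewrite eq_le; apply/andP; split.
  by apply: hausdorff_lipschitz => // x y Ax Ay; rewrite gf.
rewrite -lee_pdivlMl ?exprn_gt0// -exprVn.
apply: hausdorff_lipschitz; first by rewrite invr_gt0.
by move=> x y Ax Ay; rewrite gf// mulKf// gt_eqF.
Qed.

Lemma hausdorff_measureU m d (A X : set 'rV[R]_d) :
  measurable (A : set (g_sigma_algebraType (@open 'rV[R]_d))) ->
  hausdorff_measure m X =
  (hausdorff_measure m (X `&` A) + hausdorff_measure m (X `\` A))%E.
Proof. by move=> mA; exact: (borel_caratheodory m mA X). Qed.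

End hausdorff_lipschitz.

(** * Finiteness and positivity of the Hausdorff measure of cubes *)

Section hausdorff_cube.
Context {R : realType}.

Lemma normr_rV_le d (x : 'rV[R]_d) e : 0 <= e ->
  (forall i, `|x 0 i| <= e) -> `|x| <= e.
Proof.
move=> e0 xe.
have -> : `|x| = \big[Num.max/0]_ij `|x ij.1 ij.2| by exact: mx_normrE.
by apply: bigmax_le => // -[i j] _ /=; rewrite (ord1 i).
Qed.

Definition cube d : set 'rV[R]_d := [set x | forall i, 0 <= x 0 i < 1].
Arguments cube : clear implicits.

Let hausdorff_delta_cube m r q (delta : R) : (r <= m)%N ->
  r.+1%:R / q.+1%:R <= delta ->
  (hausdorff_delta m delta (cube r) <=
   (r.+1%:R ^+ m * q.+1%:R^-1 ^+ (m - r))%:E)%E.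
Proof.
move=> rm qd; have q0 : 0 < q.+1%:R :> R by rewrite ltr0n.
pose T : finType := {ffun 'I_r -> 'I_q.+1}.
pose cell (z : T) : set 'rV[R]_r :=
  [set x | forall i, (z i)%:R <= q.+1%:R * x 0 i < (z i)%:R + 1].
pose F i := if insub i is Some j then cell (enum_val (j : 'I_#|T|)) else set0.
have dcell z : (ediam (cell z) <= (r.+1%:R / q.+1%:R)%:E)%E.
  apply: ge_ereal_sup => _ [x zx] [y zy] <-; rewrite lee_fin.
  rewrite (le_trans (enorm_le_norm _))// ler_wpM2l//.
  apply: normr_rV_le => [|i]; first by rewrite invr_ge0 ltW.
  have /andP[? ?] := zx i; have /andP[? ?] := zy i.
  rewrite !mxE -(ler_pM2l q0) mulfV ?gt_eqF// -{1}(gtr0_norm q0) -normrM mulrBr.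
  by rewrite ler_norml; apply/andP; split; lra.
apply: (@le_trans _ _ (\sum_(i <oo) hausdorff_cost m (F i))%E).
  apply: ereal_inf_lbound; exists F => //; split.
    move=> i; rewrite /F; case: insubP => [j _ _|_].
      by rewrite (le_trans (dcell _))// lee_fin.
    by rewrite /ediam [X in ereal_sup X](_ : _ = set0) ?ereal_sup0 ?leNye//;
       apply/seteqP; split => // ? [].
  move=> x Qx.
  have h i : (Num.truncn (q.+1%:R * x 0 i)%R < q.+1)%N.
    have /andP[x0 x1] := Qx i.
    by rewrite truncn_lt_nat ?mulr_ge0 ?(ltW q0)// gtr_pMr.
  pose z : T := [ffun i => Ordinal (h i)].
  exists (enum_rank z) => //; rewrite /F valK enum_rankK => i.
  have /andP[x0 x1] := Qx i; rewrite ffunE/= truncn_le ?mulr_ge0 ?(ltW q0)//=.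
  by rewrite natr1 truncnS_gt.
rewrite (nneseries_split 0 #|T|); last by move=> *; exact: hausdorff_cost_ge0.
rewrite add0n [X in (_ + X)%E]eseries0 ?adde0; last first.
  move=> i iT _; rewrite /F insubF ?hausdorff_cost0//.
  by apply/negbTE; rewrite -leqNgt.
rewrite big_mkord.
apply: (@le_trans _ _ (\sum_(i < #|T|) ((r.+1%:R / q.+1%:R) ^+ m)%:E)%E).
  apply: lee_sum => i _; rewrite /F valK /hausdorff_cost.
  case: ifPn => [_|/set0P c0]; first by rewrite lee_fin exprn_ge0 ?divr_ge0.
  by rewrite EFin_expe le_expe// ediam_ge0.
rewrite sumEFin lee_fin sumr_const card_ord card_ffun !card_ord.
rewrite -[leLHS]mulr_natl natrX exprMn mulrCA ler_wpM2l ?exprn_ge0//.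
rewrite -[X in _ * _ ^+ X](subnK rm) exprD mulrCA.
by rewrite -exprMn mulfV ?gt_eqF// expr1n mulr1.
Qed.

Lemma hausdorff_cube_lty m : (hausdorff_measure m (cube m) < +oo)%E.
Proof.
apply: (@le_lt_trans _ _ (m.+1%:R ^+ m)%:E); last exact: ltry.
apply: ge_ereal_sup => _ [e e0 <-].
have := @hausdorff_delta_cube m m (Num.truncn (m.+1%:R / e)) e (leqnn _).
rewrite subnn expr0 mulr1; apply.
rewrite ler_pdivrMr ?ltr0n// -ler_pdivrMl// mulrC.
by rewrite ltW// truncnS_gt.
Qed.

Lemma hausdorff_cube_eq0 m r : (r < m)%N -> hausdorff_measure m (cube r) = 0%E.
Proof.
move=> rm; apply/eqP; rewrite eq_le hausdorff_measure_ge0 andbT.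
apply: ge_ereal_sup => _ [e e0 <-]; apply/lee_addgt0Pr => t t0; rewrite add0e.
pose c : R := r.+1%:R.
pose q := Num.truncn (Num.max (c / e) (c ^+ m / t)).
have /andP[qe qt] : (c / e < q.+1%:R) && (c ^+ m / t < q.+1%:R).
  by rewrite -gt_max truncnS_gt.
have q0 : 0 < q.+1%:R :> R by rewrite ltr0n.
apply: (le_trans (@hausdorff_delta_cube m r q e (ltnW rm) _)).
  by rewrite ler_pdivrMr// -ler_pdivrMl// mulrC ltW.
rewrite lee_fin (@le_trans _ _ (c ^+ m * q.+1%:R^-1))//.
  rewrite ler_wpM2l ?exprn_ge0 ?ler0n// exprVn lef_pV2 ?posrE ?exprn_gt0//.
  rewrite -natrX ler_nat -[X in (X <= _)%N]expn1 leq_pexp2l// subn_gt0//.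
by rewrite ler_pdivrMr// -ler_pdivrMl// mulrC ltW.
Qed.

Let bounded_sub_cube r (A : set 'rV[R]_r) (N : R) : 0 < N ->
  (forall x, A x -> `|x| < N) ->
  A `<=` (fun x => (2 * N) *: x - const_mx N) @` cube r.
Proof.
move=> N0 AN x /AN xN.
have N2 : 2 * N != 0 by rewrite gt_eqF// mulr_gt0.
exists ((2 * N)^-1 *: (x + const_mx N)); last first.
  by rewrite scalerA mulfV// scale1r addrK.
move=> i; rewrite !mxE.
have : `|x 0 i| < N by rewrite (le_lt_trans (coord_norm_le _ _)).
rewrite ltr_norml => /andP[? ?].
rewrite mulr_ge0 ?invr_ge0 ?mulr_ge0 ?(ltW N0)//=; last by lra.
by rewrite -ltr_pdivlMl ?invr_gt0 ?mulr_gt0// invrK mulr1; lra.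
Qed.

Let hausdorff_bounded_le m r (A : set 'rV[R]_r) (N : R) : 0 < N ->
  (forall x, A x -> `|x| < N) ->
  (hausdorff_measure m A <= ((2 * N) ^+ m)%:E * hausdorff_measure m (cube r))%E.
Proof.
move=> N0 /(bounded_sub_cube N0) /(le_hausdorff_measure m) /le_trans; apply.
rewrite -{2}[cube r]image_id; apply: hausdorff_lipschitz; first by rewrite mulr_gt0.
move=> x y _ _; rewrite opprB addrA subrK -scalerBr enormZ.
by rewrite ger0_norm// mulr_ge0// ltW.
Qed.

Lemma hausdorff_bounded_lty m (A : set 'rV[R]_m) (N : R) :
  (forall x, A x -> `|x| < N) -> (hausdorff_measure m A < +oo)%E.
Proof.
(* [N] may be nonpositive when [A] is empty, hence the maximum with 1. *)
move=> AN; have N0 : 0 < Num.max N 1 by rewrite lt_max ltr01 orbT.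
apply: (le_lt_trans (hausdorff_bounded_le m N0 _)).
  by move=> x /AN xN; rewrite lt_max xN.
by rewrite lte_mul_pinfty ?lee_fin ?exprn_ge0 ?hausdorff_cube_lty// mulr_ge0// ltW.
Qed.

Lemma hausdorff_bounded_eq0 m r (A : set 'rV[R]_r) (N : R) : (r < m)%N ->
  (forall x, A x -> `|x| < N) -> hausdorff_measure m A = 0%E.
Proof.
move=> rm AN; have N0 : 0 < Num.max N 1 by rewrite lt_max ltr01 orbT.
apply/eqP; rewrite eq_le hausdorff_measure_ge0 andbT.
apply: (le_trans (hausdorff_bounded_le m N0 _)).
  by move=> x /AN xN; rewrite lt_max xN.
by rewrite hausdorff_cube_eq0// mule0.
Qed.

End hausdorff_cube.
Arguments cube {R} d _.

Section iid_box.
Context {dis} {T : measurableType dis} {R : realType}.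

Lemma mnormalizeE (mu : {measure set T -> \bar R}) (P : probability T R) (A : set T) :
  (0 < mu setT)%E -> (mu setT < +oo)%E ->
  mnormalize mu P A = (mu A * (fine (mu setT))^-1%:E)%E.
Proof.
move=> mu0 muoo; rewrite /mnormalize ifF//.
by rewrite gt_eqF//= lt_eqF.
Qed.

Lemma mnormalize1 (mu : {measure set T -> \bar R}) (P : probability T R) (A : set T) :
  mu setT = 1%E -> mnormalize mu P A = mu A.
Proof. by move=> mu1; rewrite mnormalizeE mu1 ?lte01 ?ltry//= invr1 mule1. Qed.

Lemma measurable_tuple_box n (A : 'I_n -> set T) : (forall i, measurable (A i)) ->
  measurable [set t : n.-tuple T | forall i, A i (tnth t i)].
Proof.
move=> mA; rewrite (_ : mkset _ = \bigcap_(i : 'I_n) ((@tnth n T)^~ i @^-1` A i)).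
  apply: fin_bigcap_measurable => // i _; rewrite -[X in measurable X]setTI.
  exact: measurable_tnth.
by apply/seteqP; split => t /= h i; [move=> _|]; exact: h.
Qed.

Lemma iid_box (P : probability T R) n (A : 'I_n -> set T) :
  (forall i, measurable (A i)) ->
  iid P n [set t | forall i, A i (tnth t i)] = (\prod_(i < n) P (A i))%E.
Proof.
elim: n A => [|n IH] A mA.
  rewrite big_ord0/= diracE mem_set// => -[].
  by move=> i; case.
rewrite big_ord_recl -IH => [|i]; last exact: mA.
rewrite /= /distribution/= /pushforward.
rewrite -product_measure1E//; last first.
  by apply: (measurable_tuple_box (A := fun i => A (lift ord0 i))) => i; exact: mA.
congr ((P \x iid P n)%E _); apply/seteqP; split => -[x t]/=.
  by move=> h; split => [|i]; [exact: (h ord0)|move: (h (lift ord0 i)); rewrite tnthS].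
by move=> [Ax At] i; case: (unliftP ord0 i) => [j|] ->//; rewrite tnthS; exact: At.
Qed.

End iid_box.

Section hausdorff_cube_gt0.
Context {R : realType}.

Lemma lee_prod_nneg (I : Type) (r : seq I) (f g : I -> \bar R) :
  (forall i, 0 <= f i)%E -> (forall i, f i <= g i)%E ->
  (\prod_(i <- r) f i <= \prod_(i <- r) g i)%E.
Proof.
move=> f0 fg; suff : (0 <= \prod_(i <- r) f i <= \prod_(i <- r) g i)%E by case/andP.
elim: r => [|i r /andP[h0 h]]; first by rewrite !big_nil lee01 lexx.
by rewrite !big_cons mule_ge0//= lee_pmul.
Qed.

(** Mass distribution argument: a set of diameter [D] lies in a box of side [2 * D], which has mass
    at most [(2 * D) ^+ m] for the uniform law on the cube. A cover has total mass at least 1, so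
    its costs sum to at least [2^-1 ^+ m]. The uniform law is an [iid] product on tuples, which are
    read as row vectors. *)
Lemma hausdorff_cube_gt0 m : (0 < hausdorff_measure m (@cube R m))%E.
Proof.
pose I : set R := `[0, 1[%classic.
have mI : measurable I by exact: measurable_itv.
pose P : probability (measurableTypeR R) R :=
  mnormalize (mrestr lebesgue_measure mI) (dirac (0 : measurableTypeR R)).
have PE (A : set R) : P A = lebesgue_measure (A `&` I).
  have h : mrestr lebesgue_measure mI [set: measurableTypeR R] = 1%E.
    rewrite /mrestr setTI lebesgue_measure_itv/= lte_fin ltr01.
    by rewrite sube0.
  exact: (mnormalize1 (mu := mrestr lebesgue_measure mI) (dirac (0 : measurableTypeR R)) A h).
apply: (@lt_le_trans _ _ (2^-1 ^+ m)%:E); first by rewrite lte_fin exprn_gt0.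
apply: (le_trans _ (hausdorff_delta_le_measure m (cube m) ltr01)).
apply: le_ereal_inf_tmp => _ [F [Fd AF] <-].
pose D i := fine (ediam (F i)).
(* The box is centred at a chosen point of [F i]; the default 0 occurs only for empty [F i], which
   [B] treats apart. *)
pose J i (j : 'I_m) : set (measurableTypeR R) :=
  `[xget 0 (F i) 0 j - D i, xget 0 (F i) 0 j + D i]%classic.
pose box i := [set t : m.-tuple (measurableTypeR R) | forall j, J i j (tnth t j)].
pose B i := if F i == set0 then set0 else box i.
have mB i : measurable (B i).
  rewrite /B; case: ifP => // _; apply: (measurable_tuple_box (A := J i)) => j.
  exact: measurable_itv.
have dF i : F i !=set0 -> ediam (F i) = (D i)%:E.
  move=> F0; rewrite fineK// ge0_fin_numE ?ediam_ge0//.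
  by rewrite (le_lt_trans (Fd i))// ltry.
have D0 i : F i !=set0 -> 0 <= D i by move=> F0; rewrite -lee_fin -dF// ediam_ge0.
have cover : [set t : m.-tuple (measurableTypeR R) | forall j, I (tnth t j)] `<=` \bigcup_i B i.
  move=> t It; have [|i _ Fi] := AF (\row_j tnth t j).
    by move=> j; rewrite mxE; have := It j; rewrite /I/= in_itv.
  have F0 : F i !=set0 by exists (\row_j tnth t j).
  exists i => //; rewrite /B ifF; last by apply/negbTE/set0P.
  move=> j; rewrite /J/= in_itv/= -ler_distl.
  have Fx : F i (xget 0 (F i)) by case: F0 => x Fx; exact: (xgetI 0 Fx).
  have : ((enorm (\row_j tnth t j - xget 0 (F i)))%:E <= (D i)%:E)%E.
    rewrite -dF//; apply: ereal_sup_ubound.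
    by exists (\row_j tnth t j) => //; exists (xget 0 (F i)).
  rewrite lee_fin; apply: le_trans; apply: le_trans (ler_norm_enorm _).
  by apply: le_trans (coord_norm_le _ j); rewrite !mxE.
have : (1%:E <= \sum_(i <oo) iid P m (B i))%E.
  apply: (@le_trans _ _ (iid P m [set t : m.-tuple (measurableTypeR R) | forall j, I (tnth t j)])).
    rewrite (iid_box P (A := fun=> I))// big1// => i _; rewrite PE setIid lebesgue_measure_itv/=.
    by rewrite lte_fin ltr01 sube0.
  apply: measure_sigma_subadditive => //.
  exact: (measurable_tuple_box (A := fun=> I)).
move=> h; rewrite exprVn -[_%:E]mule1 lee_pdivrMl ?exprn_gt0// (le_trans h)//.
rewrite -nneseriesZl; last by move=> *; exact: hausdorff_cost_ge0.
apply: lee_nneseries => [i _ _|i _]; first exact: measure_ge0.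
rewrite /hausdorff_cost /B; case: ifPn => [_|/set0P F0]; first by rewrite measure0 mule0.
rewrite dF// (iid_box P (A := J i)) => [|j]; last exact: measurable_itv.
rewrite -EFin_expe -EFinM -exprMn.
apply: (@le_trans _ _ (\prod_(j < m) (2 * D i)%:E)%E); last first.
  by rewrite prodEFin lee_fin prodr_const card_ord.
apply: lee_prod_nneg => j; [exact: measure_ge0|rewrite PE].
apply: (@le_trans _ _ (lebesgue_measure (J i j))).
  by apply: le_measure; rewrite ?inE//; [apply: measurableI|]; exact: measurable_itv.
rewrite lebesgue_measure_itv/= lte_fin; case: ifPn => _.
  by rewrite -EFinB lee_fin; lra.
by rewrite lee_fin mulr_ge0// D0.
Qed.

End hausdorff_cube_gt0.

(** * Uniqueness of translation-invariant measures *)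

Notation borel_rV R d := (g_sigma_algebraType (@open 'rV[R]_d)).

Section borel_row.
Context {R : realType}.

Lemma open_borel d (U : set 'rV[R]_d) : open U -> measurable (U : set (borel_rV R d)).
Proof. exact: sub_sigma_algebra. Qed.

Lemma closed_borel d (F : set 'rV[R]_d) : closed F -> measurable (F : set (borel_rV R d)).
Proof.
move=> cF; have oF : open (~` F) by rewrite openC.
by rewrite -(setCK F); apply: measurableC; exact: open_borel.
Qed.

Lemma continuous_borel d d' (f : 'rV[R]_d -> 'rV[R]_d') : continuous f ->
  measurable_fun [set: borel_rV R d] (f : borel_rV R d -> borel_rV R d').
Proof.
move=> cf; apply: (@measurability _ _ (borel_rV R d) (borel_rV R d') setT f open) => //.
move=> _ [U oU <-]; rewrite setTI; apply: open_borel.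
by apply: open_comp => // x _; exact: cf.
Qed.

Lemma continuous_borel_real d (f : 'rV[R]_d -> R) : continuous f ->
  measurable_fun [set: borel_rV R d] (f : borel_rV R d -> R).
Proof.
move=> cf; apply: (measurability _ (measurable_realfun.RGenOInfty.measurableE R)).
move=> _ [_ [x ->] <-]; rewrite setTI; apply: open_borel.
apply: open_comp; first by move=> y _; exact: cf.
by rewrite set_itvE; exact: open_gt.
Qed.

Lemma continuous_coord d (i : 'I_d) : continuous (fun x : 'rV[R]_d => x 0 i).
Proof. exact: coord_continuous. Qed.

Lemma closed_le_coord d (i : 'I_d) (a : R) : closed [set x : 'rV[R]_d | a <= x 0 i].
Proof.
apply: (@closed_comp _ _ (fun x : 'rV[R]_d => x 0 i) [set y | a <= y]).
  by move=> x _; exact: continuous_coord.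
exact: closed_ge.
Qed.

Lemma open_lt_coord d (i : 'I_d) (a : R) : open [set x : 'rV[R]_d | x 0 i < a].
Proof.
apply: (@open_comp _ _ (fun x : 'rV[R]_d => x 0 i) [set y | y < a]).
  by move=> x _; exact: continuous_coord.
exact: open_lt.
Qed.

End borel_row.

Section dyadic_cells.
Context {R : realType} {m : nat}.
Local Notation V := 'rV[R]_m.
Local Notation T := {ffun 'I_m -> int}.

Definition cell p (z : T) : set V :=
  [set x | forall i, (z i)%:~R <= 2 ^+ p * x 0 i < (z i)%:~R + 1].

Definition cell_index p (x : V) : T := [ffun i => Num.floor (2 ^+ p * x 0 i)].

Lemma cellP p z x : cell p z x <-> cell_index p x = z.
Proof.
split=> [zx|<- i]; last first.
  rewrite ffunE floor_le/=.
  by have := floorD1_gt (2 ^+ p * x 0 i); rewrite intrD.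
apply/ffunP => i; rewrite ffunE; apply: floor_def.
by have := zx i; rewrite intrD.
Qed.

(** Dyadic nesting: the corners are integers, so a common point already forces [z i * N <= w i] and
    [w i + 1 <= (z i + 1) * N] with [N = 2 ^+ (q - p)]. *)
Lemma cell_subset p q z w : (p <= q)%N -> cell p z `&` cell q w !=set0 ->
  cell q w `<=` cell p z.
Proof.
move=> pq [x [zx wx]] y wy i.
have /andP[z1 z2] := zx i; have /andP[w1 w2] := wx i; have /andP[y1 y2] := wy i.
pose N : int := 2 ^+ (q - p).
have NE : N%:~R = 2 ^+ (q - p) :> R by rewrite /N rmorphXn.
have N0 : 0 < 2 ^+ (q - p) :> R by rewrite exprn_gt0.
have qE t : 2 ^+ q * t = 2 ^+ (q - p) * (2 ^+ p * t) :> R.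
  by rewrite mulrA -exprD subnK.
have zw : z i * N <= w i.
  rewrite -ltzD1 -(ltr_int R) intrD intrM NE.
  by rewrite (le_lt_trans _ w2)// qE mulrC ler_wpM2l// ltW.
have wz : w i + 1 <= (z i + 1) * N.
  rewrite lezD1 -(ltr_int R) intrM intrD NE.
  by rewrite (le_lt_trans w1)// qE mulrC ltr_pM2r.
move: zw wz; rewrite -(ler_int R) -[w i + 1 <= _](ler_int R) !intrM !intrD NE => zw wz.
rewrite -(ler_pM2l N0) -(ltr_pM2l N0) -qE mulrC (le_trans zw y1)/=.
by rewrite (lt_le_trans y2)// mulrC.
Qed.

Lemma cell_diam p z x y : cell p z x -> cell p z y -> `|x - y| <= 2 ^- p.
Proof.
move=> zx zy; apply: normr_rV_le => [|i]; first by rewrite invr_ge0 exprn_ge0.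
have p0 : 0 < 2 ^+ p :> R by rewrite exprn_gt0.
have /andP[? ?] := zx i; have /andP[? ?] := zy i.
rewrite !mxE -(ler_pM2l p0) mulfV ?gt_eqF// -{1}(gtr0_norm p0) -normrM mulrBr.
by rewrite ler_norml; apply/andP; split; lra.
Qed.

Lemma cell_borel p z : measurable (cell p z : set (borel_rV R m)).
Proof.
have p0 : 0 < 2 ^+ p :> R by rewrite exprn_gt0.
rewrite (_ : cell p z = \bigcap_(i : 'I_m)
    ([set x | (z i)%:~R / 2 ^+ p <= x 0 i] `&` [set x | x 0 i < ((z i)%:~R + 1) / 2 ^+ p])).
  apply: fin_bigcap_measurable => // i _; apply: measurableI.
    by apply: closed_borel; exact: closed_le_coord.
  by apply: open_borel; exact: open_lt_coord.
apply/seteqP; split => [x zx i _|x zx i].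
  by have := zx i; rewrite /= ler_pdivrMr// ltr_pdivlMr// [x 0 i * _]mulrC => /andP.
by have := zx i I; rewrite /= ler_pdivrMr// ltr_pdivlMr// [x 0 i * _]mulrC => /andP.
Qed.

Lemma exists_small_pow (e : R) : 0 < e -> exists p, 2 ^- p < e.
Proof.
move=> e0; exists (Num.truncn e^-1).+1.
rewrite invf_plt ?posrE ?exprn_gt0// (lt_le_trans (truncnS_gt _))//.
by rewrite -natrX ler_nat ltnW// ltn_expl.
Qed.

(** Two dyadic cells are nested or disjoint, so adding the empty set yields a countable pi-system;
    it generates the Borel sets. *)
Definition cells : set (set (borel_rV R m)) :=
  [set A | A = set0 \/ exists p z, A = cell p z].

Lemma cells_setI_closed : setI_closed cells.
Proof.
move=> A B [->|[p [z ->]]]; first by rewrite set0I; left.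
move=> [->|[q [w ->]]]; first by rewrite setI0; left.
have [->|/set0P zw] := eqVneq (cell p z `&` cell q w) set0; first by left.
right; case: (leqP p q) => [pq|/ltnW qp].
  by exists q, w; apply/setIidPr; exact: cell_subset zw.
by exists p, z; apply/setIidPl; apply: cell_subset; rewrite // setIC.
Qed.

Lemma measurable_cells : measurable = <<s cells >>.
Proof.
apply/seteqP; split => A.
  apply: smallest_sub A => [|U oU]; first exact: smallest_sigma_algebra.
  pose F (n : nat) : set (borel_rV R m) :=
    if unpickle n is Some (p, z) then if `[< cell p z `<=` U >] then cell p z else set0
    else set0.
  rewrite (_ : U = \bigcup_n F n).
    apply: sigma_algebra_bigcup => n; apply: sub_sigma_algebra; rewrite /F.
    case: unpickle => [[p z]|]; last by left.
    by case: ifP => _; [right; exists p, z|left].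
  apply/seteqP; split => x; last first.
    by move=> [n _]; rewrite /F; case: unpickle => [[p z]|//]; case: asboolP => // cU cx; exact: cU.
  move=> Ux; have : nbhs x U by exact: open_nbhs_nbhs.
  rewrite -nbhs_ballE => -[e /= e0 eU].
  have [p pe] := exists_small_pow e0.
  exists (pickle (p, cell_index p x)) => //; rewrite /F pickleK.
  have cx : cell p (cell_index p x) x by exact/cellP.
  rewrite ifT//; apply/asboolP => y cy; apply: eU; rewrite -ball_normE/=.
  exact: le_lt_trans (cell_diam cx cy) pe.
apply: smallest_sub A; first exact: sigma_algebra_measurable.
by move=> _ [->|[p [z ->]]]; [exact: measurable0|exact: cell_borel].
Qed.

End dyadic_cells.

Lemma mulfinI {R : realType} (a : R) (x y : \bar R) : 0 < a ->
  (a%:E * x = a%:E * y)%E -> x = y.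
Proof.
move=> a0 e; apply: le_anti.
have aE : a%:E \is a fin_num by [].
by rewrite -(lee_pmul2l aE) ?lte_fin// e lexx -(lee_pmul2l aE) ?lte_fin// e lexx.
Qed.

Section translation_invariant.
Context {R : realType} {m : nat}.
Local Notation V := 'rV[R]_m.
Local Notation B := (borel_rV R m).
Implicit Types mu nu : {measure set B -> \bar R}.

Definition translation_invariant mu := forall (a : V) (A : set B),
  measurable A -> mu ((fun x : V => x + a) @` A) = mu A.

Let cell_translate p (z : {ffun 'I_m -> int}) :
  cell p z = (fun x : V => x + \row_i ((z i)%:~R / 2 ^+ p)) @` cell p [ffun=> 0].
Proof.
have p0 : 2 ^+ p != 0 :> R by rewrite expf_neq0.
apply/seteqP; split => [x zx|_ [x zx <-]].
  exists (x - \row_i ((z i)%:~R / 2 ^+ p)); last by rewrite subrK.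
  move=> i; have := zx i; rewrite !mxE ffunE mulrBr [2 ^+ p * (_ / _)]mulrC divfK//.
  by move=> /andP[? ?]; apply/andP; split; lra.
move=> i; have := zx i; rewrite !mxE ffunE mulrDr [2 ^+ p * (_ / _)]mulrC divfK//.
by move=> /andP[? ?]; apply/andP; split; lra.
Qed.

Let cell_measure mu p z : translation_invariant mu ->
  mu (cell p z) = mu (cell p [ffun=> 0]).
Proof.
by move=> mu_tr; rewrite cell_translate; exact: (mu_tr _ _ (cell_borel p [ffun=> 0])).
Qed.

Let cube_cells p : cube m = \bigcup_(z in [set` enum {ffun 'I_m -> 'I_(2 ^ p)}])
  (cell p [ffun i => Posz (z i)] : set V).
Proof.
have p0 : 0 < 2 ^+ p :> R by rewrite exprn_gt0.
apply/seteqP; split => [x Qx|x [z _ zx] i]; last first.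
  have := zx i; rewrite ffunE => /andP[z1 z2]; apply/andP; split.
    by rewrite -(ler_pM2l p0) mulr0 (le_trans _ z1)// ler0z.
  rewrite -(ltr_pM2l p0) mulr1 (lt_le_trans z2)// -natrX.
  by rewrite natr1 ler_nat.
have h i : (`|Num.floor (2 ^+ p * x 0 i)%R|%N < 2 ^ p)%N.
  have /andP[x0 x1] := Qx i.
  have f0 : 0 <= Num.floor (2 ^+ p * x 0 i) by rewrite floor_ge0 mulr_ge0// ltW.
  rewrite -ltz_nat gez0_abs// -(ltr_int R) (le_lt_trans (floor_le _))//.
  by rewrite -pmulrn natrX gtr_pMr.
exists [ffun i => Ordinal (h i)]; first by rewrite /= mem_enum.
apply/cellP/ffunP => i; rewrite !ffunE/= gez0_abs// floor_ge0 mulr_ge0 ?(ltW p0)//.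
by have /andP[] := Qx i.
Qed.

Let cube_measure mu p : translation_invariant mu ->
  mu (cube m) = ((#|{ffun 'I_m -> 'I_(2 ^ p)}|)%:R%:E * mu (cell p [ffun=> 0%R]))%E.
Proof.
move=> mu_tr; rewrite (cube_cells p) measure_fin_bigcup//.
- rewrite -fsbig_seq ?enum_uniq// (eq_bigr (fun=> (1%:E * mu (cell p [ffun=> 0%R]))%E)); last first.
    by move=> z _; rewrite mul1e; exact: cell_measure.
  by rewrite big_enum/= -ge0_sume_distrl// sumEFin sumr_const.
- move=> z w _ _ [x [/cellP xz /cellP]]; rewrite xz => /ffunP zw.
  by apply/ffunP => i; have := zw i; rewrite !ffunE => -[] /val_inj.
- by move=> z _; exact: cell_borel.
Qed.

Lemma cube_borel : measurable (cube m : set B).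
Proof.
rewrite (_ : cube m = cell 0 [ffun=> 0]); first exact: cell_borel.
by apply/seteqP; split => x xQ i; have := xQ i; rewrite !ffunE expr0 mul1r add0r.
Qed.

(** At each level the cube is a disjoint union of finitely many translates of one cell, so the ratio
    [c] known on the cube passes to all cells, and from this generating pi-system to all Borel
    sets. *)
Lemma translation_invariant_unique mu nu (c : R) : 0 <= c ->
  translation_invariant mu -> translation_invariant nu -> (mu (cube m) < +oo)%E ->
  nu (cube m) = (c%:E * mu (cube m))%E ->
  forall A : set B, measurable A -> nu A = (c%:E * mu A)%E.
Proof.
move=> c0 mu_tr nu_tr muoo numu A mA.
have N0 p : (0 < #|{ffun 'I_m -> 'I_(2 ^ p)}|%:R :> R).
  by rewrite ltr0n card_ffun !card_ord expn_gt0 expn_gt0.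
have cell0 p : nu (cell p [ffun=> 0]) = (c%:E * mu (cell p [ffun=> 0%R]))%E.
  move: numu; rewrite (cube_measure p mu_tr) (cube_measure p nu_tr) muleCA.
  exact: mulfinI.
have cellE p z : nu (cell p z) = (c%:E * mu (cell p z))%E.
  by rewrite (cell_measure _ _ mu_tr) (cell_measure _ _ nu_tr).
have cell_fin p z : (mu (cell p z) < +oo)%E.
  rewrite (cell_measure _ _ mu_tr).
  rewrite (le_lt_trans _ muoo)// (cube_measure p mu_tr).
  rewrite -[leLHS]mul1e lee_wpmul2r// lee_fin ler1n.
  by rewrite -(ltr0n R) N0.
(* The cells of level 0 cover the space with finite measure: this is the sigma-finiteness that
   [measure_unique] asks for. *)
pose g n : set B := if unpickle n is Some z then cell 0 z else set0.
rewrite -[RHS]/(mscale (NngNum c0) mu A).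
apply: (measure_unique cells g measurable_cells cells_setI_closed) => //.
- move=> n; rewrite /g; case: unpickle => [z|]; last by left.
  by right; exists 0, z.
- rewrite -subTset => x _; exists (pickle (cell_index 0 x)) => //.
  by rewrite /g pickleK; exact/cellP.
- by move=> _ [->|[p [z ->]]]; [rewrite !measure0|rewrite cellE].
- move=> n; rewrite /g; case: unpickle => [z|]; last by rewrite measure0.
  by rewrite cellE lte_mul_pinfty.
Qed.

End translation_invariant.

(** * Linear images and volumes of simplices *)

Lemma lipschitz_rV_continuous {R : realType} m (W : normedModType R)
    (f : 'rV[R]_m -> W) (C : R) :
  (forall x y, `|f x - f y| <= C * `|x - y|) -> continuous f.
Proof.
move=> fC x U /nbhs_ballP[e /= e0 eU]; apply/nbhs_ballP.
have C0 : 0 < `|C| + 1 by rewrite ltr_wpDl.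
exists (e / (`|C| + 1)); first by rewrite /= divr_gt0.
move=> y; rewrite -ball_normE/= => xy; apply: eU; rewrite -ball_normE/=.
rewrite (le_lt_trans (fC x y))// (@le_lt_trans _ _ ((`|C| + 1) * `|x - y|))//.
  by rewrite ler_wpM2r// ler_wpDr// ler_norm.
by rewrite mulrC -ltr_pdivlMr.
Qed.

Lemma mul_rV_continuous {R : realType} m d (T : 'M[R]_(m, d)) :
  continuous (fun x : 'rV[R]_m => x *m T).
Proof.
pose C : R := \sum_i \sum_j `|T i j|.
have C0 : 0 <= C by rewrite sumr_ge0// => i _; rewrite sumr_ge0.
apply: (@lipschitz_rV_continuous _ _ _ _ C) => x y; rewrite -mulmxBl.
apply: normr_rV_le => [|j]; first by rewrite mulr_ge0.
rewrite mxE (le_trans (ler_norm_sum _ _ _))//.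
rewrite /C mulr_suml; apply: ler_sum => i _; rewrite normrM mulrC.
rewrite ler_pM ?coord_norm_le//.
by rewrite (bigD1 j)//= lerDl sumr_ge0.
Qed.

Section linear_image.
Context {R : realType}.

Definition lin_image m d (T : 'M[R]_(m, d)) (A : set 'rV[R]_m) : set 'rV[R]_d :=
  (fun x => x *m T) @` A.

Lemma lin_image_comp m p d (S : 'M[R]_(m, p)) (T : 'M[R]_(p, d)) A :
  lin_image (S *m T) A = lin_image T (lin_image S A).
Proof.
apply/seteqP; split => [_ [x Ax <-]|_ [_ [x Ax <-] <-]].
  by exists (x *m S); [exists x|rewrite mulmxA].
by exists x => //; rewrite mulmxA.
Qed.

Lemma enorm_mul_rV_le m d (T : 'M[R]_(m, d)) (M : R) (x : 'rV[R]_m) :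
  (forall i, enorm (row i T) <= M) -> enorm (x *m T) <= m%:R * M * enorm x.
Proof.
move=> TM; rewrite mulmx_sum_row.
apply: (@le_trans _ _ (\sum_i enorm (x 0 i *: row i T))).
  elim/big_ind2 : _ => [|a b a' b' ab ab'|//]; first by rewrite enorm0.
  by rewrite (le_trans (enormD _ _))// lerD.
apply: (@le_trans _ _ (\sum_(i < m) M * enorm x)).
  apply: ler_sum => i _; rewrite enormZ mulrC ler_pM ?enorm_ge0//.
  by rewrite (le_trans (coord_norm_le _ _))// ler_norm_enorm.
by rewrite sumr_const card_ord -mulrA mulr_natl.
Qed.

Lemma hausdorff_lin_image_le k m d (T : 'M[R]_(m, d)) (M : R) A :
  (forall i, enorm (row i T) <= M) ->
  (hausdorff_measure k (lin_image T A) <=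
   ((1 + m%:R * M) ^+ k)%:E * hausdorff_measure k A)%E.
Proof.
move=> TM; have M0 : 0 <= m%:R * M.
  case: m T A TM => [|m] T A TM; first by rewrite mul0r.
  by rewrite mulr_ge0// (le_trans _ (TM ord0))// enorm_ge0.
rewrite -{2}[A]image_id; apply: hausdorff_lipschitz => [|x y _ _].
  by rewrite ltr_pwDl.
rewrite -mulmxBl (le_trans (enorm_mul_rV_le _ TM))// ler_wpM2r ?enorm_ge0//.
by rewrite lerDr.
Qed.

Lemma row_bound m d (T : 'M[R]_(m, d)) :
  exists2 M, 0 <= M & forall i, enorm (row i T) <= M.
Proof.
exists (\sum_i enorm (row i T)) => [|i].
  by rewrite sumr_ge0// => j _; exact: enorm_ge0.
rewrite (bigD1 i)//= lerDl.
by rewrite sumr_ge0// => j _; exact: enorm_ge0.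
Qed.

Lemma hausdorff_lin_image_lty m d (T : 'M[R]_(m, d)) (N : R) A :
  (forall x, A x -> `|x| < N) -> (hausdorff_measure m (lin_image T A) < +oo)%E.
Proof.
move=> AN; have [M M0 TM] := row_bound T.
apply: (le_lt_trans (hausdorff_lin_image_le m A TM)).
rewrite lte_mul_pinfty ?lee_fin ?(hausdorff_bounded_lty AN)//.
by rewrite exprn_ge0// addr_ge0// mulr_ge0.
Qed.

(** [T] factors through a space whose dimension is the rank of [T], less than [m]; bounded sets
    there are null for the m-dimensional measure. *)
Lemma hausdorff_lin_image_eq0 m d (T : 'M[R]_(m, d)) (N : R) A : ~~ row_free T ->
  (forall x, A x -> `|x| < N) -> hausdorff_measure m (lin_image T A) = 0%E.
Proof.
move=> Tfree AN; apply/eqP; rewrite eq_le hausdorff_measure_ge0 andbT.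
rewrite -(mulmx_base T) lin_image_comp; have [M M0 TM] := row_bound (row_base T).
apply: (le_trans (hausdorff_lin_image_le m _ TM)).
have [M' M'0 TM'] := row_bound (col_base T).
rewrite (@hausdorff_bounded_eq0 _ m (\rank T) _ (m%:R * M' * (m.+1%:R * N) + 1)) ?mule0//.
  by rewrite ltn_neqAle rank_leq_row andbT.
move=> _ [x Ax <-]; rewrite (le_lt_trans (ler_norm_enorm _))//.
rewrite (le_lt_trans (enorm_mul_rV_le _ TM'))// ltr_pwDr// ler_wpM2l ?mulr_ge0//.
by rewrite (le_trans (enorm_le_norm _))// ler_wpM2l// ltW//; exact: AN.
Qed.

End linear_image.

Section linear_factor.
Context {R : realType}.
Local Notation H m := (hausdorff_measure m).

Lemma cube_norm_lt2 m (x : 'rV[R]_m) : cube m x -> `|x| < 2.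
Proof.
move=> Qx; rewrite (@le_lt_trans _ _ 1) ?ltr1n//.
apply: normr_rV_le => // i; have /andP[x0 x1] := Qx i.
by rewrite ger0_norm// ltW.
Qed.

Lemma hausdorff_cube_fin m : H m (@cube R m) \is a fin_num.
Proof. by rewrite ge0_fin_numE ?hausdorff_measure_ge0// hausdorff_cube_lty. Qed.

(** As a preimage under the left inverse [pinvmx T], cut down to the range of [T], the image of a
    Borel set is Borel, and the measure of the image becomes a pushforward measure in [A]. *)
Lemma lin_image_preimage m d (T : 'M[R]_(m, d)) A : row_free T ->
  lin_image T A = (fun y => y *m pinvmx T) @^-1` A `&` [set y | y *m pinvmx T *m T = y].
Proof.
move=> Tf; apply/seteqP; split => [_ [x Ax <-]|y [Ay yE]].
  have xK : x *m T *m pinvmx T = x by rewrite -mulmxA mulmxVp// mulmx1.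
  by split; rewrite /= xK.
by exists (y *m pinvmx T).
Qed.

Lemma lin_image_borel m d (T : 'M[R]_(m, d)) (A : set 'rV[R]_m) : row_free T ->
  measurable (A : set (borel_rV R m)) ->
  measurable (lin_image T A : set (borel_rV R d)).
Proof.
move=> Tf mA; rewrite lin_image_preimage//; apply: measurableI.
  have := continuous_borel (@mul_rV_continuous R d m (pinvmx T)) measurableT mA.
  by rewrite setTI.
apply: closed_borel.
rewrite (_ : mkset _ = (fun y => y *m (pinvmx T *m T - 1%:M)) @^-1` [set 0]).
  apply: closed_comp => [y _|]; first exact: mul_rV_continuous.
  exact/accessible_closed_set1/hausdorff_accessible/norm_hausdorff.
apply/seteqP; split => y.
  move=> yE; rewrite /preimage/mkset mulmxBr mulmx1 mulmxA; apply/eqP.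
  by rewrite subr_eq0; apply/eqP.
rewrite /preimage/mkset mulmxBr mulmx1 mulmxA => /eqP.
by rewrite subr_eq0 => /eqP.
Qed.

(** Classically this is the square root of the Gram determinant of the rows of [T]. Here it is
    evaluated through multiplicativity, shears and coordinate stretches instead of determinants. *)
Definition factor m d (T : 'M[R]_(m, d)) : R :=
  fine (H m (lin_image T (cube m))) / fine (H m (@cube R m)).

Lemma fine_cube_gt0 m : 0 < fine (H m (@cube R m)).
Proof. by rewrite -lte_fin fineK ?hausdorff_cube_fin// hausdorff_cube_gt0. Qed.

Lemma factor_ge0 m d (T : 'M[R]_(m, d)) : 0 <= factor T.
Proof. by rewrite divr_ge0// fine_ge0// hausdorff_measure_ge0. Qed.

Lemma factor_cube m d (T : 'M[R]_(m, d)) :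
  H m (lin_image T (cube m)) = ((factor T)%:E * H m (@cube R m))%E.
Proof.
rewrite -(fineK (hausdorff_cube_fin m)) -EFinM divfK ?gt_eqF ?fine_cube_gt0//.
rewrite fineK// ge0_fin_numE ?hausdorff_measure_ge0//.
exact: hausdorff_lin_image_lty (@cube_norm_lt2 m).
Qed.

Lemma lin_imageD m d (T : 'M[R]_(m, d)) A a :
  lin_image T ((fun x => x + a) @` A) = (fun x => x *m T + a *m T) @` A.
Proof.
apply/seteqP; split => [_ [_ [x Ax <-] <-]|_ [x Ax <-]].
  by exists x => //; rewrite mulmxDl.
by exists (x + a); [exists x|rewrite mulmxDl].
Qed.

Lemma hausdorff_translate k d (X : Type) (A : set X) (f : X -> 'rV[R]_d) a :
  H k ((fun x => f x + a) @` A) = H k (f @` A).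
Proof. by apply: hausdorff_isometry => x y _ _; rewrite opprD addrACA subrr addr0. Qed.

Lemma hausdorff_lin_image m d (T : 'M[R]_(m, d)) (A : set (borel_rV R m)) :
  row_free T -> measurable A -> H m (lin_image T A) = ((factor T)%:E * H m A)%E.
Proof.
move=> Tf mA.
have mrange : measurable ([set y | y *m pinvmx T *m T = y] : set (borel_rV R d)).
  have := lin_image_borel Tf (@measurableT _ (borel_rV R m)).
  by rewrite lin_image_preimage// preimage_setT setTI.
have mf := continuous_borel (@mul_rV_continuous R d m (pinvmx T)).
pose mu : {measure set (borel_rV R d) -> \bar R} := mrestr (@borel_hausdorff R d m) mrange.
have [nu nuE] : exists nu : {measure set (borel_rV R m) -> \bar R},
    forall A : set (borel_rV R m), nu A = H m (lin_image T A).
  unshelve eexists (pushforward mu (fun y : borel_rV R d => y *m pinvmx T : borel_rV R m)).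
    exact: mf.
  by move=> B; rewrite lin_image_preimage.
rewrite -nuE; apply: (@translation_invariant_unique R m (@borel_hausdorff R m m)) => //.
- exact: factor_ge0.
- by move=> a B mB; rewrite -[in RHS](image_id B); exact: hausdorff_translate.
- move=> a B mB; rewrite !nuE; apply: eq_trans (hausdorff_translate m B _ (a *m T)).
  by congr (H m _); exact: lin_imageD.
- exact: hausdorff_cube_lty.
- by rewrite nuE factor_cube.
Qed.

Lemma factor_isometry m d d' (T : 'M[R]_(m, d)) (T' : 'M[R]_(m, d')) :
  (forall x, enorm (x *m T) = enorm (x *m T')) -> factor T = factor T'.
Proof.
move=> TT'; rewrite /factor /lin_image; congr (fine _ / _).
by apply: hausdorff_isometry => x y _ _; rewrite -!mulmxBl TT'.
Qed.

Lemma factorM m d (S : 'M[R]_m) (T : 'M[R]_(m, d)) : S \in unitmx -> row_free T ->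
  factor (S *m T) = factor S * factor T.
Proof.
move=> Su Tf; rewrite {1}/factor lin_image_comp hausdorff_lin_image//; last first.
  by apply: lin_image_borel; [rewrite row_free_unit|exact: cube_borel].
rewrite factor_cube -(fineK (hausdorff_cube_fin m)) -!EFinM/=.
by rewrite mulrA mulfK ?gt_eqF ?fine_cube_gt0// mulrC.
Qed.

Lemma factor1 m : factor (1%:M : 'M[R]_m) = 1.
Proof.
rewrite /factor (_ : lin_image _ _ = cube m) ?divff ?gt_eqF ?fine_cube_gt0//.
by rewrite -[RHS]image_id; apply: eq_imagel => x _; rewrite mulmx1.
Qed.

Lemma factor_scalar m (t : R) : 0 < t -> factor (t%:M : 'M[R]_m) = t ^+ m.
Proof.
move=> t0; rewrite /factor /lin_image.
rewrite (@hausdorff_similarity _ _ _ _ _ (cube m) id _ t)//; last first.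
  by move=> x y _ _; rewrite -mulmxBl mul_mx_scalar enormZ gtr0_norm.
rewrite image_id -(fineK (hausdorff_cube_fin m)) -EFinM/=.
by rewrite mulfK ?gt_eqF ?fine_cube_gt0.
Qed.

End linear_factor.

Section elementary_factors.
Context {R : realType}.

Lemma enorm_row_mx p q (x : 'rV[R]_p) (y : 'rV[R]_q) :
  enorm (row_mx x y) ^+ 2 = enorm x ^+ 2 + enorm y ^+ 2.
Proof.
rewrite !sqr_enorm big_split_ord/=; congr (_ + _); apply: eq_bigr => i _.
  by rewrite row_mxEl.
by rewrite row_mxEr.
Qed.

Lemma eq_enorm_sqr d d' (x : 'rV[R]_d) (y : 'rV[R]_d') :
  enorm x ^+ 2 = enorm y ^+ 2 -> enorm x = enorm y.
Proof. by move/eqP; rewrite eqrXn2 ?enorm_ge0// => /eqP. Qed.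

Definition shear p (a : 'rV[R]_p) : 'M[R]_(1 + p) := block_mx 1%:M a 0 1%:M.

Let flip p : 'M[R]_(1 + p) := block_mx (- 1%:M) 0 0 1%:M.

Let enorm_flip p d (T : 'M[R]_(d, 1 + p)) x :
  enorm (x *m (T *m flip p)) = enorm (x *m T).
Proof.
apply: eq_enorm_sqr; rewrite mulmxA -[x *m T]hsubmxK mul_row_block.
by rewrite !enorm_row_mx mulmxN !mulmx1 !mulmx0 addr0 add0r enormN.
Qed.

Let flipK p : flip p *m flip p = 1%:M.
Proof.
rewrite mulmx_block !mulmx0 !mul0mx !addr0 !add0r !mulmxN !mulNmx !mulmx1 opprK.
by rewrite -scalar_mx_block.
Qed.

Let flip_unit p : flip p \in unitmx.
Proof. by case: (mulmx1_unit (flipK p)). Qed.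

Let shearN p (a : 'rV[R]_p) : flip p *m shear a *m flip p = shear (- a).
Proof.
rewrite !mulmx_block.
by rewrite !(mulmx0, mul0mx, addr0, add0r, mulmxN, mulNmx, mulmx1, mul1mx, opprK, oppr0).
Qed.

Let shearK p (a : 'rV[R]_p) : shear a *m shear (- a) = 1%:M.
Proof.
rewrite mulmx_block !mulmx0 !mul0mx !addr0 !add0r !mulmx1 mul1mx addNr.
by rewrite -scalar_mx_block.
Qed.

Lemma shear_unit p (a : 'rV[R]_p) : shear a \in unitmx.
Proof. by case: (mulmx1_unit (shearK a)). Qed.

(** The reflection [flip] conjugates [shear a] to its inverse [shear (- a)], so both have the same
    factor, while the product of the two factors is 1. *)
Lemma factor_shear p (a : 'rV[R]_p) : factor (shear a) = 1.
Proof.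
have fN : factor (shear (- a)) = factor (shear a).
  rewrite -shearN -mulmxA factorM//; last first.
    by rewrite row_free_unit unitmx_mul shear_unit flip_unit.
  rewrite (factor_isometry (enorm_flip (shear a))).
  rewrite -[flip p]mul1mx (factor_isometry (enorm_flip 1%:M)) factor1.
  by rewrite mul1r.
have := factorM (shear_unit a) (etrans (row_free_unit _) (shear_unit (- a))).
rewrite shearK factor1 fN -expr2 => /esym/eqP.
by rewrite sqrf_eq1 => /orP[/eqP//|/eqP f]; have := factor_ge0 (shear a); rewrite f ler0N1.
Qed.

Definition scale_coord m (k : 'I_m) (t : R) : 'M[R]_m :=
  diag_mx (\row_i (if i == k then t else 1)).

Let diag_unit m (v : 'rV[R]_m) : (forall i, v 0 i != 0) -> diag_mx v \in unitmx.
Proof.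
move=> v0; rewrite unitmxE det_diag unitfE.
by apply/prodf_neq0 => i _; exact: v0.
Qed.

Let scale_coord_neq0 m (k : 'I_m) (t : R) : t != 0 ->
  forall i, (\row_i (if i == k then t else 1)) (0 : 'I_1) i != 0.
Proof. by move=> t0 i; rewrite mxE; case: ifP => // _; exact: oner_neq0. Qed.

Lemma scale_coord_unit m (k : 'I_m) (t : R) : t != 0 -> scale_coord k t \in unitmx.
Proof. by move=> t0; apply: diag_unit; exact: scale_coord_neq0. Qed.

(** Transposing two coordinates is an isometry that preserves the cube, so the factor is the same
    for every [k]. Stretching all coordinates in turn gives the homothety [t%:M], of factor
    [t ^+ m], and nonnegative m-th roots are unique. *)
Lemma factor_scale_coord m (k : 'I_m) (t : R) : 0 < t -> factor (scale_coord k t) = t.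
Proof.
move=> t0; have t0' : t != 0 by rewrite gt_eqF.
have fE (k' : 'I_m) : factor (scale_coord k' t) = factor (scale_coord k t).
  rewrite /factor; congr (fine _ / _).
  pose s (x : 'rV[R]_m) : 'rV[R]_m := \row_(i < m) x 0 (tperm k k' i).
  have sK x : s (s x) = x by apply/rowP => i; rewrite !mxE tpermK.
  have -> : lin_image (scale_coord k' t) (cube m) =
      (fun x => s x *m scale_coord k' t) @` cube m.
    apply/seteqP; split => _ [x Qx <-]; exists (s x); rewrite ?sK//.
    - by move=> i; rewrite !mxE; exact: Qx.
    - by move=> i; rewrite !mxE; exact: Qx.
  apply: hausdorff_isometry => x y _ _; rewrite -!mulmxBl.
  apply: eq_enorm_sqr; rewrite !sqr_enorm (reindex_inj (@perm_inj _ (tperm k k')))/=.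
  apply: eq_bigr => i _; rewrite !mul_mx_diag !mxE tpermK; congr (((_ - _) * _) ^+ 2).
  suff -> : (tperm k k' i == k') = (i == k) by [].
  by rewrite -[X in _ == X](tpermL k k') (inj_eq perm_inj).
(* [E j] stretches the first [j] coordinates and interpolates between the identity and [t%:M]. *)
pose E j : 'M[R]_m := diag_mx (\row_i (if (i < j)%N then t else 1)).
have Eu j : E j \in unitmx.
  by apply: diag_unit => i; rewrite mxE; case: ifP => // _; exact: oner_neq0.
have EX j : (j <= m)%N -> factor (E j) = factor (scale_coord k t) ^+ j.
  elim: j => [|j IH] jm.
    rewrite (_ : E 0 = 1%:M) ?factor1//.
    by rewrite -diag_const_mx; congr diag_mx; apply/rowP => i; rewrite !mxE.
  rewrite (_ : E j.+1 = scale_coord (Ordinal jm) t *m E j).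
    by rewrite factorM ?row_free_unit ?scale_coord_unit// fE IH ?exprS// ltnW.
  rewrite mulmx_diag; congr diag_mx; apply/rowP => i; rewrite !mxE ltnS leq_eqVlt.
  rewrite -val_eqE/=; case: eqVneq => [->|_]; first by rewrite ltnn mulr1.
  by rewrite mul1r.
have := EX m (leqnn m); rewrite (_ : E m = t%:M); last first.
  by rewrite -diag_const_mx; congr diag_mx; apply/rowP => i; rewrite !mxE ltn_ord.
rewrite factor_scalar// => /eqP; rewrite eqrXn2 ?factor_ge0 ?(ltW t0)//.
  by move=> /eqP.
exact: leq_ltn_trans (ltn_ord k).
Qed.

End elementary_factors.

Section simplex_content.
Context {R : realType}.
Local Notation H m := (hausdorff_measure m).

Definition std_simplex m : set 'rV[R]_m :=
  [set x | (forall i, 0 <= x 0 i) /\ \sum_i x 0 i <= 1].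
Arguments std_simplex : clear implicits.

Lemma std_simplex_norm m x : std_simplex m x -> `|x| < 2.
Proof.
move=> [x0 x1]; rewrite (@le_lt_trans _ _ 1) ?ltr1n//.
apply: normr_rV_le => // i; rewrite ger0_norm//.
by rewrite (le_trans _ x1)// (bigD1 i)//= lerDl sumr_ge0.
Qed.

Lemma std_simplex_borel m : measurable (std_simplex m : set (borel_rV R m)).
Proof.
rewrite (_ : std_simplex m = (\bigcap_(i : 'I_m) [set x : 'rV[R]_m | 0 <= x 0 i]) `&`
    [set x | (x *m (- const_mx 1 : 'cV_m)) 0 0 >= -1]).
  apply: measurableI.
    apply: fin_bigcap_measurable => // i _.
    by apply: closed_borel; exact: closed_le_coord.
  apply: closed_borel.
  apply: (@closed_comp _ _ (fun x : 'rV[R]_m => x *m - const_mx 1) [set y | -1 <= y 0 0]).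
    by move=> x _; exact: mul_rV_continuous.
  exact: closed_le_coord.
have sE (x : 'rV[R]_m) : (x *m (- const_mx 1 : 'cV_m)) 0 0 = - \sum_i x 0 i.
  by rewrite mulmxN !mxE; congr (- _); apply: eq_bigr => i _; rewrite mxE mulr1.
apply/seteqP; split => x; rewrite /std_simplex /mkset.
  by move=> [x0 x1]; split; [move=> i _; exact: x0|rewrite /mkset sE lerN2].
by move=> [x0]; rewrite /mkset sE lerN2; split => // i; exact: x0.
Qed.

Lemma hausdorff_std_simplex_gt0 m : (0 < H m (std_simplex m))%E.
Proof.
have m0 : 0 < (m.+1%:R : R)^-1 by rewrite invr_gt0 ltr0n.
apply: (@lt_le_trans _ _ (H m ((fun x => m.+1%:R^-1 *: x) @` cube m))).
  rewrite (@hausdorff_similarity _ _ _ _ _ (cube m) id _ (m.+1%:R^-1))//.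
    by rewrite image_id mule_gt0 ?hausdorff_cube_gt0// lte_fin exprn_gt0.
  by move=> x y _ _; rewrite -scalerBr enormZ gtr0_norm.
apply: le_hausdorff_measure => _ [x Qx <-]; split.
  by move=> i; rewrite mxE mulr_ge0 ?(ltW m0)//; have /andP[] := Qx i.
apply: (@le_trans _ _ (\sum_(i < m) m.+1%:R^-1)).
  apply: ler_sum => i _; rewrite mxE ler_piMr ?(ltW m0)//.
  by have /andP[_ /ltW] := Qx i.
rewrite sumr_const card_ord -[leLHS]mulr_natl ler_pdivrMr ?ltr0n// mul1r.
by rewrite ler_nat.
Qed.

Lemma hausdorff_simplex_fin m d (T : 'M[R]_(m, d)) :
  H m (lin_image T (std_simplex m)) \is a fin_num.
Proof.
rewrite ge0_fin_numE ?hausdorff_measure_ge0//.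
exact: hausdorff_lin_image_lty (@std_simplex_norm m).
Qed.

(* Up to the normalising constant, the volume of the simplex spanned by 0 and the rows of T. *)
Definition svol m d (T : 'M[R]_(m, d)) : R :=
  fine (H m (lin_image T (std_simplex m))).

Lemma svol_ge0 m d (T : 'M[R]_(m, d)) : 0 <= svol T.
Proof. by rewrite fine_ge0// hausdorff_measure_ge0. Qed.

Lemma svol_degenerate m d (T : 'M[R]_(m, d)) : ~~ row_free T -> svol T = 0.
Proof.
by move=> Tf; rewrite /svol (hausdorff_lin_image_eq0 Tf (@std_simplex_norm m)).
Qed.

Lemma svol_factor m d (T : 'M[R]_(m, d)) : row_free T ->
  svol T = factor T * fine (H m (std_simplex m)).
Proof.
move=> Tf; rewrite /svol hausdorff_lin_image//; last exact: std_simplex_borel.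
rewrite fineM//; have := hausdorff_simplex_fin (1%:M : 'M[R]_m).
rewrite (_ : lin_image _ _ = std_simplex m)//.
by rewrite -[RHS]image_id; apply: eq_imagel => x _; rewrite mulmx1.
Qed.

(** [factorM] covers the case [row_free T]; otherwise [S *m T] is degenerate too and both sides
    vanish. *)
Lemma svol_mul m d (S : 'M[R]_m) (T : 'M[R]_(m, d)) : S \in unitmx ->
  svol (S *m T) = factor S * svol T.
Proof.
move=> Su; have [Tf|Tf] := boolP (row_free T).
  by rewrite !svol_factor ?factorM ?mulrA// /row_free mxrankMfree// mxrank_unit.
rewrite !svol_degenerate ?mulr0// /row_free.
by rewrite (eqmxMfull T (etrans (row_full_unit S) Su)).
Qed.

Lemma svol_isometry m d d' (T : 'M[R]_(m, d)) (T' : 'M[R]_(m, d')) :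
  (forall x, enorm (x *m T) = enorm (x *m T')) -> svol T = svol T'.
Proof.
move=> TT'; rewrite /svol /lin_image; congr fine.
by apply: hausdorff_isometry => x y _ _; rewrite -!mulmxBl TT'.
Qed.

Lemma svol_le m d (T : 'M[R]_(m, d)) (M : R) : (forall i, enorm (row i T) <= M) ->
  svol T <= (1 + m%:R * M) ^+ m * fine (H m (std_simplex m)).
Proof.
move=> TM; rewrite -lee_fin fineK ?hausdorff_simplex_fin// EFinM fineK.
  exact: hausdorff_lin_image_le.
have := hausdorff_simplex_fin (1%:M : 'M[R]_m).
rewrite (_ : lin_image _ _ = std_simplex m)//.
by rewrite -[RHS]image_id; apply: eq_imagel => x _; rewrite mulmx1.
Qed.

Section one_vertex.
Variables (p d : nat) (S : 'M[R]_(p, d)).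
Implicit Types u w : 'rV[R]_d.

Let h u : R := svol (col_mx u S).

Let h_shear (a : 'rV[R]_p) u : h (u + a *m S) = h u.
Proof.
rewrite /h -[RHS]mul1r -(factor_shear a) -svol_mul ?shear_unit//.
by rewrite mul_block_col !mul1mx mul0mx add0r.
Qed.

Let h_scale t u : 0 < t -> h (t *: u) = t * h u.
Proof.
move=> t0; rewrite /h -[X in X * _](factor_scale_coord (ord0 : 'I_(1 + p)) t0).
rewrite -svol_mul ?scale_coord_unit ?gt_eqF//; congr svol.
rewrite mul_diag_mx; apply/matrixP => i j; rewrite [RHS]mxE.
rewrite [X in X * _]mxE; case: (@split_ordP 1 p i) => k ->.
  by rewrite !col_mxEu !mxE (ord1 k).
by rewrite !col_mxEd mul1r.
Qed.

(** By Pythagoras, the length of [x *m col_mx u S] depends on a vector [u] orthogonal to the rows of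
    [S] only through [enorm u], so the two simplices are isometric. *)
Let h_isometry u w : u *m S^T = 0 -> w *m S^T = 0 -> enorm u = enorm w -> h u = h w.
Proof.
move=> uS wS uw; apply: svol_isometry => x; apply: eq_enorm_sqr.
have pyth v : v *m S^T = 0 -> enorm (x *m col_mx v S) ^+ 2 =
    (x 0 0 * enorm v) ^+ 2 + enorm (rsubmx (x : 'rV_(1 + p)) *m S) ^+ 2.
  move=> vS; rewrite -[x in LHS](hsubmxK (x : 'rV_(1 + p))) mul_row_col.
  have -> : lsubmx (x : 'rV_(1 + p)) *m v = x 0 0 *: v.
    rewrite [lsubmx _]mx11_scalar mul_scalar_mx mxE; congr (x _ _ *: v).
    exact/val_inj.
  set y := rsubmx _ *m S.
  have sq (z : 'rV[R]_d) : enorm z ^+ 2 = (z *m z^T) 0 0.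
    by rewrite sqr_enorm dotmxE.
  have vy : v *m y^T = 0 by rewrite trmx_mul mulmxA vS mul0mx.
  have yv : y *m v^T = 0 by rewrite -[LHS]trmxK trmx_mul trmxK vy trmx0.
  rewrite exprMn !sq linearD linearZ/= mulmxDl !mulmxDr.
  rewrite -!scalemxAl -!scalemxAr vy yv !scaler0 addr0 add0r.
  by rewrite mxE scalerA mxE expr2.
by rewrite !pyth// uw.
Qed.

(** For independent rows of [S], [P] projects orthogonally to their span. Shears reduce [u] to
    [u *m P], isometries reduce that vector to its length, and [h_scale] makes the dependence on the
    length linear. The result is a seminorm in [u], which is what convexity and the Lipschitz bound
    require. *)
Lemma svol_col_mxE : exists2 kappa : R, 0 <= kappa &
  exists P : 'M[R]_d, forall u, svol (col_mx u S) = kappa * enorm (u *m P).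
Proof.
have [Sf|Sf] := boolP (row_free S); last first.
  exists 0 => //; exists 0 => u; rewrite mul0r svol_degenerate//.
  apply: contra Sf; rewrite /row_free => /eqP h1.
  have := mxrank_adds_leqif u S => -[+ _].
  rewrite addsmxE h1 => h2; rewrite eqn_leq rank_leq_row/= -(leq_add2l 1).
  by rewrite (leq_trans h2)// leq_add2r rank_leq_row.
have Gu : S *m S^T \in unitmx.
  rewrite -row_free_unit -kermx_eq0; apply/rowV0P => v /sub_kermxP vG.
  have : v *m S *m (v *m S)^T = 0.
    by rewrite trmx_mul mulmxA -[v *m S *m S^T]mulmxA vG mul0mx.
  move=> /(congr1 (fun z : 'M[R]_1 => z 0 0)); rewrite dotmxE [RHS]mxE.
  rewrite (eq_bigr (fun i => (v *m S) 0 i ^+ 2)); last by move=> i _; rewrite expr2.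
  rewrite -sqr_enorm => /eqP; rewrite sqrf_eq0 enorm_eq0 => /eqP vS.
  by apply/eqP; rewrite -(inj_eq (row_free_inj Sf)) mul0mx vS.
pose P : 'M[R]_d := 1%:M - S^T *m invmx (S *m S^T) *m S.
have uP u : u *m P = u + (- (u *m S^T *m invmx (S *m S^T))) *m S.
  by rewrite mulmxBr mulmx1 mulNmx !mulmxA.
have hP u : h (u *m P) = h u by rewrite uP h_shear.
have PS u : u *m P *m S^T = 0.
  by rewrite uP mulmxDl mulNmx mulNmx -!mulmxA mulVmx// mulmx1 subrr.
have h0 : h 0 = 0.
  rewrite /h svol_degenerate// /row_free -addsmxE adds0mx neq_ltn.
  by rewrite ltnS rank_leq_row.
(* [w] is a reference direction that determines the constant. If the rows of [S] span the whole
   space there is none, but then [u *m P] is always 0. *)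
have [[w [wS w0]]|none] := pselect (exists w, w *m S^T = 0 /\ w != 0).
  exists (h w / enorm w); first by rewrite divr_ge0 ?svol_ge0 ?enorm_ge0.
  exists P => u; rewrite -/(h u) -hP.
  have [->|v0] := eqVneq (u *m P) 0; first by rewrite h0 enorm0 mulr0.
  have w0' : 0 < enorm w by rewrite enorm_gt0.
  have v0' : 0 < enorm (u *m P) by rewrite enorm_gt0.
  rewrite [RHS](_ : _ = enorm (u *m P) / enorm w * h w); last by ring.
  rewrite -h_scale; last by rewrite mulr_gt0// invr_gt0.
  apply: h_isometry => //; first by rewrite -scalemxAl wS scaler0.
  rewrite enormZ gtr0_norm ?mulr_gt0 ?invr_gt0//.
  by rewrite divfK// gt_eqF.
exists 0 => //; exists P => u; rewrite mul0r -/(h u) -hP.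
suff -> : u *m P = 0 by [].
by apply/eqP; apply: contrapT => /negP v0; apply: none; exists (u *m P).
Qed.

End one_vertex.

End simplex_content.
Arguments std_simplex {R} m _.

Lemma convex_setP {R : realType} (V : lmodType R) (A : set V) :
  @convex_set R V A <->
  (forall x y t, 0 <= t <= 1 -> A x -> A y -> A (t *: x + (1 - t) *: y)).
Proof.
split=> [cA x y t /andP[t0 t1] Ax Ay|cA x y l /set_mem Ax /set_mem Ay].
  by have := cA x y (Itv01 t0 t1) (mem_set Ax) (mem_set Ay) => /set_mem.
by apply/mem_set; apply: cA => //; apply/andP; split.
Qed.

Section simplex_volume.
Context {R : realType}.
Local Notation H m := (hausdorff_measure m).

Lemma lin_image_convex m d (T : 'M[R]_(m, d)) y :
  @convex_set R 'rV[R]_d ((fun c => y + c *m T) @` std_simplex m).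
Proof.
apply/convex_setP => _ _ t /andP[t0 t1] [a [a0 a1] <-] [b [b0 b1] <-].
have t1' : 0 <= 1 - t by rewrite subr_ge0.
exists (t *: a + (1 - t) *: b).
  split=> [i|]; first by rewrite !mxE addr_ge0// mulr_ge0.
  under eq_bigr do rewrite !mxE.
  rewrite big_split/= -!mulr_sumr.
  have : t * (\sum_i a 0 i) <= t * 1 by rewrite ler_wpM2l.
  have : (1 - t) * (\sum_i b 0 i) <= (1 - t) * 1 by rewrite ler_wpM2l.
  lra.
rewrite mulmxDl -!scalemxAl !scalerDr addrACA -scalerDl.
by rewrite [t + _]addrC subrK scale1r.
Qed.

Definition edges d (y : 'rV[R]_d) (r : seq 'rV[R]_d) : 'M[R]_(size r, d) :=
  \matrix_(i < size r) (nth 0 r i - y).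

(** Induction on the points: the weight of the head is split off and the others are divided by
    [1 - c 0]. The point [y] carries the missing weight, so the sum only has to be at most 1.
    Weights indexed by [nat] can be shifted to the tail. *)
Lemma convex_combination_mem d (C : set 'rV[R]_d) y : @convex_set R 'rV[R]_d C -> C y ->
  forall r (c : nat -> R), (forall x, x \in r -> C x) ->
  (forall i, 0 <= c i) -> \sum_(i < size r) c i <= 1 ->
  C (y + \sum_(i < size r) c i *: (nth 0 r i - y)).
Proof.
move=> /convex_setP cC Cy; elim=> [|z r IH] c rC c0 c1.
  by rewrite big_ord0 addr0.
move: c1; rewrite !big_ord_recl/= => c1.
set S := \sum_(i < size r) c i.+1 in c1 *.
have S0 : 0 <= S by rewrite sumr_ge0.
have Cz : C z by apply: rC; rewrite mem_head.
have rC' x : x \in r -> C x by move=> xr; apply: rC; rewrite inE xr orbT.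
have [c00|c00] := eqVneq (c 0) 1.
  have {}S0 : S = 0 by apply/le_anti; rewrite S0 andbT; lra.
  rewrite big1 ?addr0; first by rewrite c00 scale1r addrC subrK.
  move=> i _; suff -> : c i.+1 = 0 by rewrite scale0r.
  apply/le_anti; rewrite c0 andbT -[leRHS]S0 /S (bigD1 i)//= lerDl.
  by rewrite sumr_ge0.
have c01 : 0 < 1 - c 0 by rewrite subr_gt0 lt_neqAle c00; lra.
have c0' i : 0 <= c i.+1 / (1 - c 0) by rewrite divr_ge0// ltW.
have c1' : \sum_(i < size r) c i.+1 / (1 - c 0) <= 1.
  by rewrite -mulr_suml ler_pdivrMr// mul1r -/S; lra.
have := IH _ rC' c0' c1'.
set w := y + _ => Cw.
have := cC z w (c 0); rewrite c0 -subr_ge0 (ltW c01) => /(_ isT Cz Cw).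
have wE : (1 - c 0) *: w = (1 - c 0) *: y + \sum_(i < size r) c i.+1 *: (nth 0 r i - y).
  rewrite /w scalerDr scaler_sumr; congr (_ + _); apply: eq_bigr => i _.
  by rewrite scalerA mulrC divfK// gt_eqF.
by rewrite wE scalerBl scale1r scalerBr !addrA [c 0 *: z + y]addrC.
Qed.

Lemma convex_hull_edges d (y : 'rV[R]_d) r :
  convex_hull [set` y :: r] = (fun c => y + c *m edges y r) @` std_simplex (size r).
Proof.
apply/seteqP; split.
  apply: smallest_sub; first exact: lin_image_convex.
  move=> x /=; rewrite inE => /predU1P[->|xr].
    exists 0; last by rewrite mul0mx addr0.
    split=> [i|]; first by rewrite mxE.
    by rewrite big1// => i _; rewrite mxE.
  have ix : (index x r < size r)%N by rewrite index_mem.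
  exists (delta_mx 0 (Ordinal ix)).
    split=> [i|]; first by rewrite mxE ler0n.
    rewrite (bigD1 (Ordinal ix))//= big1 => [|i /negPf ie]; last by rewrite mxE ie andbF.
    by rewrite mxE !eqxx addr0.
  by rewrite -rowE rowK/= nth_index// addrC subrK.
move=> _ [c [c0 c1] <-] C [cC sC].
have Cy : C y by apply: sC; rewrite /= mem_head.
have rC x : x \in r -> C x by move=> xr; apply: sC; rewrite /= inE xr orbT.
pose c' (i : nat) := if insub i is Some j then c 0 j else 0.
have c'E (i : 'I_(size r)) : c' i = c 0 i by rewrite /c' valK.
have := @convex_combination_mem d C y cC Cy r c' rC.
rewrite (eq_bigr (fun i => c 0 i)); last by move=> i _; exact: c'E.
rewrite (eq_bigr (fun i => c 0 i *: (nth 0 r i - y))); last by move=> i _; rewrite c'E.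
rewrite mulmx_sum_row; under [X in _ -> C (_ + X)]eq_bigr do rewrite rowK.
by apply=> // i; rewrite /c'; case: insubP.
Qed.

Lemma mul_pid_mxE p q m (x : 'rV[R]_p) (j : 'I_q) :
  (x *m (pid_mx m : 'M[R]_(p, q))) 0 j =
  if insub (j : nat) is Some i then x 0 (i : 'I_p) *+ (i < m)%N else 0.
Proof.
rewrite mxE; case: insubP => [i _ ij|jp].
  rewrite (bigD1 i)//= big1 ?addr0; first by rewrite mxE -ij eqxx mulr_natr.
  move=> k ki; rewrite mxE -ij; case: eqP => [/val_inj kj|]; last by rewrite mulr0.
  by rewrite kj eqxx in ki.
rewrite big1// => k _; rewrite mxE; case: eqP => [kj|]; last by rewrite mulr0.
by rewrite -kj ltn_ord in jp.
Qed.

Lemma enorm_mul_pid_mx m d (x : 'rV[R]_m) : (m <= d)%N ->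
  enorm (x *m (pid_mx m : 'M[R]_(m, d))) = enorm x.
Proof.
move=> md; apply: eq_enorm_sqr.
have sq k (z : 'rV[R]_k) : enorm z ^+ 2 = (z *m z^T) 0 0.
  by rewrite sqr_enorm dotmxE; apply: eq_bigr => i _; rewrite expr2.
rewrite !sq trmx_mul mulmxA -[x *m _ *m _]mulmxA tr_pid_mx mul_pid_mx.
by rewrite minnn (minn_idPr md) pid_mx_1 mulmx1.
Qed.

(** This is the normalising constant in [volume]. The closed cube contains an isometric copy of the
    half-open one and lies in a linear image of a bounded set; finiteness matters because [fine]
    sends infinity to 0. *)
Lemma hausdorff_unit_cube_gt0 m d : (m <= d)%N ->
  0 < fine (H m (@unit_cube R d m)).
Proof.
move=> md; pose T : 'M[R]_(m, d) := pid_mx m.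
have TQ : lin_image T (cube m) `<=` unit_cube m.
  move=> _ [x Qx <-] j; rewrite mul_pid_mxE; case: insubP => [i _ ij|jm].
    by rewrite ltn_ord -ij ltn_ord mulr1n; have /andP[-> /ltW ->] := Qx i.
  by rewrite (negbTE jm) lexx.
have QT : @unit_cube R d m `<=` lin_image T [set c | `|c| < 2].
  move=> x Qx; exists (x *m (pid_mx m : 'M[R]_(d, m))).
    rewrite /= (@le_lt_trans _ _ 1) ?ltr1n//; apply: normr_rV_le => // i.
    rewrite mul_pid_mxE; case: insubP => [j _ ji|]; last by rewrite normr0.
    rewrite ji ltn_ord mulr1n; have /andP[x0 x1] := Qx j.
    by rewrite ger0_norm// (le_trans x1)// lern1; case: (j < m)%N.
  rewrite -mulmxA mul_pid_mx; apply/rowP => j.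
  rewrite mul_pid_mxE valK; have := Qx j.
  rewrite !(minnn, minn_idPr md); case: ltnP => _; first by rewrite mulr1n.
  by rewrite mulr0n => /le_anti <-.
have fin : (H m (@unit_cube R d m) < +oo)%E.
  apply: le_lt_trans (le_hausdorff_measure m QT) _.
  exact: (@hausdorff_lin_image_lty _ _ _ _ 2).
rewrite -lte_fin fineK ?ge0_fin_numE ?hausdorff_measure_ge0//.
apply: lt_le_trans (le_hausdorff_measure m TQ).
suff -> : H m (lin_image T (cube m)) = H m (@cube R m) by exact: hausdorff_cube_gt0.
rewrite -[in RHS](image_id (cube m)).
by apply: hausdorff_isometry => x y _ _; rewrite -mulmxBl enorm_mul_pid_mx.
Qed.

End simplex_volume.

(** * The volume of a convex hull as a function of its vertices *)

Section hull_volume.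
Context {R : realType} {d : nat}.
Local Notation V := 'rV[R]_d.
Local Notation H m := (hausdorff_measure m).
Implicit Types (x y : V) (r s : seq V).

(* Locked because unification would otherwise unfold Hausdorff measures. *)
Fact hull_volume_key : unit. Proof. exact: tt. Qed.
Definition hull_volume s : R :=
  locked_with hull_volume_key (volume (size s).-1 (convex_hull [set` s])).

Let hull_volumeE s : hull_volume s = volume (size s).-1 (convex_hull [set` s]).
Proof. exact: locked_withE. Qed.

Lemma simplex_volumeE n (t : n.-tuple V) : simplex_volume t = hull_volume t.
Proof. by rewrite /simplex_volume hull_volumeE size_tuple. Qed.

Lemma hull_volume_ge0 s : 0 <= hull_volume s.
Proof. by rewrite hull_volumeE /volume divr_ge0// fine_ge0// hausdorff_measure_ge0. Qed.

Lemma hull_volume_perm s s' : perm_eq s s' -> hull_volume s = hull_volume s'.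
Proof.
move=> ss'; rewrite !hull_volumeE (perm_size ss'); congr (volume _ (convex_hull _)).
by apply/seteqP; split => x /=; rewrite (perm_mem ss').
Qed.

Let kappa m : R := fine (H m (@unit_cube R d m)).

Let kappa_ge0 m : 0 <= kappa m.
Proof. by rewrite fine_ge0// hausdorff_measure_ge0. Qed.

Lemma hull_volume_edges y r :
  hull_volume (y :: r) = svol (edges y r) / kappa (size r).
Proof.
rewrite hull_volumeE /volume /=; congr (fine _ / _).
rewrite convex_hull_edges; under eq_imagel do rewrite addrC.
by rewrite hausdorff_translate.
Qed.

Lemma edges_cons y x r : edges y (x :: r) = col_mx (x - y) (edges y r).
Proof.
apply/matrixP => i j; rewrite mxE; case: (@split_ordP 1 (size r) i) => k ->.
  by rewrite (@col_mxEu _ 1) (ord1 k) !mxE.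
by rewrite (@col_mxEd _ 1) !mxE.
Qed.

Lemma hull_volume_swap x y r : hull_volume (x :: y :: r) = hull_volume (y :: x :: r).
Proof. by apply: hull_volume_perm; rewrite (perm_catCA [:: x] [:: y] r). Qed.

(** The swap makes [y] the base point of the edges, so that [x] enters through the single edge
    [x - y] and [svol_col_mxE] applies. *)
Lemma hull_volume_vertex y r : exists2 c : R, 0 <= c &
  exists P : 'M[R]_d, forall x, hull_volume (x :: y :: r) = c * enorm ((x - y) *m P).
Proof.
have [c c0 [P cP]] := svol_col_mxE (edges y r).
exists (c / kappa (size r).+1); first by rewrite divr_ge0.
by exists P => x; rewrite hull_volume_swap hull_volume_edges edges_cons cP mulrAC.
Qed.

Lemma hull_volume_diag y r : hull_volume (y :: y :: r) = 0.
Proof.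
have [c c0 [P ->]] := hull_volume_vertex y r.
by rewrite subrr mul0mx enorm0 mulr0.
Qed.

Lemma hull_volume_midpoint x s : (0 < size s)%N ->
  2 * hull_volume (0 :: s) <= hull_volume (x :: s) + hull_volume (- x :: s).
Proof.
case: s => [|y r _]; first by rewrite ltnn.
have [c c0 [P cP]] := hull_volume_vertex y r.
rewrite !cP -mulrDr mulrCA ler_wpM2l// sub0r -[2]gtr0_norm// -enormZ.
rewrite (_ : 2 *: (- y *m P) = (x - y) *m P + (- x - y) *m P) ?enormD//.
by rewrite -mulmxDl scalemxAl addrACA subrr add0r scaler_nat mulr2n.
Qed.

Let lip_const p (N : R) : R :=
  (1 + p.+1%:R * (1 + 2 * N)) ^+ p.+1 * fine (H p.+1 (@std_simplex R p.+1)) / kappa p.+1.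

(** By the triangle inequality the increment is at most the seminorm of [u = x - x']. This equals
    [enorm u] times the volume of a simplex with a unit edge in the direction of [u], all of whose
    edges have length at most [1 + 2 * N]. *)
Lemma hull_volume_lipschitz p (N : R) : 0 <= N -> exists2 Lam : R, 0 <= Lam &
  forall s, size s = p.+1 -> (forall y, y \in s -> enorm y <= N) ->
  forall x x', hull_volume (x :: s) <= hull_volume (x' :: s) + Lam * enorm (x - x').
Proof.
move=> N0.
have C0 : 0 <= 1 + p.+1%:R * (1 + 2 * N).
  by rewrite addr_ge0// mulr_ge0// addr_ge0// mulr_ge0.
exists (lip_const p N).
  rewrite divr_ge0// mulr_ge0 ?exprn_ge0//.
  by rewrite fine_ge0// hausdorff_measure_ge0.
case=> // y r [rp] sN x x'; have [c c0 [P cP]] := hull_volume_vertex y r.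
rewrite !cP (_ : x - y = (x' - y) + (x - x')); last by rewrite [RHS]addrC addrA subrK.
rewrite mulmxDl (le_trans (ler_wpM2l c0 (enormD _ _)))// mulrDr lerD2l.
have [->|xx'] := eqVneq (x - x') 0; first by rewrite mul0mx enorm0 !mulr0.
set u := x - x' in xx' *.
have u0 : 0 < enorm u by rewrite enorm_gt0.
pose e := (enorm u)^-1 *: u.
have e1 : enorm e = 1 by rewrite enormZ ger0_norm ?invr_ge0 ?enorm_ge0// mulVf ?gt_eqF.
have -> : c * enorm (u *m P) = enorm u * hull_volume (y + e :: y :: r).
  rewrite cP [y + e]addrC addrK /e -scalemxAl enormZ.
  rewrite ger0_norm ?invr_ge0 ?enorm_ge0// [RHS]mulrCA mulVKf//.
  by rewrite gt_eqF.
rewrite mulrC ler_wpM2r ?enorm_ge0// hull_volume_swap hull_volume_edges /lip_const -rp.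
rewrite ler_wpM2r ?invr_ge0//; apply: svol_le => i.
rewrite rowK; have yN : enorm y <= N by apply: sN; rewrite mem_head.
have bnd z : z \in y + e :: r -> enorm (z - y) <= 1 + 2 * N.
  rewrite inE => /predU1P[->|zr].
    by rewrite [y + e]addrC addrK e1 lerDl mulr_ge0.
  rewrite (le_trans (enormD _ _))// enormN.
  have : enorm z <= N by apply: sN; rewrite inE zr orbT.
  by lra.
by apply: bnd; rewrite mem_nth.
Qed.

(** The hypothesis says that the edges from 0 are orthogonal of common length [a], so the simplex is
    a similar copy of [std_simplex]. *)
Lemma hull_volume_gt0 r (a : R) : 0 < a -> (size r <= d)%N ->
  (forall x : 'rV_(size r), enorm (x *m edges 0 r) = a * enorm x) -> 0 < hull_volume (0 :: r).
Proof.
move=> a0 rd Ta; rewrite hull_volume_edges divr_gt0//; last exact: hausdorff_unit_cube_gt0.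
rewrite -lte_fin fineK ?hausdorff_simplex_fin// /lin_image.
rewrite (@hausdorff_similarity _ _ _ _ _ (std_simplex (size r)) id _ a)//; last first.
  by move=> x y _ _; rewrite -mulmxBl Ta.
by rewrite image_id mule_gt0 ?hausdorff_std_simplex_gt0// lte_fin exprn_gt0.
Qed.

End hull_volume.

Section hull_volume_measurable.
Context {R : realType} {d : nat}.
Local Notation V := 'rV[R]_d.
Implicit Types (x y : V) (r s : seq V).

Lemma hull_volume_cat_cons (a s : seq V) w :
  hull_volume (a ++ w :: s) = hull_volume (w :: a ++ s).
Proof. by apply: hull_volume_perm; exact: (permEl (perm_catCA a [:: w] s)). Qed.

(** The vertices are moved from [f z] to [g z] one at a time; [a] collects those already moved. *)
Lemma hull_volume_lipschitz_seq p (N : R) : 0 <= N -> exists2 Lam : R, 0 <= Lam &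
  forall (T : eqType) (f g : T -> V) (e : R) (t : seq T) (a : seq V),
    (size a + size t = p.+2)%N -> (forall y, y \in a -> enorm y <= N) ->
    (forall z, z \in t -> [/\ enorm (f z) <= N, enorm (g z) <= N & enorm (f z - g z) <= e]) ->
  hull_volume (a ++ map f t) <= hull_volume (a ++ map g t) + (size t)%:R * (Lam * e).
Proof.
move=> N0; have [Lam L0 lip] := @hull_volume_lipschitz R d p N N0.
exists Lam => // T f g e; elim=> [|z t IH] a sz aN tN; first by rewrite mul0r addr0.
have [fN gN fg] := tN z (mem_head _ _).
have tN' w : w \in t -> [/\ enorm (f w) <= N, enorm (g w) <= N & enorm (f w - g w) <= e].
  by move=> wt; apply: tN; rewrite inE wt orbT.
apply: (@le_trans _ _ (hull_volume (a ++ g z :: map f t) + Lam * e)).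
  rewrite /= !hull_volume_cat_cons (le_trans (lip (a ++ map f t) _ _ (f z) (g z)))//.
  - by move: sz; rewrite size_cat size_map addnS => -[].
  - move=> y; rewrite mem_cat => /orP[/aN//|/mapP[w wt ->]].
    by have [] := tN' w wt.
  - by rewrite lerD2l ler_wpM2l.
rewrite /= -cat_rcons -[in leRHS]cat_rcons -natr1 mulrDl mul1r addrA lerD2r.
apply: IH => //; first by rewrite size_rcons addSnnS.
by move=> y; rewrite mem_rcons inE => /predU1P[->//|/aN].
Qed.

Let grid q x : V := \row_i ((Num.floor (2 ^+ q * x 0 i))%:~R / 2 ^+ q).

Let grid_near q x : enorm (x - grid q x) <= d.+1%:R * 2 ^- q.
Proof.
rewrite (le_trans (enorm_le_norm _))// ler_wpM2l//.
have q0 : 0 < 2 ^+ q :> R by rewrite exprn_gt0.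
apply: normr_rV_le => [|i]; first by rewrite invr_ge0 ltW.
rewrite !mxE -(ler_pM2l q0) mulfV ?gt_eqF// -{1}(gtr0_norm q0) -normrM mulrBr.
rewrite [2 ^+ q * (_ / _)]mulrC divfK ?gt_eqF//.
have := floor_le (2 ^+ q * x 0 i); have := floorD1_gt (2 ^+ q * x 0 i).
by rewrite intrD ler_norml => ? ?; apply/andP; split; lra.
Qed.

Let grid_measurable p q : measurable_fun [set: p.-tuple (borel_rV R d)]
  (fun t : p.-tuple (borel_rV R d) => hull_volume (map (grid q) t)).
Proof.
pose node (w : {ffun 'I_d -> int}) : V := \row_i ((w i)%:~R / 2 ^+ q).
pose G (z : p.-tuple {ffun 'I_d -> int}) : R := hull_volume (map node z).
have gE (t : p.-tuple V) : hull_volume (map (grid q) t) = G (map_tuple (cell_index q) t).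
  rewrite /G -map_comp; congr hull_volume; apply: eq_map => x /=.
  by apply/rowP => i; rewrite !mxE ffunE.
move=> _ Y mY; rewrite setTI.
pose F (z : p.-tuple {ffun 'I_d -> int}) : set (p.-tuple (borel_rV R d)) :=
  if `[< Y (G z) >] then [set t | forall i, cell q (tnth z i) (tnth t i)] else set0.
rewrite (_ : _ @^-1` Y = \bigcup_z F z).
  apply: countable_bigcupT_measurable; first exact: countableP.
  move=> z; rewrite /F; case: ifP => _; last exact: measurable0.
  apply: (measurable_tuple_box (A := fun i => cell q (tnth z i) : set (borel_rV R d))) => i.
  exact: cell_borel.
apply/seteqP; split => t; rewrite /preimage /mkset gE.
  move=> Yt; exists (map_tuple (cell_index q) t); first by [].
  by rewrite /F ifT; [move=> i; apply/cellP; rewrite tnth_map|apply/asboolP].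
move=> [z _]; rewrite /F; case: asboolP => [Yz zt|_ []].
rewrite (_ : map_tuple _ t = z)//; apply: eq_from_tnth => i; rewrite tnth_map.
by apply/cellP; exact: zt.
Qed.

(** Tuples carry the product sigma-algebra, so the continuity estimate is used through a pointwise
    limit: with its vertices rounded to the dyadic grid, the volume is constant on each of countably
    many measurable boxes. *)
Lemma measurable_hull_volume p : measurable_fun [set: p.+2.-tuple (borel_rV R d)]
  (fun t : p.+2.-tuple (borel_rV R d) => hull_volume t).
Proof.
apply: (@measurable_fun_cvg _ (p.+2.-tuple (borel_rV R d)) R setT
  (fun q t => hull_volume (map (grid q) t))) => [q|t _]; first exact: grid_measurable.
(* [N] bounds the vertices and also their rounded copies, which are at distance at most
   [d.+1%:R]. *)
pose N : R := \sum_(x <- t) enorm x + d.+1%:R.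
have N0 : 0 <= N by rewrite addr_ge0// sumr_ge0// => x _; exact: enorm_ge0.
have tN x : x \in (t : seq V) -> enorm x <= \sum_(x <- t) enorm x.
  move=> xt; rewrite (big_rem x xt)/= lerDl sumr_ge0// => y _; exact: enorm_ge0.
have [Lam L0 lip] := hull_volume_lipschitz_seq p N0.
have pow1 q : 2 ^- q <= 1 :> R by rewrite invf_le1 ?exprn_gt0// exprn_ege1// ler1n.
have bnd q x : x \in (t : seq V) -> [/\ enorm x <= N, enorm (grid q x) <= N,
    enorm (x - grid q x) <= d.+1%:R * 2 ^- q & enorm (grid q x - x) <= d.+1%:R * 2 ^- q].
  move=> xt; have xN := tN x xt; have xg := grid_near q x.
  have d1 : d.+1%:R * 2 ^- q <= d.+1%:R :> R by rewrite ler_piMr.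
  have gx : enorm (grid q x - x) <= d.+1%:R * 2 ^- q by rewrite enorm_distC.
  split => //; first by rewrite (le_trans xN)// lerDl.
  rewrite -[grid q x](subrK x) addrC (le_trans (enormD _ _))//.
  by rewrite lerD// (le_trans gx).
apply/cvgrPdist_le => e e0.
pose A : R := p.+2%:R * (Lam * d.+1%:R).
have A0 : 0 <= A by rewrite !mulr_ge0.
have [Q Qe] : exists Q, 2 ^- Q < e / (A + 1).
  by apply: exists_small_pow; rewrite divr_gt0// ltr_wpDl.
exists Q => // q /= Qq.
have qe : p.+2%:R * (Lam * (d.+1%:R * 2 ^- q)) <= e.
  have q2 : 2 ^- q <= 2 ^- Q :> R.
    by rewrite lef_pV2 ?posrE ?exprn_gt0// ler_weXn2l// ler1n.
  have q0 : 0 <= 2 ^- q :> R by rewrite invr_ge0 exprn_ge0.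
  move: Qe; rewrite ltr_pdivlMr ?ltr_wpDl// => Qe.
  rewrite !mulrA -[p.+2%:R * Lam * _]mulrA -/A; nra.
have st : size t = p.+2 by exact: size_tuple.
have h1 : hull_volume t <= hull_volume (map (grid q) t) + e.
  have := lip _ id (grid q) (d.+1%:R * 2 ^- q) t [::].
  rewrite /= map_id add0n st => /(_ erefl) h; rewrite (le_trans (h _ _))//.
    by move=> z zt; have [] := bnd q z zt.
  by rewrite lerD2l.
have h2 : hull_volume (map (grid q) t) <= hull_volume t + e.
  have := lip _ (grid q) id (d.+1%:R * 2 ^- q) t [::].
  rewrite /= map_id add0n st => /(_ erefl) h; rewrite (le_trans (h _ _))//.
    by move=> z zt; have [] := bnd q z zt.
  by rewrite lerD2l.
by rewrite ler_norml; apply/andP; split; lra.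
Qed.

End hull_volume_measurable.

(** * Comparison of iterated integrals *)

Section iterated_integral.
Context {dis} {T : measurableType dis} {R : realType}.
Implicit Types (f g : seq T -> \bar R) (P Q : probability T R) (Ps : seq (probability T R)).

Local Notation emeasurable X F := (@measurable_fun _ _ X (\bar R) setT F).

(** Unlike [iid], a list of laws can mix the laws of two bodies, and a function of sequences can be
    permuted or have its head fixed. *)
Fixpoint iter_integral Ps f : \bar R :=
  if Ps is P :: Ps' then (\int[P]_x iter_integral Ps' (fun s => f (x :: s)))%E else f [::].

Definition measurable_seq n f := emeasurable (n.-tuple T) (fun t => f t).

Lemma measurable_seq_cons2 n f : measurable_seq n.+1 f ->
  emeasurable (T * n.-tuple T)%type (fun z => f (z.1 :: z.2)).
Proof.
move=> mf; have := measurableT_comp mf (@measurable_tuple_cons _ T n).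
exact.
Qed.

Lemma measurable_seq_cons n f x : measurable_seq n.+1 f ->
  measurable_seq n (fun s => f (x :: s)).
Proof.
by move=> /measurable_seq_cons2 mf; exact: (measurableT_comp mf (measurable_pair1 x)).
Qed.

Lemma iter_integral_ge0 Ps f : (forall s, 0 <= f s)%E -> (0 <= iter_integral Ps f)%E.
Proof.
elim: Ps f => [|P Ps IH] f f0 //=; apply: integral_ge0 => x _.
by apply: IH => s; exact: f0.
Qed.

(** The parameter space is general because in the induction it absorbs the variable that is
    integrated next. *)
Lemma measurable_iter_integral_param d' (Z : measurableType d') Ps (g : Z -> seq T -> \bar R) :
  (forall z s, 0 <= g z s)%E ->
  emeasurable (Z * (size Ps).-tuple T)%type (fun u => g u.1 u.2) ->
  emeasurable Z (fun z => iter_integral Ps (g z)).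
Proof.
elim: Ps d' Z g => [|P Ps IH] d' Z g g0 mg /=.
  have mp : measurable_fun [set: Z] (fun z : Z => (z, [tuple] : 0.-tuple T)).
    by apply: measurable_fun_pair => //; exact: measurable_cst.
  exact: (measurableT_comp mg mp).
pose g' (u : Z * T) s := g u.1 (u.2 :: s).
have mg' : emeasurable ((Z * T) * (size Ps).-tuple T)%type (fun u => g' u.1 u.2).
  have mp : measurable_fun [set: (Z * T) * (size Ps).-tuple T]
      (fun u => (u.1.1, [tuple of u.1.2 :: u.2])).
    apply: measurable_fun_pair; first exact: measurableT_comp.
    apply: measurable_cons; last exact: measurable_snd.
    exact: measurableT_comp.
  exact: (measurableT_comp mg mp).
have mh := IH _ _ g' (fun _ _ => g0 _ _) mg'.
apply: (@measurable_fun_fubini_tonelli_F _ _ _ _ _ P (fun u => iter_integral Ps (g' u))) => // u.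
by apply: iter_integral_ge0 => s; exact: g0.
Qed.

Lemma measurable_iter_integral Ps f : (forall s, 0 <= f s)%E ->
  measurable_seq (size Ps).+1 f ->
  emeasurable T (fun x => iter_integral Ps (fun s => f (x :: s))).
Proof.
move=> f0 mf; apply: (measurable_iter_integral_param (g := fun x s => f (x :: s))) => //.
exact: measurable_seq_cons2.
Qed.

Lemma iid_integral P n f : (forall s, 0 <= f s)%E -> measurable_seq n f ->
  (\int[iid P n]_t f t = iter_integral (nseq n P) f)%E.
Proof.
elim: n f => [|n IH] f f0 mf /=; first by rewrite integral_dirac// diracT mul1e.
rewrite ge0_integral_distribution//.
have := @fubini_tonelli1 _ _ _ _ _ P (iid P n) (fun z => f (z.1 :: z.2)).
move=> /(_ (measurable_seq_cons2 mf) (fun _ => f0 _)) ->.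
apply: eq_integral => x _; rewrite /fubini_F/=; apply: IH => //.
exact: measurable_seq_cons.
Qed.

Lemma eq_iter_integral Ps f g : (forall s, size s = size Ps -> f s = g s) ->
  iter_integral Ps f = iter_integral Ps g.
Proof.
elim: Ps f g => [|P Ps IH] f g fg /=; first exact: fg.
by apply: eq_integral => x _; apply: IH => s sP; apply: fg; rewrite /= sP.
Qed.

Lemma le_iter_integral Ps f g : (forall s, 0 <= f s)%E -> (forall s, 0 <= g s)%E ->
  measurable_seq (size Ps) f -> measurable_seq (size Ps) g ->
  (forall s, size s = size Ps -> f s <= g s)%E ->
  (iter_integral Ps f <= iter_integral Ps g)%E.
Proof.
elim: Ps f g => [|P Ps IH] f g f0 g0 mf mg fg /=; first exact: fg.
have If x : (0 <= iter_integral Ps (fun s => f (x :: s)))%E.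
  by apply: iter_integral_ge0 => s; exact: f0.
have mIf := measurable_iter_integral f0 mf.
have mIg := measurable_iter_integral g0 mg.
apply: ge0_le_integral => // x _; apply: IH => //; [exact: measurable_seq_cons..|].
by move=> s sP; apply: fg; rewrite /= sP.
Qed.

Lemma iter_integralD Ps f g : (forall s, 0 <= f s)%E -> (forall s, 0 <= g s)%E ->
  measurable_seq (size Ps) f -> measurable_seq (size Ps) g ->
  (iter_integral Ps (fun s => f s + g s) = iter_integral Ps f + iter_integral Ps g)%E.
Proof.
elim: Ps f g => [//|P Ps IH] f g f0 g0 mf mg /=.
rewrite -ge0_integralD//.
- apply: eq_integral => x _.
  by rewrite -IH//; exact: measurable_seq_cons.
- by move=> x _; apply: iter_integral_ge0 => s; exact: f0.
- exact: (measurable_iter_integral f0 mf).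
- by move=> x _; apply: iter_integral_ge0 => s; exact: g0.
- exact: (measurable_iter_integral g0 mg).
Qed.

Lemma iter_integralZl Ps f (k : R) : 0 <= k -> (forall s, 0 <= f s)%E ->
  measurable_seq (size Ps) f ->
  (iter_integral Ps (fun s => k%:E * f s) = k%:E * iter_integral Ps f)%E.
Proof.
elim: Ps f => [//|P Ps IH] f k0 f0 mf /=.
rewrite -ge0_integralZl//.
- by apply: eq_integral => x _; rewrite -IH//; exact: measurable_seq_cons.
- exact: measurable_iter_integral.
- by move=> x _; apply: iter_integral_ge0 => s; exact: f0.
Qed.

Lemma iter_integral_cst Ps (c : \bar R) : (0 <= c)%E -> iter_integral Ps (fun=> c) = c.
Proof.
move=> c0; elim: Ps => [//|P Ps IH] /=.
rewrite (eq_integral (fun=> c)) => [|x _]; last exact: IH.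
rewrite integral_cst// [X in (_ * X)%E](_ : _ = 1%E) ?mule1//.
exact: (probability_setT P).
Qed.

Lemma iter_integral_swap P Q Ps f : (forall s, 0 <= f s)%E ->
  measurable_seq (size Ps).+2 f ->
  (forall s s', perm_eq s s' -> f s = f s') ->
  iter_integral (P :: Q :: Ps) f = iter_integral (Q :: P :: Ps) f.
Proof.
move=> f0 mf fP /=.
have mh : emeasurable (T * T)%type (fun u => iter_integral Ps (fun s => f (u.1 :: u.2 :: s))).
  apply: (measurable_iter_integral_param (g := fun u s => f (u.1 :: u.2 :: s))) => //.
  have mp : measurable_fun [set: (T * T) * (size Ps).-tuple T]
      (fun u => [tuple of u.1.1 :: [tuple of u.1.2 :: u.2]]).
    apply: measurable_cons; first exact: measurableT_comp.
    apply: measurable_cons; last exact: measurable_snd.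
    exact: measurableT_comp.
  exact: (measurableT_comp mf mp).
have := @fubini_tonelli _ _ _ _ _ P Q
  (fun u => iter_integral Ps (fun s => f (u.1 :: u.2 :: s))) mh.
move=> /(_ (fun _ => iter_integral_ge0 _ (fun _ => f0 _))) /= ->.
apply: eq_integral => y _; apply: eq_integral => x _.
apply: eq_iter_integral => s _; apply: fP.
exact: (permEl (perm_catCA [:: x] [:: y] s)).
Qed.

Lemma iter_integral_rot P Qs Ps f : (forall s, 0 <= f s)%E ->
  measurable_seq (size Qs + size Ps).+1 f ->
  (forall s s', perm_eq s s' -> f s = f s') ->
  iter_integral (Qs ++ P :: Ps) f = iter_integral (P :: Qs ++ Ps) f.
Proof.
elim: Qs f => [//|Q Qs IH] f f0 mf fP.
rewrite [RHS]iter_integral_swap//=; last by rewrite size_cat.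
apply: eq_integral => x _; rewrite IH//; first exact: measurable_seq_cons.
by move=> s s' ss'; apply: fP; rewrite perm_cons.
Qed.

(* Replacing the factors one at a time, with the replaced variable moved to the front. *)
Lemma iid_integral_lt P Q n f : (forall s, 0 <= f s)%E -> measurable_seq n.+1 f ->
  (forall s s', perm_eq s s' -> f s = f s') ->
  (forall i j, (i + j)%N = n ->
     (iter_integral (P :: nseq i Q ++ nseq j P) f <
      iter_integral (Q :: nseq i Q ++ nseq j P) f)%E) ->
  (\int[iid P n.+1]_t f t < \int[iid Q n.+1]_t f t)%E.
Proof.
move=> f0 mf fP step; rewrite !iid_integral//.
have chain i : (i <= n)%N -> (iter_integral (nseq n.+1 P) f <
    iter_integral (nseq i.+1 Q ++ nseq (n - i) P) f)%E.
  elim: i => [|i IH] i_n; first by have := step 0 n; rewrite subn0; exact.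
  apply: (lt_trans (IH (ltnW i_n))).
  have ij : (i.+1 + (n - i.+1))%N = n by rewrite subnKC.
  have := step i.+1 (n - i.+1)%N ij.
  rewrite -[X in (X < _)%E]iter_integral_rot ?size_nseq ?ij//.
  by rewrite -[P :: nseq _ P]/(nseq (n - i.+1).+1 P) subnSK.
by have := chain n (leqnn n); rewrite subnn cats0.
Qed.

End iterated_integral.

(** In the induction, Chebyshev's inequality [0 <= (b - c) * (b ^+ k - c ^+ k)] bounds
    [(b + c) * (b ^+ k + c ^+ k)] by twice the sum of the next powers. *)
Lemma midpoint_exprn {R : realFieldType} (a b c : R) k : 0 <= a -> 0 <= b -> 0 <= c ->
  2 * a <= b + c -> 2 * a ^+ k <= b ^+ k + c ^+ k.
Proof.
move=> a0 b0 c0 abc; elim: k => [|k IH]; first by rewrite !expr0; lra.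
have bk : 0 <= b ^+ k by rewrite exprn_ge0.
have ck : 0 <= c ^+ k by rewrite exprn_ge0.
have ak : 0 <= a ^+ k by rewrite exprn_ge0.
have cheb : 0 <= (b - c) * (b ^+ k - c ^+ k).
  have [bc|/ltW cb] := leP b c.
    by rewrite mulr_le0// subr_le0// lerXn2r ?nnegrE.
  by rewrite mulr_ge0// subr_ge0// lerXn2r ?nnegrE.
rewrite !exprS; nra.
Qed.

Section one_step.
Context {dis} {T : measurableType dis} {R : realType}.
Variables (P Q : probability T R) (S C D : set T) (F : T -> \bar R).
Variables (a b g e f0 r gap M : R).
Hypotheses (mS : measurable S) (mC : measurable C) (mD : measurable D).
Hypotheses (SC : S `&` C = set0) (SD : S `&` D = set0).
Hypotheses (a0 : 0 < a) (b0 : 0 < b) (abge : a - b = g - e) (eg : e <= g).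
Hypotheses (PSC : P (S `|` C) = 1%E).
Hypotheses (PC : P C = (g / a)%:E) (QD : Q D = (e / b)%:E).
Hypothesis PQ : forall X, measurable X -> X `<=` S -> (b%:E * Q X = a%:E * P X)%E.
Hypotheses (mF : measurable_fun [set: T] F) (F0 : forall x, (0 <= F x)%E).
Hypothesis FM : forall x, (F x <= M%:E)%E.
Hypothesis FC : forall x, C x -> (F x <= (f0 + r)%:E)%E.
Hypothesis FD : forall x, D x -> (f0%:E <= F x + r%:E)%E.
Hypotheses (f00 : 0 <= f0) (r0 : 0 <= r).
Hypothesis gapP : ((f0 + gap)%:E <= \int[P]_x F x)%E.
Hypothesis small : (g + e) * r < (g - e) * gap.

Let mFS E : measurable E -> measurable_fun E F.
Proof. by move=> mE; apply: measurable_funS mF. Qed.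

Let int_fin (P' : probability T R) E : measurable E ->
  (\int[P']_(x in E) F x)%E \is a fin_num.
Proof.
move=> mE; rewrite ge0_fin_numE; last by apply: integral_ge0.
have M0 : 0 <= M by rewrite -lee_fin (le_trans (F0 point)).
apply: (@le_lt_trans _ _ (\int[P']_(x in E) M%:E)%E).
  by apply: ge0_le_integral => //; exact: mFS.
rewrite integral_cst// lte_mul_pinfty ?lee_fin//.
by rewrite (le_lt_trans (probability_le1 _ mE))// ltry.
Qed.

Let int_cst (P' : probability T R) E (x : R) : measurable E ->
  (\int[P']_(y in E) x%:E = x%:E * P' E)%E.
Proof. by move=> mE; exact: integral_cst. Qed.

(** [P] and [Q] stand for the laws of the larger and the smaller body, [S] for the common boundary,
    [C] for the tip, [D] for the cut; [a], [b], [g], [e] are the areas of the two boundaries, of [C]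
    and of [D], and [f0] is the value at the apex, with error [r] on [C] and [D]. If [I] is the mean
    under [P], then [b] times the gain is at least [(g - e) * (I - f0) - (g + e) * r], where
    [I - f0 >= gap]. *)
Lemma integral_lt_transfer : (\int[P]_x F x < \int[Q]_x F x)%E.
Proof.
pose I := fine (\int[P]_x F x).
pose s := fine (\int[P]_(x in S) F x).
pose c := fine (\int[P]_(x in C) F x).
pose q := fine (\int[Q]_(x in D) F x).
have IE : (\int[P]_x F x = I%:E)%E by rewrite fineK// int_fin.
have sE : (\int[P]_(x in S) F x = s%:E)%E by rewrite fineK// int_fin.
have cE : (\int[P]_(x in C) F x = c%:E)%E by rewrite fineK// int_fin.
have qE : (\int[Q]_(x in D) F x = q%:E)%E by rewrite fineK// int_fin.
have mSC : measurable (S `|` C) by exact: measurableU.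
have Isc : I = s + c.
  apply: EFin_inj; rewrite EFinD -IE -sE -cE -ge0_integral_setU//; last 2 first.
    exact: mFS.
    exact/eqP.
  have mN : measurable (~` (S `|` C)) by exact: measurableC.
  have PN : P (~` (S `|` C)) = 0%E by rewrite probability_setC// PSC subee.
  by rewrite (ge0_negligible_integral mN measurableT mF _ PN)// setTD setCK.
have c_le : c <= (g / a) * (f0 + r).
  rewrite -lee_fin -cE.
  apply: (@le_trans _ _ (\int[P]_(x in C) (f0 + r)%:E)%E).
    by apply: ge0_le_integral => //; exact: mFS.
  by rewrite int_cst// PC -EFinM mulrC.
have q_ge : (e / b) * f0 <= q + r * (e / b).
  rewrite -lee_fin EFinD -qE.
  have -> : (r * (e / b))%:E = (\int[Q]_(x in D) r%:E)%E.
    by rewrite int_cst// QD.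
  rewrite -ge0_integralD//; last exact: mFS.
  apply: (@le_trans _ _ (\int[Q]_(x in D) f0%:E)%E).
    by rewrite int_cst// QD -EFinM mulrC.
  apply: ge0_le_integral => //.
  by apply: emeasurable_funD => //; exact: mFS.
have sQ : (\int[Q]_(x in S) F x = (a / b * s)%:E)%E.
  have ab0 : 0 <= a / b by rewrite divr_ge0// ltW.
  rewrite (eq_measure_integral (mscale (NngNum ab0) P)).
    by rewrite ge0_integral_mscale//= ?sE//; exact: mFS.
  move=> X mX XS; rewrite /mscale/=; apply: (@mulfinI _ b) => //.
  by rewrite PQ// muleA -EFinM mulrC divfK// gt_eqF.
rewrite IE; apply: (@lt_le_trans _ _ (a / b * s + q)%:E); last first.
  have mSD : measurable (S `|` D) by exact: measurableU.
  rewrite EFinD -sQ -qE -ge0_integral_setU//; last 2 first.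
    exact: mFS.
    exact/eqP.
  by apply: ge0_subset_integral.
have gapI : f0 + gap <= I by rewrite -lee_fin -IE.
rewrite lte_fin -(ltr_pM2l b0) mulrDr.
have -> : b * (a / b * s) = a * s by field; rewrite gt_eqF.
have h1 : a * c <= g * (f0 + r).
  have := ler_wpM2l (ltW a0) c_le.
  by rewrite (_ : a * (g / a * (f0 + r)) = g * (f0 + r))//; field; rewrite gt_eqF.
have h2 : e * f0 <= b * q + e * r.
  have := ler_wpM2l (ltW b0) q_ge.
  rewrite (_ : b * (e / b * f0) = e * f0); last by field; rewrite gt_eqF.
  by rewrite (_ : b * (q + r * (e / b)) = b * q + e * r)//; field; rewrite gt_eqF.
have h3 : (g - e) * (f0 + gap) <= (g - e) * I by rewrite ler_wpM2l// subr_ge0.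
have : a * I = a * s + a * c by rewrite Isc mulrDr.
have : b * I = a * I - (g - e) * I by rewrite -abge; ring.
have h4 := small; rewrite !mulrDr in h3 h1; rewrite mulrDl in h4.
lra.
Qed.

End one_step.

Section box_lower_bound.
Context {dis} {T : measurableType dis} {R : realType}.
Implicit Types (As : seq (set T)).

Fixpoint in_boxes As (s : seq T) : bool :=
  match As, s with
  | A :: As', x :: s' => `[< A x >] && in_boxes As' s'
  | _, _ => true
  end.

Lemma measurable_in_boxes As (w : R) n : (forall A, A \in As -> measurable A) ->
  (size As <= n)%N ->
  measurable_seq n (fun s => if in_boxes As s then w%:E else 0%E).
Proof.
move=> mA An; pose B (i : 'I_n) := nth setT As i.
have mB i : measurable (B i).
  rewrite /B; have [iA|Ai] := ltnP i (size As); last by rewrite nth_default.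
  by apply: mA; rewrite mem_nth.
have boxE (t : n.-tuple T) : in_boxes As t <-> [set t : n.-tuple T | forall i, B i (tnth t i)] t.
  have in_nth : forall As' s, (size As' <= size s)%N -> in_boxes As' s <->
      forall i, (i < size s)%N -> nth setT As' i (nth point s i).
    move=> As' s; elim: As' s => [|A As' IH] [|x s]//=.
    - by move=> _; split => // _ i _; rewrite nth_nil.
    - rewrite ltnS => /IH {}IH; split=> [/andP[/asboolP Ax /IH h] [|i]//=|h].
        by rewrite ltnS; exact: h.
      apply/andP; split; first by apply/asboolP; exact: (h 0).
      by apply/IH => i i_s; exact: (h i.+1).
  have st : (size As <= size t)%N by rewrite size_tuple.
  apply: (iff_trans (in_nth As t st)); split=> h i.
    by rewrite (tnth_nth point); apply: h; rewrite size_tuple.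
  by rewrite size_tuple => i_n; have := h (Ordinal i_n); rewrite (tnth_nth point).
pose E := [set t : n.-tuple T | forall i, B i (tnth t i)].
have mE : measurable E by exact: measurable_tuple_box.
have fE : (fun t : n.-tuple T => if in_boxes As t then w%:E else 0%E) =
    (fun t => (w * \1_E t)%:E).
  apply/funext => u; rewrite indicE; case: ifPn => [/boxE uE|/negP uE].
    by rewrite mem_set// mulr1.
  by rewrite memNset ?mulr0// => /boxE.
rewrite /measurable_seq fE.
by apply/measurable_EFinP; apply: measurable_funM => //; exact: measurable_indic.
Qed.

(** Restricting each variable to its box contributes a factor of at least [beta]. The index type [I]
    gives one bound for all the laws that the list mixes. *)
Lemma iter_integral_box (I : Type) (pr : I -> probability T R) (bs : seq I) As (w beta : R) :
  0 <= w -> 0 <= beta -> size As = size bs ->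
  (forall A, A \in As -> measurable A) ->
  (forall i A, A \in As -> (beta%:E <= pr i A)%E) ->
  ((w * beta ^+ size bs)%:E <=
   iter_integral (map pr bs) (fun s => if in_boxes As s then w%:E else 0%E))%E.
Proof.
move=> w0 beta0; elim: bs As => [|i bs IH] [|A As]//= => [_ _ _|[sA] mA prA].
  by rewrite expr0 mulr1.
have mA0 : measurable A by apply: mA; rewrite mem_head.
set c := iter_integral (map pr bs) (fun s => if in_boxes As s then w%:E else 0%E).
have c_ge : ((w * beta ^+ size bs)%:E <= c)%E.
  apply: IH => // [B BA|j B BA]; first by apply: mA; rewrite inE BA orbT.
  by apply: prA; rewrite inE BA orbT.
rewrite exprS mulrCA EFinM.
apply: (@le_trans _ _ (\int[pr i]_(x in A) (w * beta ^+ size bs)%:E)%E).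
  rewrite integral_cst// muleC lee_wpmul2l ?lee_fin ?mulr_ge0 ?exprn_ge0//.
  by apply: prA; rewrite mem_head.
rewrite integral_mkcond.
have p0 x : (0 <= ((fun=> (w * beta ^+ size bs)%:E) \_ A) x)%E.
  by rewrite patchE; case: ifP => // _; rewrite lee_fin mulr_ge0 ?exprn_ge0.
have mp : measurable_fun [set: T] ((fun=> (w * beta ^+ size bs)%:E) \_ A).
  by apply/(measurable_restrictT _ _).1.
have mI : measurable_fun [set: T] (fun x => iter_integral (map pr bs)
    (fun s => if in_boxes (A :: As) (x :: s) then w%:E else 0%E)).
  apply: (measurable_iter_integral (f := fun s => if in_boxes (A :: As) s then w%:E else 0%E)).
    by move=> s; case: ifP.
  by rewrite size_map; apply: measurable_in_boxes => //=; rewrite sA.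
apply: ge0_le_integral => // x _; rewrite patchE; case: ifPn => [/set_mem Ax|_].
  by rewrite (asboolT Ax)/=.
by apply: iter_integral_ge0 => s; case: ifP.
Qed.

End box_lower_bound.

(** * Moments with one vertex fixed *)

Section truncated_power.
Context {R : realType} {m : nat}.
Local Notation V := 'rV[R]_(1 + m).
Implicit Types (x y : V) (s : seq V).

(* Both bodies lie in the unit ball; the cut-off makes the integrand bounded on the whole space. *)
Definition ball_power k s : R :=
  if all (fun x => `|x| <= 1) s then hull_volume s ^+ k else 0.

Lemma ball_power_ge0 k s : 0 <= ball_power k s.
Proof. by rewrite /ball_power; case: ifP => // _; rewrite exprn_ge0// hull_volume_ge0. Qed.

Lemma ball_power_in k s : all (fun x => `|x| <= 1) s ->
  ball_power k s = hull_volume s ^+ k.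
Proof. by rewrite /ball_power => ->. Qed.

Lemma ball_power_out k s : ~~ all (fun x => `|x| <= 1) s -> ball_power k s = 0.
Proof. by rewrite /ball_power => /negbTE ->. Qed.

Lemma all_ball_cons x s : `|x| <= 1 ->
  all (fun x => `|x| <= 1) (x :: s) = all (fun x => `|x| <= 1) s.
Proof. by move=> /= ->. Qed.

Lemma ball_power_perm k s s' : perm_eq s s' -> ball_power k s = ball_power k s'.
Proof.
by move=> ss'; rewrite /ball_power (perm_all _ ss') (hull_volume_perm ss').
Qed.

Lemma closed_unit_ball : closed [set x : V | `|x| <= 1].
Proof.
apply: (@closed_comp _ _ (fun x : V => `|x|) [set y : R | y <= 1]).
  by move=> x _; exact: norm_continuous.
exact: closed_le.
Qed.

Lemma unit_ball_borel : measurable ([set x : V | `|x| <= 1] : set (borel_rV R (1 + m))).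
Proof. by apply: closed_borel; exact: closed_unit_ball. Qed.

Lemma all_ball_borel n : measurable
  [set t : n.-tuple (borel_rV R (1 + m)) | all (fun x : V => `|x| <= 1) t].
Proof.
pose A (i : 'I_n) : set (borel_rV R (1 + m)) := [set x : V | `|x| <= 1].
have := @measurable_tuple_box _ (borel_rV R (1 + m)) n A (fun=> unit_ball_borel).
congr measurable.
apply/seteqP; split => t; first by move=> h; apply/all_tnthP.
by move=> /all_tnthP.
Qed.

Lemma measurable_ball_power k p :
  measurable_seq p.+2 (fun s : seq (borel_rV R (1 + m)) => (ball_power k s)%:E).
Proof.
apply/measurable_EFinP.
pose E := [set t : p.+2.-tuple (borel_rV R (1 + m)) | all (fun x : V => `|x| <= 1) t].
have fE : (fun t : p.+2.-tuple (borel_rV R (1 + m)) => ball_power k t) =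
    (fun t => hull_volume t ^+ k * \1_E t).
  apply/funext => t; rewrite /ball_power indicE; case: ifPn => [tE|/negP tE].
    by rewrite mem_set// mulr1.
  by rewrite memNset ?mulr0.
rewrite fE; apply: measurable_funM.
  by apply: measurable_funX; exact: measurable_hull_volume.
by apply: measurable_indic; exact: all_ball_borel.
Qed.

(** The Euclidean ball of this radius contains the unit ball of the sup norm. *)
Let rad : R := m.+2%:R.

Let enorm_ball x : `|x| <= 1 -> enorm x <= rad.
Proof.
by move=> x1; rewrite (le_trans (enorm_le_norm _))// -[leRHS]mulr1 ler_wpM2l.
Qed.

Lemma hull_volume_ball_bound p : exists2 C : R, 1 <= C &
  forall s, size s = p.+2 -> all (fun x => `|x| <= 1) s -> hull_volume s <= C.
Proof.
have [Lam L0 lip] := @hull_volume_lipschitz R (1 + m) p rad (ler0n _ _).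
exists (1 + Lam * (2 * rad)); first by rewrite lerDl !mulr_ge0.
case=> [//|x [//|y r]] [rp] /= /and3P[x1 y1 r1].
have := lip (y :: r) _ _ x y; rewrite hull_volume_diag add0r => h.
rewrite (le_trans (h _ _))//=; first by rewrite rp.
  move=> z; rewrite inE => /predU1P[->|zr]; first exact: enorm_ball.
  by apply: enorm_ball; exact: (allP r1).
rewrite ler_wpDl// ler_wpM2l// (le_trans (enormD _ _))// enormN.
by have := enorm_ball x1; have := enorm_ball y1; lra.
Qed.

Lemma ball_power_bound k p : exists2 C : R, 0 <= C &
  forall s, size s = p.+2 -> ball_power k s <= C.
Proof.
have [C C1 hC] := hull_volume_ball_bound p.
have C0 : 0 <= C by rewrite (le_trans ler01).
exists (C ^+ k); first exact: exprn_ge0.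
move=> s sp; rewrite /ball_power; case: ifPn => [s1|_]; last exact: exprn_ge0.
by rewrite lerXn2r ?nnegrE ?hull_volume_ge0// hC.
Qed.

Lemma exprn_lipschitz (C a b t : R) k : 0 <= a <= C -> 0 <= b -> 0 <= t -> a <= b + t ->
  a ^+ k <= b ^+ k + (k%:R * C ^+ k.-1) * t.
Proof.
move=> /andP[a0 aC] b0 t0 abt; have C0 : 0 <= C by exact: le_trans aC.
have [ab|ba] := leP a b.
  rewrite (@le_trans _ _ (b ^+ k)) ?lerXn2r ?nnegrE// lerDl.
  by rewrite !mulr_ge0 ?exprn_ge0.
have bC : b <= C by rewrite (le_trans (ltW ba)).
rewrite -lerBlDl subrXX mulrC.
apply: (@le_trans _ _ ((\sum_(i < k) C ^+ k.-1) * t)).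
  apply: ler_pM => //.
  - by rewrite sumr_ge0// => i _; rewrite mulr_ge0 ?exprn_ge0.
  - by rewrite subr_ge0 ltW.
  - apply: ler_sum => i _; rewrite [in leRHS](_ : k.-1 = (k.-1 - i) + i)%N; last first.
      by rewrite subnK// -ltnS prednK// (leq_ltn_trans _ (ltn_ord i)).
    by rewrite exprD ler_pM ?exprn_ge0// lerXn2r ?nnegrE.
  - by rewrite lerBlDl.
by rewrite sumr_const card_ord -[in leLHS]mulr_natl.
Qed.

Lemma ball_power_lipschitz k p : exists2 Lam : R, 0 <= Lam &
  forall s, size s = p.+1 -> forall x x', `|x| <= 1 -> `|x'| <= 1 ->
  ball_power k (x :: s) <= ball_power k (x' :: s) + Lam * enorm (x - x').
Proof.
have [Lam L0 lip] := @hull_volume_lipschitz R (1 + m) p rad (ler0n _ _).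
have [C C1 hC] := hull_volume_ball_bound p.
have C0 : 0 <= C by rewrite (le_trans ler01).
exists (k%:R * C ^+ k.-1 * Lam); first by rewrite !mulr_ge0 ?exprn_ge0.
move=> s sp x x' x1 x'1; have [s1|s1] := boolP (all (fun x => `|x| <= 1) s); last first.
  rewrite !ball_power_out ?all_ball_cons// add0r.
  by rewrite !mulr_ge0 ?exprn_ge0 ?enorm_ge0.
rewrite !ball_power_in ?all_ball_cons// -mulrA.
apply: exprn_lipschitz; [|exact: hull_volume_ge0|by rewrite mulr_ge0 ?enorm_ge0|].
  by rewrite hull_volume_ge0 hC ?all_ball_cons//= sp.
by apply: lip => // y ys; apply: enorm_ball; exact: (allP s1).
Qed.

Lemma ball_power_midpoint k x s : `|x| <= 1 -> (0 < size s)%N ->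
  2 * ball_power k (0 :: s) <= ball_power k (x :: s) + ball_power k (- x :: s).
Proof.
move=> x1 s0; have x1' : `|- x| <= 1 by rewrite normrN.
have z1 : `|0 : V| <= 1 by rewrite normr0 ler01.
have [s1|s1] := boolP (all (fun x => `|x| <= 1) s); last first.
  by rewrite !ball_power_out ?all_ball_cons// mulr0 addr0.
have in_ball y : `|y| <= 1 -> ball_power k (y :: s) = hull_volume (y :: s) ^+ k.
  by move=> y1; apply: ball_power_in; rewrite all_ball_cons.
rewrite (in_ball _ z1) (in_ball _ x1) (in_ball _ x1').
apply: midpoint_exprn; [exact: hull_volume_ge0..|].
exact: hull_volume_midpoint.
Qed.

End truncated_power.
Arguments measurable_ball_power {R m} k p.

Lemma in_boxes_nth {dis} {T : measurableType dis} (As : seq (set T)) s x0 :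
  size As = size s -> in_boxes As s ->
  forall i, (i < size s)%N -> nth setT As i (nth x0 s i).
Proof.
elim: As s => [|A As IH] [|x s]//= [sz] /andP[/asboolP Ax /IH h] [|i]//=.
by rewrite ltnS; exact: h.
Qed.

Section strict_gain.
Context {R : realType} {m : nat}.
Local Notation V := 'rV[R]_(1 + m).
Implicit Types (x y : V) (s : seq V).

(** The shift in [i.+1] skips coordinate 0, the height, so nodes lie in the plane w = 0. The length
    1/2 keeps balls of radius at most 1/2 around them inside the unit ball. *)
Definition node (i : nat) : V := \row_j (if j == i.+1 :> nat then 2^-1 else 0).

(* The midpoint inequality is strict near the simplex with these vertices, its first
   vertex [node 0] being the one that is reflected. *)
Definition nodes p : seq V := 0 :: [seq node i | i <- iota 1 p].

Definition ball_at (eta : R) (c : V) : set V := [set y | `|y - c| <= eta].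

Lemma node_norm i : `|node i| <= 2^-1.
Proof.
apply: normr_rV_le => [|j]; first by rewrite invr_ge0.
by rewrite mxE; case: ifP => _; rewrite ?normr0 ?invr_ge0// ger0_norm ?invr_ge0.
Qed.

Lemma nodes_norm p c : c \in nodes p -> `|c| <= 2^-1.
Proof.
by rewrite inE => /predU1P[->|/mapP[i _ ->]]; [rewrite normr0 invr_ge0|exact: node_norm].
Qed.

(** Seen from 0 the edges are orthogonal of length 1/2. There are [p.+1] of them in an m-dimensional
    plane, which is where the number of vertices is limited by the dimension. *)
Lemma hull_volume_nodes_gt0 p : (p.+1 <= m)%N -> 0 < hull_volume (node 0 :: nodes p).
Proof.
move=> pm; rewrite hull_volume_swap.
rewrite (_ : node 0 :: _ = [seq node i | i <- iota 0 p.+1])//.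
set r := [seq _ | _ <- _]; have rp : size r = p.+1 by rewrite size_map size_iota.
apply: (@hull_volume_gt0 _ _ _ 2^-1); rewrite ?invr_gt0//.
  by rewrite rp (leq_trans pm)// leqnSn.
move=> x; have -> : 2^-1 * enorm x = enorm (2^-1 *: x) by rewrite enormZ gtr0_norm ?invr_gt0.
apply: eq_enorm_sqr; rewrite [in RHS]enormZ gtr0_norm ?invr_gt0//.
have sq k (z : 'rV[R]_k) : enorm z ^+ 2 = (z *m z^T) 0 0.
  by rewrite sqr_enorm dotmxE; apply: eq_bigr => i _; rewrite expr2.
suff EE : edges 0 r *m (edges 0 r)^T = (2^-1 ^+ 2)%:M.
  by rewrite exprMn !sq trmx_mul mulmxA -[x *m _ *m _]mulmxA EE mul_mx_scalar -scalemxAl mxE.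
have rE (i : 'I_(size r)) : nth 0 r i = node i.
  by rewrite (nth_map 0) ?size_iota -?rp// nth_iota -?rp.
apply/matrixP => i l; rewrite mxE [RHS]mxE.
have im : (i.+1 < 1 + m)%N.
  by have := ltn_ord i; rewrite {2}rp; lia.
rewrite (bigD1 (Ordinal im))//= big1 => [|j ji].
  rewrite !mxE !rE subr0 !mxE/= eqxx addr0 eqSS.
  by rewrite -val_eqE/= subr0; case: eqP => _; rewrite ?mulr1n ?mulr0n ?mulr0.
rewrite !mxE !rE !subr0 !mxE; case: eqP => [jE|]; last by rewrite mul0r.
by move: ji; rewrite -val_eqE/= jE eqxx.
Qed.

(** Near the nodes the volume with vertex [x] is at least [v - v / 8], while with vertex 0 it is at
    most [v / 8], since 0 is also a node and the limiting simplex is flat. As [k > 0],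
    [(v / 8) ^+ k] is at most a quarter of [(v / 2) ^+ k]; this leaves a gain of half of
    [(v / 2) ^+ k], even with the term of [- x] bounded below by 0 only. *)
Lemma ball_power_gain k p : (0 < k)%N -> (p.+1 <= m)%N ->
  exists2 w : R, 0 < w & exists2 eta : R, 0 < eta <= 2^-1 &
  forall x s, size s = p.+1 -> ball_at eta (node 0) x ->
    in_boxes (map (ball_at eta) (nodes p) : seq (set (borel_rV R (1 + m)))) s ->
    2 * ball_power k (0 :: s) + w <= ball_power k (x :: s) + ball_power k (- x :: s).
Proof.
move=> k0 pm; have v0 := hull_volume_nodes_gt0 pm.
set v := hull_volume _ in v0.
pose N : R := m.+2%:R.
have [Lam L0 lip] := @hull_volume_lipschitz_seq R (1 + m) p N (ler0n _ _).
pose A : R := p.+2%:R * (Lam * N).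
have A0 : 0 <= A by rewrite !mulr_ge0.
exists ((v / 2) ^+ k / 2); first by rewrite divr_gt0// exprn_gt0// divr_gt0.
(* The second bound keeps the change of volume below [v / 8] when all [p.+2] vertices move by
   [eta]. *)
pose eta := Num.min 2^-1 (v / 8 / (A + 1)).
have eta0 : 0 < eta by rewrite lt_min invr_gt0 ltr0n !divr_gt0// ltr_wpDl.
have eta2 : eta <= 2^-1 by rewrite ge_min lexx.
have etaA : A * eta <= v / 8.
  have : eta <= v / 8 / (A + 1) by rewrite ge_min lexx orbT.
  rewrite ler_pdivlMr ?ltr_wpDl//; nra.
exists eta; first by rewrite eta0.
move=> x s sp xB sB.
have near_ball c y : `|c| <= 2^-1 -> ball_at eta c y -> `|y| <= 1.
  rewrite /ball_at/= => c2 yc; rewrite -[y](subrK c) (le_trans (ler_normD _ _))//.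
  by have := eta2; lra.
have near_enorm c y : `|c| <= 2^-1 -> ball_at eta c y ->
    [/\ enorm y <= N, enorm c <= N, enorm (y - c) <= N * eta & enorm (c - y) <= N * eta].
  move=> c2 yc; have y1 := near_ball c y c2 yc.
  have bnd (z : V) t : `|z| <= t -> enorm z <= N * t.
    move=> zt; apply: (@le_trans _ _ (N * `|z|)); first exact: enorm_le_norm.
    by rewrite ler_wpM2l.
  split; [by rewrite -[N]mulr1; exact: bnd| |exact: bnd|].
    rewrite -[N]mulr1; apply: bnd; rewrite (le_trans c2)//.
    by rewrite invf_le1// ler1n.
  by rewrite enorm_distC; exact: bnd.
have close (l l' : seq V) : size l = p.+2 -> size l' = p.+2 ->
    (forall i, (i < p.+2)%N -> [/\ enorm (nth 0 l i) <= N, enorm (nth 0 l' i) <= N &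
       enorm (nth 0 l i - nth 0 l' i) <= N * eta]) ->
    hull_volume l <= hull_volume l' + v / 8.
  move=> lp lp' ll'; have := lip _ (nth 0 l) (nth 0 l') (N * eta) (iota 0 p.+2) [::].
  rewrite size_iota add0n => /(_ erefl) h.
  have mapE (z : seq V) : size z = p.+2 -> map (nth 0 z) (iota 0 p.+2) = z.
    by move=> zp; rewrite map_nth_iota0 -?zp// take_size.
  rewrite !mapE// !cat0s in h; rewrite (le_trans (h _ _))//.
    by move=> i; rewrite mem_iota => /= ip; exact: ll'.
  by rewrite lerD2l (le_trans _ etaA)// /A !mulrA.
have sz : size (nodes p) = p.+1 by rewrite /= size_map size_iota.
have s_near i : (i < p.+1)%N -> ball_at eta (nth 0 (nodes p) i) (nth 0 s i).
  move=> ip; have := @in_boxes_nth _ (borel_rV R (1 + m)) _ _ 0 _ sB.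
  rewrite size_map sz sp => /(_ erefl i ip).
  by rewrite (nth_map 0) ?sz.
have nth_node i : (i < p.+1)%N -> `|nth 0 (nodes p) i| <= 2^-1.
  by move=> ip; apply: (@nodes_norm p); rewrite mem_nth ?sz.
have s_ball : all (fun x => `|x| <= 1) s.
  apply/(all_nthP 0) => i; rewrite sp => ip.
  by apply: near_ball (s_near i ip); exact: nth_node.
have x1 : `|x| <= 1 by apply: near_ball xB; exact: node_norm.
have z1 : `|0 : V| <= 1 by rewrite normr0 ler01.
have in_ball y : `|y| <= 1 -> ball_power k (y :: s) = hull_volume (y :: s) ^+ k.
  by move=> y1; apply: ball_power_in; rewrite all_ball_cons.
rewrite (in_ball _ x1) (in_ball _ z1).
have h1 : v <= hull_volume (x :: s) + v / 8.
  apply: close; [by rewrite /= size_map size_iota|by rewrite /= sp|].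
  case=> [_|i ip].
    by have [? ? ? ?] := near_enorm _ _ (node_norm 0) xB; split.
  by have [? ? ? ?] := near_enorm _ _ (nth_node i ip) (s_near i ip); split.
have h2 : hull_volume (0 :: s) <= v / 8.
  have hd : hull_volume (0 :: nodes p) = 0 by exact: hull_volume_diag.
  rewrite -[leRHS]add0r -hd; apply: close; [by rewrite /= sp|by rewrite /= size_map size_iota|].
  case=> [_|i ip]; last by have [? ? ? ?] := near_enorm _ _ (nth_node i ip) (s_near i ip); split.
  by rewrite /= subrr enorm0 !mulr_ge0// ltW.
have h0 := hull_volume_ge0 (0 :: s).
have v2 : 0 <= v / 2 by rewrite divr_ge0// ltW.
have v8 : 0 <= v / 8 by rewrite divr_ge0// ltW.
have hx := hull_volume_ge0 (x :: s).
have g3 := ball_power_ge0 k (- x :: s).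
move: (hull_volume (x :: s)) (hull_volume (0 :: s)) (ball_power k (- x :: s))
  h1 h2 h0 hx g3 v0 v2 v8 => hvx hv0 bp h1 h2 h0 hx g3 v0 v2 v8.
have g1 : (v / 2) ^+ k <= hvx ^+ k by rewrite lerXn2r ?nnegrE//; lra.
have g2 : hv0 ^+ k <= (v / 2) ^+ k / 4.
  apply: (@le_trans _ _ ((v / 8) ^+ k)); first by rewrite lerXn2r ?nnegrE.
  rewrite (_ : v / 8 = v / 2 / 4); last by field.
  rewrite expr_div_n ler_wpM2l ?exprn_ge0//.
  rewrite lef_pV2 ?posrE ?exprn_gt0// -[leLHS]expr1 ler_weXn2l// ler1n.
  by [].
lra.
Qed.

End strict_gain.

Section reflected_mean_gain.
Context {dis} {T : measurableType dis} {R : realType}.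
Variables (P : probability T R) (U A : set T) (refl : T -> T) (F : T -> \bar R).
Variables (C : R) (f0 : \bar R) (c beta : R).
Hypotheses (mU : measurable U) (mA : measurable A) (AU : A `<=` U) (PU : P U = 1%E).
Hypotheses (mrefl : measurable_fun [set: T] refl) (reflU : refl @^-1` U = U).
Hypothesis Prefl : forall X, measurable X -> P (refl @^-1` X) = P X.
Hypotheses (mF : measurable_fun [set: T] F) (F0 : forall x, (0 <= F x)%E).
Hypotheses (FC : forall x, (F x <= C%:E)%E) (f00 : (0 <= f0)%E) (f0C : (f0 <= C%:E)%E).
Hypotheses (c0 : 0 <= c) (PA : (beta%:E <= P A)%E).
Hypothesis mid : forall x, U x -> (2%:E * f0 <= F x + F (refl x))%E.
Hypothesis midA : forall x, A x -> (2%:E * f0 + c%:E <= F x + F (refl x))%E.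

(** By invariance of [P], twice the mean of [F] on [U] is the mean of [F x + F (refl x)], which is
    at least [2 * f0], and on [A] exceeds it by [c]. *)
Lemma reflected_mean_gain : (f0 + (c * beta / 2)%:E <= \int[P]_x F x)%E.
Proof.
have mFU : measurable_fun U F by exact: measurable_funS mF.
have mFr : measurable_fun U (F \o refl).
  by apply: measurable_funS (measurableT_comp mF mrefl).
have intC E : measurable E -> (\int[P]_(x in E) F x <= C%:E)%E.
  move=> mE; apply: (@le_trans _ _ (\int[P]_(x in E) C%:E)%E).
    by apply: ge0_le_integral => //; exact: measurable_funS mF.
  have C0 : 0 <= C by rewrite -lee_fin (le_trans f00).
  rewrite integral_cst// -[leRHS]mule1 lee_wpmul2l ?lee_fin//.
  exact: probability_le1.
have JU_fin : (\int[P]_(x in U) F x)%E \is a fin_num.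
  rewrite ge0_fin_numE; last by apply: integral_ge0.
  by rewrite (le_lt_trans (intC U mU))// ltry.
pose J := fine (\int[P]_(x in U) F x)%E.
pose fz := fine f0.
have fzE : f0 = fz%:E by rewrite fineK// ge0_fin_numE// (le_lt_trans f0C)// ltry.
have fz0 : 0 <= fz by rewrite fine_ge0.
have sym : (\int[P]_(x in U) F (refl x) = \int[P]_(x in U) F x)%E.
  have := ge0_integral_pushforward mrefl P mU mFU (fun y _ => F0 y).
  rewrite reflU => <-; apply: eq_measure_integral => X mX _.
  exact: (Prefl mX).
have lower : ((2 * fz + c * beta)%:E <= \int[P]_(x in U) (F x + F (refl x)))%E.
  apply: (@le_trans _ _ (\int[P]_(x in U) ((2 * fz)%:E + c%:E * (\1_A x)%:E))%E).
    rewrite ge0_integralD//; last 3 first.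
    - by move=> x _; rewrite lee_fin mulr_ge0.
    - by move=> x _; rewrite mule_ge0 ?lee_fin.
    - apply: measurable_funeM; apply/measurable_EFinP; exact: measurable_indic.
    rewrite ge0_integralZl//; last first.
      by apply/measurable_EFinP; exact: measurable_indic.
    rewrite integral_indic// integral_cst// EFinD leeD//.
      by rewrite [X in (_ <= _ * X)%E](_ : _ = 1%E) ?mule1//; exact: PU.
    rewrite EFinM lee_wpmul2l ?lee_fin//.
    by rewrite (setIidl AU); exact: PA.
  apply: ge0_le_integral => //.
  - by move=> x _; rewrite adde_ge0// ?mule_ge0 ?lee_fin// mulr_ge0.
  - apply: emeasurable_funD => //; apply: measurable_funeM.
    by apply/measurable_EFinP; exact: measurable_indic.
  - exact: emeasurable_funD.
  - move=> x Ux; rewrite indicE; have [/set_mem Ax|_] := boolP (x \in A).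
      by rewrite mule1 EFinM -fzE; exact: midA.
    by rewrite mule0 adde0 EFinM -fzE; exact: mid.
have JE : (\int[P]_(x in U) F x = J%:E)%E by rewrite fineK.
move: lower; rewrite ge0_integralD// sym JE -EFinD lee_fin => lower.
apply: (@le_trans _ _ J%:E); last first.
  by rewrite -JE; apply: ge0_subset_integral.
by rewrite fzE -EFinD lee_fin; lra.
Qed.

End reflected_mean_gain.

Section conditional_mean.
Context {R : realType} {m : nat}.
Local Notation V := 'rV[R]_(1 + m).
Local Notation B := (borel_rV R (1 + m)).
Implicit Types (x y : V) (Ps : seq (probability B R)).

(** The function F of the overview, for any list of laws of the other vertices. *)
Definition cond_mean k Ps (x : B) : \bar R :=
  iter_integral Ps (fun s : seq B => (ball_power k (x :: s))%:E).

Lemma ball_power_EFin_ge0 k (s : seq B) : (0 <= (ball_power k s)%:E)%E.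
Proof. by rewrite lee_fin; exact: ball_power_ge0. Qed.

Lemma cond_mean_ge0 k Ps x : (0 <= cond_mean k Ps x)%E.
Proof. by apply: iter_integral_ge0 => s; exact: ball_power_EFin_ge0. Qed.

Lemma measurable_ball_power_cons k p x :
  measurable_seq p.+1 (fun s : seq B => (ball_power k (x :: s))%:E).
Proof.
exact: (measurable_seq_cons (f := fun s : seq B => (ball_power k s)%:E) x
  (measurable_ball_power k p)).
Qed.
Arguments measurable_ball_power_cons : clear implicits.

Lemma measurable_cond_mean k Ps p : size Ps = p.+1 ->
  measurable_fun [set: B] (cond_mean k Ps).
Proof.
move=> sp; apply: (measurable_iter_integral (f := fun s : seq B => (ball_power k s)%:E)).
  by move=> s; exact: ball_power_EFin_ge0.
by rewrite sp; exact: measurable_ball_power.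
Qed.

Lemma cond_mean_bound k p : exists2 C : R, 0 <= C &
  forall Ps x, size Ps = p.+1 -> (cond_mean k Ps x <= C%:E)%E.
Proof.
have [C C0 hC] := @ball_power_bound R m k p.
exists C => // Ps x sp; rewrite -(iter_integral_cst Ps (c := C%:E)) ?lee_fin//.
apply: le_iter_integral.
- by move=> s; exact: ball_power_EFin_ge0.
- by move=> s; rewrite lee_fin.
- by rewrite sp; exact: measurable_ball_power_cons.
- exact: measurable_cst.
- by move=> s ss; rewrite lee_fin; apply: hC; rewrite /= ss sp.
Qed.

Lemma cond_mean_lipschitz k p : exists2 Lam : R, 0 <= Lam &
  forall Ps x x', size Ps = p.+1 -> `|x : V| <= 1 -> `|x' : V| <= 1 ->
  (cond_mean k Ps x <= cond_mean k Ps x' + (Lam * enorm ((x : V) - x'))%:E)%E.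
Proof.
have [Lam L0 lip] := @ball_power_lipschitz R m k p.
exists Lam => // Ps x x' sp x1 x'1.
have e0 : 0 <= Lam * enorm ((x : V) - x') by rewrite mulr_ge0 ?enorm_ge0.
rewrite -[X in (_ <= _ + X)%E](iter_integral_cst Ps) ?lee_fin//.
rewrite /cond_mean -iter_integralD.
- apply: le_iter_integral.
  + by move=> s; exact: ball_power_EFin_ge0.
  + by move=> s; rewrite adde_ge0 ?lee_fin//; exact: ball_power_ge0.
  + by rewrite sp; exact: measurable_ball_power_cons.
  + apply: emeasurable_funD; last exact: measurable_cst.
    by rewrite sp; exact: measurable_ball_power_cons.
  + move=> s ss; rewrite -EFinD lee_fin; apply: lip => //.
    by rewrite ss sp.
- by move=> s; exact: ball_power_EFin_ge0.
- by move=> s; rewrite lee_fin.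
- by rewrite sp; exact: measurable_ball_power_cons.
- exact: measurable_cst.
Qed.

Lemma ball_at_borel eta (c : V) : measurable (ball_at eta c : set B).
Proof.
apply: closed_borel.
apply: (@closed_comp _ _ (fun x : V => x - c) [set y | `|y| <= eta]).
  move=> x _; apply: (@lipschitz_rV_continuous _ _ _ _ 1) => a b.
  by rewrite mul1r opprB addrA subrK.
apply: (@closed_comp _ _ (fun x : V => `|x|) [set y : R | y <= eta]).
  by move=> x _; exact: norm_continuous.
exact: closed_le.
Qed.

Lemma oppr_borel : measurable_fun [set: B] (fun x : B => - (x : V) : B).
Proof.
apply: (@continuous_borel R (1 + m) (1 + m) (fun x => - x)).
apply: (@lipschitz_rV_continuous _ _ _ _ 1) => a b.
by rewrite mul1r -opprD normrN.
Qed.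

(** The strict gain [w] holds when the [p.+1] other vertices fall in the balls around [nodes p] and
    the reflected one falls in the ball around [node 0]; elsewhere the plain midpoint inequality is
    used. [w] and [eta] come before the laws, so they serve all bodies and all mixtures. *)
Lemma cond_mean_gain k p : (0 < k)%N -> (p.+1 <= m)%N ->
  exists2 w : R, 0 < w & exists2 eta : R, 0 < eta <= 2^-1 &
  forall (I : Type) (pr : I -> probability B R) (P : probability B R) (bs : seq I) (beta : R),
    size bs = p.+1 -> 0 <= beta ->
    (forall i c, c \in nodes p -> (beta%:E <= pr i (ball_at eta c))%E) ->
    (beta%:E <= P (ball_at eta (node 0)))%E ->
    P [set x : V | (`|x| <= 1)%R] = 1%E ->
    (forall X : set B, measurable X -> P ((fun x : V => (- x)%R) @^-1` X) = P X) ->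
  (cond_mean k (map pr bs) (0%R : V) + (w / 2 * beta ^+ p.+2)%:E <=
   \int[P]_x cond_mean k (map pr bs) x)%E.
Proof.
move=> k0 pm; have [w w0 [eta eta0 gain]] := @ball_power_gain R m k p k0 pm.
exists w => //; exists eta => // I pr P bs beta sb beta0 prB PB P1 Psym.
set Ps := map pr bs; have sp : size Ps = p.+1 by rewrite size_map.
pose F := cond_mean k Ps.
pose U : set B := [set x : V | (`|x| <= 1)%R].
have mU : measurable U by exact: unit_ball_borel.
pose c := w * beta ^+ p.+1.
have c0 : 0 <= c by rewrite mulr_ge0 ?exprn_ge0// ltW.
pose A : set B := ball_at eta (node 0).
have mA : measurable A by exact: ball_at_borel.
have mF : measurable_fun [set: B] F by exact: measurable_cond_mean sp.
have F0 x : (0 <= F x)%E by exact: cond_mean_ge0.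
have mFN : measurable_fun [set: B] (fun x : B => F (- (x : V))%R).
  exact: (measurableT_comp mF oppr_borel).
pose As := map (ball_at eta) (nodes p) : seq (set B).
have sAs : size As = p.+1 by rewrite size_map /= size_map size_iota.
have AsP X : X \in As -> exists2 c, c \in nodes p & X = ball_at eta c.
  by move=> /mapP.
have mAs X : X \in As -> measurable X.
  by move=> /AsP[z _ ->]; exact: ball_at_borel.
pose bx (s : seq B) : \bar R := if in_boxes As s then w%:E else 0%E.
have bx0 s : (0 <= bx s)%E by rewrite /bx; case: ifP => // _; rewrite lee_fin ltW.
have mbx : measurable_seq p.+1 bx by apply: measurable_in_boxes; rewrite ?sAs.
have box_ge : (c%:E <= iter_integral Ps bx)%E.
  rewrite /c -sb; apply: iter_integral_box; rewrite ?(ltW w0) ?sAs ?sb//.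
  by move=> i X /AsP[z zp ->]; exact: prB.
have W0 := fun x s => ball_power_EFin_ge0 k (x :: s).
have mW x := measurable_ball_power_cons k p x.
have F2 : (2%:E * F (0%R : V) =
    iter_integral Ps (fun s => 2%:E * (ball_power k ((0%R : V) :: s))%:E))%E.
  by rewrite iter_integralZl ?sp.
have mW2 : measurable_seq p.+1 (fun s : seq B => (2%:E * (ball_power k ((0%R : V) :: s))%:E)%E).
  by apply: measurable_funeM; exact: mW.
have W20 (s : seq B) : (0 <= 2%:E * (ball_power k ((0%R : V) :: s))%:E)%E by rewrite mule_ge0.
have FD x : (F x + F (- (x : V))%R = iter_integral Ps (fun s : seq B =>
    (ball_power k (x :: s))%:E + (ball_power k ((- (x : V))%R :: s))%:E))%E.
  by rewrite iter_integralD ?sp.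
have mid x : U x -> (2%:E * F (0%R : V) <= F x + F (- (x : V))%R)%E.
  move=> Ux; rewrite F2 FD; apply: le_iter_integral.
  - exact: W20.
  - by move=> s; apply: adde_ge0; exact: W0.
  - by rewrite sp; exact: mW2.
  - by rewrite sp; apply: emeasurable_funD; exact: mW.
  - move=> s; rewrite sp => ss; rewrite -EFinM -EFinD lee_fin.
    by apply: ball_power_midpoint; [exact: Ux|rewrite ss].
have midA x : A x -> (2%:E * F (0%R : V) + c%:E <= F x + F (- (x : V))%R)%E.
  move=> Ax; apply: (@le_trans _ _ (2%:E * F (0%R : V) + iter_integral Ps bx)%E).
    by rewrite leeD2l.
  rewrite F2 FD -iter_integralD; [|exact: W20|exact: bx0|by rewrite sp|by rewrite sp].
  apply: le_iter_integral.
  - by move=> s; apply: adde_ge0; [exact: W20|exact: bx0].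
  - by move=> s; apply: adde_ge0; exact: W0.
  - by rewrite sp; apply: emeasurable_funD; [exact: mW2|exact: mbx].
  - by rewrite sp; apply: emeasurable_funD; exact: mW.
  - move=> s; rewrite sp => ss; rewrite /bx; case: ifPn => sB.
      by rewrite -EFinM -!EFinD lee_fin; exact: (gain x s ss Ax sB).
    rewrite adde0 -EFinM -EFinD lee_fin.
    have x1 : `|x : V| <= 1.
      rewrite -[x : V](subrK (node 0 : V)) (le_trans (ler_normD _ _))//.
      by have := node_norm (R := R) (m := m) 0; move: Ax; rewrite /A /ball_at/=; lra.
    by apply: ball_power_midpoint; [exact: x1|rewrite ss].
have UA : A `<=` U.
  move=> x; rewrite /A /U /ball_at/= => Ax.
  rewrite -[x : V](subrK (node 0 : V)) (le_trans (ler_normD _ _))//.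
  by have := node_norm (R := R) (m := m) 0; move: Ax; lra.
have UN : (fun x : V => - x) @^-1` U = U.
  by apply/seteqP; split => x; rewrite /U/= normrN.
have [C C0 hC] := cond_mean_bound k p.
have -> : w / 2 * beta ^+ p.+2 = c * beta / 2 by rewrite /c exprS; ring.
exact: (reflected_mean_gain mU mA UA P1 oppr_borel UN Psym mF F0 (fun x => hC Ps x sp)
  (F0 _) (hC Ps _ sp) c0 PB mid midA).
Qed.

End conditional_mean.

(** * The two bipyramids *)

Section gauge_body.
Context {R : realType} {m : nat}.
Local Notation V := 'rV[R]_(1 + m).
Variables (q : V -> R) (A M : R).
Hypothesis qZ : forall t x, 0 <= t -> q (t *: x) = t * q x.
Hypothesis qD : forall x y, q (x + y) <= q x + q y.
Hypothesis q_lip : forall x y, `|q x - q y| <= A * `|x - y|.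
Hypotheses (M0 : 0 < M) (q_coer : forall x, `|x| <= M * q x).

Let q0 : q 0 = 0. Proof. by rewrite -(scale0r 0) qZ// mul0r. Qed.

Lemma gauge_continuous : continuous q.
Proof. exact: (@lipschitz_rV_continuous _ _ _ _ A). Qed.

Lemma gauge_closed a : closed [set x | q x <= a].
Proof.
apply: (@closed_comp _ _ q [set y | y <= a]); last exact: closed_le.
by move=> x _; exact: gauge_continuous.
Qed.

Lemma gauge_open a : open [set x | q x < a].
Proof.
apply: (@open_comp _ _ q [set y | y < a]); last exact: open_lt.
by move=> x _; exact: gauge_continuous.
Qed.

Let gauge_interior : [set x | q x <= 1]° = [set x | q x < 1].
Proof.
apply/seteqP; split => x; last first.
  move=> qx; apply: (@filterS _ _ _ [set x | q x < 1]).
    by move=> y; exact: ltW.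
  by apply: open_nbhs_nbhs; split => //; exact: gauge_open.
rewrite /interior -nbhs_ballE => -[e /= e0 xe].
rewrite /mkset; apply: contrapT => /negP; rewrite -leNgt => qx.
have x0 : 0 < `|x| + 1 by rewrite ltr_wpDl.
(* [t] is small enough for [(1 + t) *: x] to stay in the ball of radius [e] around [x], although its
   gauge exceeds 1. *)
pose t := e / 2 / (`|x| + 1).
have t0 : 0 < t by rewrite !divr_gt0.
have : q ((1 + t) *: x) <= 1.
  apply: xe; rewrite -ball_normE/= scalerDl scale1r opprD addNKr normrN normrZ gtr0_norm//.
  apply: (@le_lt_trans _ _ (t * (`|x| + 1))); first by rewrite ler_wpM2l ?(ltW t0)// lerDl.
  by rewrite /t divfK ?gt_eqF//; lra.
rewrite qZ ?addr_ge0 ?(ltW t0)//; nra.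
Qed.

Lemma gauge_boundary : boundary [set x | q x <= 1] = [set x | q x = 1].
Proof.
rewrite /boundary gauge_interior -((closure_id _).1 (@gauge_closed 1)).
apply/seteqP; split => x /=; first by move=> [q1 /negP]; rewrite -leNgt => ?; apply/le_anti/andP.
by move=> ->; split => //; rewrite ltxx.
Qed.

Lemma gauge_convex_body : convex_body [set x | q x <= 1].
Proof.
split.
- apply: bounded_closed_compact; last exact: gauge_closed.
  exists M; split; first exact: num_real.
  move=> y My x /= q1; rewrite (le_trans (q_coer x))// (le_trans _ (ltW My))//.
  by rewrite ler_piMr// ltW.
- apply/convex_setP => x y t /andP[t0 t1] /= x1 y1.
  rewrite (le_trans (qD _ _))// !qZ ?subr_ge0//.
  have : t * q x <= t * 1 by rewrite ler_wpM2l.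
  have : (1 - t) * q y <= (1 - t) * 1 by rewrite ler_wpM2l// subr_ge0.
  lra.
- by exists 0; rewrite gauge_interior /= q0 ltr01.
Qed.

End gauge_body.

Section bipyramid.
Context {R : realType} {m : nat}.
Local Notation V := 'rV[R]_(1 + m).
Variables (eps rho : R).
Hypotheses (eps0 : 0 < eps) (eps1 : eps <= 1) (rho0 : 0 < rho) (rho1 : rho < 1).

Definition height (x : V) : R := x 0 ord0.

Definition bipyramid_gauge (x : V) : R := `|rsubmx x| + `|height x| / eps.

(** A maximum of gauges describes an intersection, here with a half-space; [height x] carries no
    absolute value because only the upper tip is cut. *)
Definition truncated_gauge (x : V) : R :=
  Num.max (bipyramid_gauge x) (height x / (eps * (1 - rho))).

Definition bipyramid : set V := [set x | bipyramid_gauge x <= 1].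

Definition truncated_bipyramid : set V := [set x | truncated_gauge x <= 1].

Let w0 : R := eps * (1 - rho).

Let w0_gt0 : 0 < w0. Proof. by rewrite mulr_gt0// subr_gt0. Qed.

Lemma rsubmx_norm_le (x : V) : `|rsubmx x| <= `|x|.
Proof. by apply: normr_rV_le => // i; rewrite mxE coord_norm_le. Qed.

Lemma height_norm_le (x : V) : `|height x| <= `|x|.
Proof. exact: coord_norm_le. Qed.

Lemma norm_le_height_rsubmx (x : V) e : `|height x| <= e -> `|rsubmx x| <= e -> `|x| <= e.
Proof.
move=> h1 h2; apply: normr_rV_le => [|i]; first exact: le_trans h1.
case: (@split_ordP 1 m i) => j ->.
  by rewrite (ord1 j) (_ : lshift m 0 = ord0)//; exact: val_inj.
rewrite (_ : x 0 (rshift 1 j) = rsubmx x 0 j); last by rewrite mxE.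
exact: le_trans (coord_norm_le _ _) h2.
Qed.

Lemma heightD (x y : V) : height (x + y) = height x + height y.
Proof. by rewrite /height mxE. Qed.

Let heightZ t x : height (t *: x) = t * height x.
Proof. by rewrite /height mxE. Qed.

Lemma heightN (x : V) : height (- x) = - height x.
Proof. by rewrite /height mxE. Qed.

Let bipZ t x : 0 <= t -> bipyramid_gauge (t *: x) = t * bipyramid_gauge x.
Proof.
move=> t0; rewrite /bipyramid_gauge linearZ/= normrZ heightZ normrM ger0_norm//.
by rewrite mulrDr mulrA.
Qed.

Let bipD x y : bipyramid_gauge (x + y) <= bipyramid_gauge x + bipyramid_gauge y.
Proof.
rewrite /bipyramid_gauge linearD/= heightD addrACA -mulrDl.
by rewrite lerD ?ler_normD// ler_wpM2r ?invr_ge0 ?(ltW eps0)// ler_normD.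
Qed.

Let bip_le x : bipyramid_gauge x <= (1 + eps^-1) * `|x|.
Proof.
rewrite /bipyramid_gauge mulrDl mul1r lerD ?rsubmx_norm_le// mulrC.
by rewrite ler_wpM2l ?invr_ge0 ?(ltW eps0)// height_norm_le.
Qed.

Let bip_coer x : `|x| <= 1 * bipyramid_gauge x.
Proof.
rewrite mul1r; apply: norm_le_height_rsubmx; rewrite /bipyramid_gauge.
  rewrite ler_wpDl// ler_pdivlMr// ler_piMr//.
by rewrite lerDl divr_ge0// ltW.
Qed.

Let sublinear_lipschitz (q : V -> R) (A : R) : (forall x y, q (x + y) <= q x + q y) ->
  (forall x, q x <= A * `|x|) -> forall x y, `|q x - q y| <= A * `|x - y|.
Proof.
move=> qD qA x y; rewrite ler_norml; apply/andP; split.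
  have := qD x (y - x); have := qA (y - x).
  by rewrite [x + _]addrC subrK distrC; lra.
have := qD y (x - y); have := qA (x - y).
by rewrite [y + _]addrC subrK; lra.
Qed.

Let trZ t x : 0 <= t -> truncated_gauge (t *: x) = t * truncated_gauge x.
Proof.
by move=> t0; rewrite /truncated_gauge bipZ// heightZ -mulrA maxr_pMr.
Qed.

Let trD x y : truncated_gauge (x + y) <= truncated_gauge x + truncated_gauge y.
Proof.
rewrite /truncated_gauge ge_max; apply/andP; split.
  by rewrite (le_trans (bipD _ _))// lerD// le_max lexx.
by rewrite heightD mulrDl lerD// le_max lexx orbT.
Qed.

Let tr_le x : truncated_gauge x <= (1 + eps^-1 + w0^-1) * `|x|.
Proof.
rewrite /truncated_gauge ge_max; apply/andP; split.
  rewrite (le_trans (bip_le _))// ler_wpM2r// lerDl invr_ge0 ltW//.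
apply: (@le_trans _ _ (w0^-1 * `|x|)).
  rewrite -/w0 mulrC ler_wpM2l ?invr_ge0 ?(ltW w0_gt0)//.
  by rewrite (le_trans (ler_norm _))// height_norm_le.
by rewrite ler_wpM2r// lerDr addr_ge0// invr_ge0 ltW.
Qed.

Let tr_coer x : `|x| <= 1 * truncated_gauge x.
Proof. by rewrite (le_trans (bip_coer x))// !mul1r le_max lexx. Qed.

Lemma bipyramid_convex_body : convex_body bipyramid.
Proof. exact: gauge_convex_body bipZ bipD (sublinear_lipschitz bipD bip_le) ltr01 bip_coer. Qed.

Lemma truncated_convex_body : convex_body truncated_bipyramid.
Proof. exact: gauge_convex_body trZ trD (sublinear_lipschitz trD tr_le) ltr01 tr_coer. Qed.

Lemma truncated_subset : truncated_bipyramid `<=` bipyramid.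
Proof. by move=> x; rewrite /truncated_bipyramid/= ge_max => /andP[]. Qed.

(** The rim, where the gauge is 1 and the height is [w0], is assigned to this set; the strict
    inequalities in [tip] and [cut] keep both disjoint from it. *)
Definition common_boundary : set V := [set x | bipyramid_gauge x = 1 /\ height x <= w0].
Definition tip : set V := [set x | bipyramid_gauge x = 1 /\ w0 < height x].
Definition cut : set V := [set x | bipyramid_gauge x < 1 /\ height x = w0].

Lemma boundary_bipyramid : boundary bipyramid = common_boundary `|` tip.
Proof.
rewrite (gauge_boundary bipZ (sublinear_lipschitz bipD bip_le)).
apply/seteqP; split => x /=; last by move=> [[]|[]].
by move=> x1; case: (leP (height x) w0) => h; [left|right].
Qed.

Lemma boundary_truncated : boundary truncated_bipyramid = common_boundary `|` cut.
Proof.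
rewrite (gauge_boundary trZ (sublinear_lipschitz trD tr_le)).
have hE x : (height x / w0 <= 1) = (height x <= w0) by rewrite ler_pdivrMr// mul1r.
apply/seteqP; split => x /=.
  rewrite /truncated_gauge -/w0 => t1.
  have : Num.max (bipyramid_gauge x) (height x / w0) <= 1 by rewrite t1.
  rewrite ge_max hE => /andP[b1 h1].
  have [b1'|b1'] := eqVneq (bipyramid_gauge x) 1; first by left.
  right; split; first by rewrite lt_neqAle b1'.
  move: t1; rewrite maxEle; case: ifP => _ h; last by rewrite h eqxx in b1'.
  by rewrite -[height x](@divfK _ w0) ?gt_eqF// h mul1r.
move=> [[b1 h1]|[b1 h1]]; rewrite /truncated_gauge -/w0.
  by rewrite b1 max_l// hE.
by rewrite h1 divff ?gt_eqF// max_r// ltW.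
Qed.

End bipyramid.

(** * Areas of cones over balls *)

Section bipyramid_areas.
Context {R : realType} {m : nat}.
Local Notation V := 'rV[R]_(1 + m).
Local Notation H := (@hausdorff_measure R _ m).
Implicit Types z : 'rV[R]_m.

Definition at_height (a : R) z : V := row_mx a%:M z.

Lemma height_at a z : height (at_height a z) = a.
Proof.
transitivity (row_mx (a%:M : 'M[R]_1) z 0 (lshift m 0)).
  by congr (row_mx _ _ _ _); exact: val_inj.
by rewrite row_mxEl mxE eqxx.
Qed.

Lemma rsubmx_at a z : rsubmx (at_height a z) = z.
Proof. exact: row_mxKr. Qed.

Lemma at_heightK (x : V) : at_height (height x) (rsubmx x) = x.
Proof.
rewrite -[RHS]hsubmxK; congr row_mx; rewrite [RHS]mx11_scalar mxE; congr (_%:M).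
by congr (x _ _); exact: val_inj.
Qed.

Lemma enorm_at_height a b z z' :
  enorm (at_height a z - at_height b z') ^+ 2 = (a - b) ^+ 2 + enorm (z - z') ^+ 2.
Proof.
rewrite opp_row_mx add_row_mx enorm_row_mx; congr (_ + _).
by rewrite sqr_enorm big_ord1 !mxE.
Qed.

Lemma norm_dist_le z z' : (`|z| - `|z'|) ^+ 2 <= enorm (z - z') ^+ 2.
Proof.
rewrite -real_normK ?num_real// lerXn2r ?nnegrE ?enorm_ge0//.
by rewrite (le_trans (ler_dist_dist _ _))// ler_norm_enorm.
Qed.

(** Each sheet of the boundaries is such a graph: slope [- eps] on the upper side, [eps] on the
    lower side, 0 on the cut. *)
Definition cone (h t : R) z : V := at_height (h + t * `|z|) z.

Lemma cone_lipschitz h t z z' : `|t| <= 1 ->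
  enorm (cone h t z - cone h t z') <= 2 * enorm (z - z').
Proof.
move=> t1; rewrite -(@ler_pXn2r _ 2)// ?nnegrE ?mulr_ge0 ?enorm_ge0// enorm_at_height.
have t2 : t ^+ 2 <= 1 by rewrite -[_ ^+ 2]real_normK ?num_real// expr_le1.
rewrite opprD addrACA subrr add0r -mulrBr exprMn exprMn.
have := norm_dist_le z z'; have := sqr_ge0 (`|z| - `|z'|); nra.
Qed.

Lemma cone_expands h t z z' : enorm (z - z') <= enorm (cone h t z - cone h t z').
Proof.
rewrite -(@ler_pXn2r _ 2)// ?nnegrE ?enorm_ge0// enorm_at_height lerDr.
exact: sqr_ge0.
Qed.

Lemma hausdorff_cone_le h t (A : set 'rV[R]_m) : `|t| <= 1 ->
  (H (cone h t @` A) <= (2 ^+ m)%:E * H A)%E.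
Proof.
move=> t1; rewrite -{2}[A]image_id; apply: hausdorff_lipschitz => // z z' _ _.
exact: cone_lipschitz.
Qed.

Lemma hausdorff_cone_ge h t (A : set 'rV[R]_m) : (H A <= H (cone h t @` A))%E.
Proof.
rewrite -{1}[A]image_id -[leRHS]mul1e -(expr1n R m).
apply: hausdorff_lipschitz => // z z' _ _; rewrite mul1r.
exact: cone_expands.
Qed.

Definition openb (r : R) : set 'rV[R]_m := [set z | `|z| < r].
Definition closedb (r : R) : set 'rV[R]_m := [set z | `|z| <= r].

(** Graphs of equal slope over balls are similar whatever their apex heights, so the ratio of the
    areas of tip and cut does not depend on [rho]. *)
Lemma hausdorff_cone_dilate h h' t r : 0 < r ->
  H (cone h t @` openb r) = ((r ^+ m)%:E * H (cone h' t @` openb 1))%E.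
Proof.
move=> r0; have -> : cone h t @` openb r = (fun z => cone h t (r *: z)) @` openb 1.
  apply/seteqP; split => [_ [z zr <-]|_ [z z1 <-]].
    exists (r^-1 *: z); last by rewrite scalerA mulfV ?gt_eqF// scale1r.
    rewrite /openb/= normrZ gtr0_norm ?invr_gt0// mulrC ltr_pdivrMr// mul1r.
    exact: zr.
  by exists (r *: z) => //; rewrite /openb/= normrZ gtr0_norm// gtr_pMr.
apply: hausdorff_similarity => // z z' _ _.
rewrite [RHS](_ : _ = enorm (r *: (cone h' t z - cone h' t z'))); last first.
  by rewrite enormZ gtr0_norm.
apply: eq_enorm_sqr; rewrite [in RHS]enormZ exprMn !enorm_at_height -scalerBr enormZ.
by rewrite !normrZ (gtr0_norm r0); ring.
Qed.

Lemma hausdorff_openb_fin r : (H (openb r) < +oo)%E.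
Proof. exact: (@hausdorff_bounded_lty _ _ _ r). Qed.

Lemma hausdorff_closedb_fin r : (H (closedb r) < +oo)%E.
Proof.
apply: (@hausdorff_bounded_lty _ _ _ (r + 1)) => z /= zr.
by rewrite (le_lt_trans zr)// ltrDl.
Qed.

Lemma hausdorff_closedb_gt0 r : 0 < r -> (0 < H (closedb r))%E.
Proof.
move=> r0; apply: (@lt_le_trans _ _ (H ((fun z => r *: z) @` cube m))).
  rewrite (@hausdorff_similarity _ _ _ _ _ (cube m) id _ r)//.
    by rewrite image_id mule_gt0 ?hausdorff_cube_gt0// lte_fin exprn_gt0.
  by move=> x y _ _; rewrite -scalerBr enormZ gtr0_norm.
apply: le_hausdorff_measure => _ [z Qz <-]; rewrite /closedb/= normrZ gtr0_norm//.
rewrite ler_piMr ?(ltW r0)//; apply: normr_rV_le => // i.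
by have /andP[z0 z1] := Qz i; rewrite ger0_norm// ltW.
Qed.

(* On a cube where the sup norm is the coordinate [i0], the cone is linear and stretches
   that coordinate only. *)
Lemma hausdorff_cone_gt (i0 : 'I_m) h t : t != 0 ->
  (* [Q] will be a cube of side 1/4, with coordinate [i0] in [1/2, 3/4) and the others in [0, 1/4),
     so that coordinate [i0] is the sup norm on it. *)
  exists2 tau : R, 0 < tau & (H (openb 1) + tau%:E <= H (cone h t @` openb 1))%E.
Proof.
move=> t0; pose c : 'rV[R]_m := 2^-1 *: delta_mx 0 i0.
pose u z := 4^-1 *: z + c.
pose Q := u @` cube m.
pose s := Num.sqrt (1 + t ^+ 2).
have t2 : 0 < t ^+ 2 by rewrite exprn_even_gt0.
have s1 : 1 < s by rewrite -sqrtr1 ltr_sqrt ?ltrDl// ltr_pwDl// sqr_ge0.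
have uE z i : u z 0 i = 4^-1 * z 0 i + (if i == i0 then 2^-1 else 0).
  by rewrite !mxE eqxx/=; case: eqP => _; rewrite ?mulr1 ?mulr0.
have uB z : cube m z -> `|u z| = 4^-1 * z 0 i0 + 2^-1.
  move=> Qz; apply/le_anti/andP; split; last first.
    have /andP[z0 z1] := Qz i0; have := coord_norm_le (u z) i0.
    by rewrite uE eqxx ger0_norm// addr_ge0// mulr_ge0.
  have /andP[y0 y1] := Qz i0.
  apply: normr_rV_le => [|i]; first by rewrite addr_ge0// mulr_ge0.
  have /andP[z0 z1] := Qz i; rewrite uE; case: eqP => [->|_].
    by rewrite ger0_norm// addr_ge0// mulr_ge0.
  by rewrite addr0 ger0_norm ?mulr_ge0//; lra.
have uD x y : u x - u y = 4^-1 *: (x - y).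
  by rewrite /u opprD addrACA subrr addr0 scalerBr.
have QB : Q `<=` openb 1.
  move=> _ [z Qz <-]; rewrite /openb/= uB//; have /andP[z0 z1] := Qz i0; lra.
have HQ : H Q = ((4^-1 ^+ m)%:E * H (cube m))%E.
  rewrite (@hausdorff_similarity _ _ _ _ _ (cube m) id _ 4^-1) ?image_id// => x y _ _.
  by rewrite uD enormZ gtr0_norm.
have HfQ : H (cone h t @` Q) = (s%:E * H Q)%E.
  have -> : cone h t @` Q = (cone h t \o u) @` cube m.
    by rewrite /Q image_comp.
  rewrite (@hausdorff_similarity _ _ _ _ _ (cube m) (fun z => z *m scale_coord i0 s) _ 4^-1)//.
    rewrite -/(lin_image _ _) factor_cube factor_scale_coord ?(lt_trans ltr01)//.
    by rewrite HQ muleCA.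
  move=> x y Qx Qy.
  rewrite [RHS](_ : _ =
    enorm (4^-1 *: (x *m scale_coord i0 s - y *m scale_coord i0 s))); last first.
    by rewrite enormZ gtr0_norm.
  apply: eq_enorm_sqr; rewrite /= enorm_at_height !uB// enormZ.
  rewrite uD enormZ !exprMn.
  rewrite -mulmxBl mul_mx_diag !sqr_enorm gtr0_norm//.
  rewrite [in LHS](bigD1 i0)//= [in RHS](bigD1 i0)//= !mxE eqxx exprMn.
  rewrite sqr_sqrtr; last by rewrite addr_ge0// sqr_ge0.
  set r1 := \sum_(_ | _) _; set r2 := \sum_(_ | _) _.
  have -> : r2 = r1.
    by apply: eq_bigr => i ii0; rewrite !mxE (negbTE ii0) mulr1.
  by ring.
have mQ : measurable (Q : set (borel_rV R m)).
  have -> : Q = (fun z => 4 *: (z - c)) @^-1` cube m.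
    apply/seteqP; split => [_ [z Qz <-]|z Qz] /=.
      by rewrite /u addrK scalerA mulfV// scale1r.
    by exists (4 *: (z - c)) => //; rewrite /u scalerA mulVf// scale1r subrK.
  have cont : continuous (fun z : 'rV[R]_m => 4 *: (z - c)).
    apply: (@lipschitz_rV_continuous _ _ _ _ 4) => a b.
    by rewrite -scalerBr normrZ gtr0_norm// opprB addrA subrK.
  have := continuous_borel cont measurableT cube_borel.
  by rewrite setTI.
have mA : measurable ((fun y : V => rsubmx y) @^-1` Q : set (borel_rV R (1 + m))).
  have cont : continuous (fun y : V => rsubmx y).
    apply: (@lipschitz_rV_continuous _ _ _ _ 1) => a b.
    by rewrite mul1r -linearB/= rsubmx_norm_le.
  have := continuous_borel cont measurableT mQ.
  by rewrite setTI.
have HQ_fin : H Q \is a fin_num.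
  rewrite ge0_fin_numE ?hausdorff_measure_ge0//.
  by rewrite (le_lt_trans (le_hausdorff_measure m QB))// hausdorff_openb_fin.
have HQ0 : 0 < fine (H Q).
  by rewrite -lte_fin fineK// HQ mule_gt0 ?hausdorff_cube_gt0.
pose hq := fine (H Q).
have HQE : H Q = hq%:E by rewrite fineK.
exists ((s - 1) * hq); first by rewrite mulr_gt0// subr_gt0.
(* The cone is split along the Borel cylinder over [Q]: over [Q] its area is multiplied by [s], and
   over the rest it is at least that of the projection. *)
rewrite (hausdorff_measureU m (cone h t @` openb 1) mA).
rewrite (hausdorff_measureU m (openb 1) mQ).
apply: (@le_trans _ _ (H (cone h t @` Q) + H (cone h t @` (openb 1 `\` Q)))%E); last first.
  apply: leeD; apply: le_hausdorff_measure.
    move=> _ [z Qz <-]; split; first by exists z => //; exact: QB.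
    by rewrite /preimage /mkset rsubmx_at.
  move=> _ [z [z1 zQ] <-]; split; first by exists z.
  by rewrite /preimage /mkset rsubmx_at.
rewrite HfQ (setIidr QB).
apply: (@le_trans _ _ (s%:E * H Q + H (openb 1 `\` Q))%E).
  rewrite addeAC leeD2r// HQE -EFinM -EFinD lee_fin.
  by rewrite mulrBl mul1r addrC subrK.
by rewrite leeD2l// hausdorff_cone_ge.
Qed.

End bipyramid_areas.

Section uniform_boundary_law.
Context {R : realType} {m : nat}.
Local Notation V := 'rV[R]_(1 + m).
Local Notation B := (borel_rV R (1 + m)).
Local Notation H := (@hausdorff_measure R (1 + m) m).

Lemma uniform_boundaryE (X : set V) (A : set B) : (0 < H (boundary X))%E ->
  (H (boundary X) < +oo)%E ->
  uniform_boundary X A = (H (A `&` boundary X) * (fine (H (boundary X)))^-1%:E)%E.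
Proof.
move=> X0 Xoo.
have sT : surface_area X setT = H (boundary X).
  exact: (congr1 H (setTI (boundary X))).
have := @mnormalizeE _ B R (surface_area X) (dirac (point : B)) A.
rewrite sT => /(_ X0 Xoo) e; exact: e.
Qed.

(** The cut-off in [ball_power] changes the integrand only on a null set. *)
Lemma moment_ball_power k p (X : set V) (P := uniform_boundary X) :
  P [set x : V | `|x| <= 1] = 1%E ->
  moment p.+2 k X = (\int[iid P p.+2]_t (ball_power k (t : seq V))%:E)%E.
Proof.
move=> P1; rewrite /moment unlock -/P.
pose E : set (p.+2.-tuple B) := [set t | all (fun x : V => `|x| <= 1) t].
have mE : measurable E by exact: all_ball_borel.
have PE : iid P p.+2 E = 1%E.
  pose A (i : 'I_p.+2) : set B := [set x : V | `|x| <= 1].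
  have := @iid_box _ B R P p.+2 A (fun=> unit_ball_borel).
  rewrite big1 => [<-|i _]; last exact: P1.
  congr (iid P p.+2 _); apply/seteqP; split => t /=; first by move=> /all_tnthP.
  by move=> h; apply/all_tnthP.
have mN : measurable (~` E) by exact: measurableC.
have PN : iid P p.+2 (~` E) = 0%E by rewrite probability_setC// PE subee.
have mf : measurable_fun [set: p.+2.-tuple B]
      (fun t : p.+2.-tuple B => (simplex_volume (t : p.+2.-tuple V) ^+ k)%:E).
  apply/measurable_EFinP; apply: measurable_funX.
  apply: (eq_measurable_fun (fun t : p.+2.-tuple B => hull_volume t)).
    by move=> t _; rewrite simplex_volumeE.
  exact: measurable_hull_volume.
have f0 t : [set: p.+2.-tuple B] t -> (0 <= (simplex_volume (t : p.+2.-tuple V) ^+ k)%:E)%E.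
  by move=> _; rewrite simplex_volumeE lee_fin exprn_ge0// hull_volume_ge0.
rewrite (ge0_negligible_integral mN measurableT mf f0 PN).
have mg : measurable_fun [set: p.+2.-tuple B]
      (fun t : p.+2.-tuple B => (ball_power k (t : seq V))%:E).
  exact: measurable_ball_power.
have g0 t : [set: p.+2.-tuple B] t -> (0 <= (ball_power k (t : seq V))%:E)%E.
  by move=> _; rewrite lee_fin ball_power_ge0.
rewrite (ge0_negligible_integral mN measurableT mg g0 PN).
apply: eq_integral => t; rewrite setTD setCK => /set_mem tE.
by rewrite ball_power_in// simplex_volumeE.
Qed.

End uniform_boundary_law.

Section bipyramid_boundary.
Context {R : realType} {m : nat}.
Local Notation V := 'rV[R]_(1 + m).
Local Notation B := (borel_rV R (1 + m)).
Local Notation H := (@hausdorff_measure R _ m).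
Variables (eps rho : R).
Hypotheses (eps0 : 0 < eps) (eps1 : eps <= 1) (rho0 : 0 < rho) (rho1 : rho < 1).

Local Notation S := (@common_boundary R m eps rho).
Local Notation C := (@tip R m eps rho).
Local Notation D := (@cut R m eps rho).
Let w0 : R := eps * (1 - rho).

Let w0_gt0 : 0 < w0. Proof. by rewrite mulr_gt0// subr_gt0. Qed.

Lemma gauge_at a z : bipyramid_gauge eps (at_height a z : V) = `|z| + `|a| / eps.
Proof. by rewrite /bipyramid_gauge height_at rsubmx_at. Qed.

Lemma tip_cone : C = cone eps (- eps) @` openb rho.
Proof.
apply/seteqP; split => [x [x1 xw]|_ [z zr <-]].
  have hx : 0 < height x by rewrite (lt_trans w0_gt0).
  have e : height x = eps + - eps * `|rsubmx x|.
    move: x1; rewrite /bipyramid_gauge gtr0_norm// => /eqP.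
    by rewrite eq_sym -subr_eq => /eqP h; rewrite -[LHS](@divfK _ eps) ?gt_eqF// -h; ring.
  exists (rsubmx x); last by rewrite /cone -e at_heightK.
  move: xw; rewrite e /openb/= => h; rewrite -(ltr_pM2l eps0); lra.
have zr' : `|z| < rho by [].
have aE : eps + - eps * `|z| = eps * (1 - `|z|) by ring.
have a0 : 0 < eps + - eps * `|z| by rewrite aE mulr_gt0// subr_gt0 (lt_trans zr').
split; rewrite /cone ?gauge_at ?height_at.
  by rewrite gtr0_norm//; field; rewrite gt_eqF.
by rewrite aE ltr_pM2l// ltrD2l ltrN2.
Qed.

Lemma cut_cone : D = cone w0 0 @` openb rho.
Proof.
have w0e : `|w0| / eps = 1 - rho.
  by rewrite gtr0_norm// /w0 mulrAC divff ?mul1r// gt_eqF.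
apply/seteqP; split => [x [x1 xw]|_ [z zr <-]].
  exists (rsubmx x); last by rewrite /cone mul0r addr0 /w0 -xw at_heightK.
  move: x1; rewrite /bipyramid_gauge xw -/w0 w0e /openb/=; lra.
have zr' : `|z| < rho by [].
split; rewrite /cone mul0r addr0 ?gauge_at ?height_at// w0e; lra.
Qed.

Lemma hausdorff_tip : H C = ((rho ^+ m)%:E * H (cone (0 : R) (- eps) @` @openb R m 1))%E.
Proof. by rewrite tip_cone; exact: hausdorff_cone_dilate. Qed.

Lemma hausdorff_cut : H D = ((rho ^+ m)%:E * H (@openb R m 1))%E.
Proof.
rewrite cut_cone (hausdorff_cone_dilate w0 0)//; congr (_ * _)%E.
rewrite -[in RHS](image_id (openb 1)); apply: hausdorff_isometry => z z' _ _.
by apply: eq_enorm_sqr; rewrite enorm_at_height !mul0r subrr expr0n add0r.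
Qed.

Lemma common_boundary_tip_sub :
  S `|` C `<=` cone eps (- eps) @` closedb 1 `|` cone (- eps) eps @` closedb 1.
Proof.
move=> x Sx; have x1 : bipyramid_gauge eps x = 1 by case: Sx => -[].
have hx : eps - eps * `|rsubmx x| = `|height x|.
  rewrite -[RHS](@divfK _ eps) ?gt_eqF// -[X in X - _]mulr1 -x1 /bipyramid_gauge; ring.
have zx : `|rsubmx x| <= 1 by rewrite -x1 /bipyramid_gauge lerDl divr_ge0// ltW.
have [h0|h0] := leP 0 (height x); [left|right]; exists (rsubmx x) => //; rewrite /cone.
  by rewrite mulNr hx ger0_norm// at_heightK.
rewrite (_ : - eps + _ = height x) ?at_heightK//.
by move: hx; rewrite ltr0_norm//; lra.
Qed.

(** Two cones over the closed ball, each of area at most [2 ^+ m] times that of the ball, and one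
    more ball for the cut. Neither [eps] nor [rho] occurs. *)
Definition area_bound : R := (2 * 2 ^+ m + 1) * fine (H (@closedb R m 1)).

Let closedb_fin : H (@closedb R m 1) \is a fin_num.
Proof. by rewrite ge0_fin_numE ?hausdorff_measure_ge0// hausdorff_closedb_fin. Qed.

Let eps_le1 : `|eps| <= 1. Proof. by rewrite gtr0_norm. Qed.

Lemma hausdorff_common_boundary_tip_le : (H (S `|` C) <= (2 * 2 ^+ m * fine (H (@closedb R m 1)))%:E)%E.
Proof.
apply: (le_trans (le_hausdorff_measure m common_boundary_tip_sub)).
apply: (le_trans (outer_measureU2 _ _ _)).
rewrite EFinM fineK// (_ : 2 * 2 ^+ m = 2 ^+ m + 2 ^+ m)//; last by ring.
rewrite EFinD ge0_muleDl ?lee_fin ?exprn_ge0//.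
by apply: leeD; apply: hausdorff_cone_le; rewrite ?normrN.
Qed.

Lemma hausdorff_boundary_bipyramid_le : (H (boundary (@bipyramid R m eps)) <= area_bound%:E)%E.
Proof.
rewrite (boundary_bipyramid rho eps0) (le_trans hausdorff_common_boundary_tip_le)//.
by rewrite lee_fin /area_bound ler_wpM2r ?lerDl// fine_ge0// hausdorff_measure_ge0.
Qed.

Lemma hausdorff_boundary_truncated_le :
  (H (boundary (@truncated_bipyramid R m eps rho)) <= area_bound%:E)%E.
Proof.
rewrite (boundary_truncated eps0 rho1) (le_trans (outer_measureU2 _ _ _))//.
rewrite /area_bound mulrDl mul1r EFinD; apply: leeD.
  by rewrite (le_trans _ hausdorff_common_boundary_tip_le)//; apply: le_hausdorff_measure; exact: subsetUl.
rewrite fineK// [leLHS]hausdorff_cut.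
apply: (@le_trans _ _ (H (@openb R m 1))).
  rewrite -[leRHS]mul1e lee_wpmul2r ?hausdorff_measure_ge0// lee_fin.
  by rewrite exprn_ile1 ?ltW.
by apply: le_hausdorff_measure => z; exact: ltW.
Qed.

(** The lower sheet over the ball of radius [eta] around [c] has heights between [- eps] and 0,
    hence stays within [eta] of [c]. It belongs to the common boundary, and its projection is the
    whole ball. *)
Lemma hausdorff_common_ge eta (c : V) : eps <= eta -> eta <= 2^-1 -> height c = 0 ->
  `|c| <= 2^-1 -> (H (@closedb R m eta) <= H (ball_at eta c `&` S))%E.
Proof.
move=> ee e2 c0 c2.
apply: (@le_trans _ _ (H ((fun z => z + rsubmx c) @` closedb eta))).
  by rewrite (hausdorff_translate m (closedb eta) id) image_id.
apply: (le_trans (hausdorff_cone_ge (- eps) eps _)).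
apply: le_hausdorff_measure => _ [_ [z ze <-] <-].
have {}ze : `|z| <= eta by [].
have z1 : `|z + rsubmx c| <= 1.
  by rewrite (le_trans (ler_normD _ _))//; have := rsubmx_norm_le c; lra.
set y := z + rsubmx c in z1 *.
have a0 : - eps + eps * `|y| <= 0.
  by rewrite addrC subr_le0 ler_piMr// ltW.
split; last first.
  split; rewrite /cone ?gauge_at ?height_at; last by rewrite (le_trans a0)// ltW.
  by rewrite ler0_norm//; field; rewrite gt_eqF.
apply: norm_le_height_rsubmx.
  rewrite /height mxE -/(height _) mxE -/(height _) c0 oppr0 addr0 height_at ler0_norm//.
  have : 0 <= eps * `|y| by rewrite mulr_ge0// ltW.
  lra.
by rewrite linearB/= rsubmx_at /y addrK.
Qed.

End bipyramid_boundary.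

(** * Comparison of the moments *)

Section truncation_law.
Context {R : realType} {m : nat}.
Local Notation V := 'rV[R]_(1 + m).
Local Notation B := (borel_rV R (1 + m)).
Local Notation H := (@hausdorff_measure R _ m).
Variables (eps rho : R).
Hypotheses (eps0 : 0 < eps) (eps2 : eps <= 2^-1) (rho0 : 0 < rho) (rho1 : rho < 1).

Let eps1 : eps <= 1. Proof. by have := eps2; lra. Qed.

Local Notation S := (@common_boundary R m eps rho).
Local Notation C := (@tip R m eps rho).
Local Notation D := (@cut R m eps rho).
Local Notation L := (@bipyramid R m eps).
Local Notation K := (@truncated_bipyramid R m eps rho).
Local Notation w0 := (eps * (1 - rho)).

Let low_borel : measurable ([set x : V | height x <= w0] : set B).
Proof.
have := @continuous_borel_real R (1 + m) _ (@continuous_coord R (1 + m) ord0).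
move=> /(_ measurableT [set y | y <= w0]); rewrite setTI; apply.
by rewrite -[X in measurable X]set_itvNyc; exact: measurable_itv.
Qed.

Lemma common_boundary_borel : measurable (S : set B).
Proof.
rewrite (_ : S = boundary L `&` [set x | height x <= w0]).
  by apply: measurableI => //; exact: measurable_boundary.
rewrite (boundary_bipyramid rho eps0); apply/seteqP; split => x.
  by move=> Sx; split; [left|case: Sx].
by move=> [[//|[_ h]]] /=; rewrite leNgt h.
Qed.

Lemma tip_borel : measurable (C : set B).
Proof.
rewrite (_ : C = boundary L `\` S).
  by apply: measurableD; [exact: measurable_boundary|exact: common_boundary_borel].
rewrite (boundary_bipyramid rho eps0); apply/seteqP; split => x.
  by move=> Cx; split; [right|move=> [_]; case: Cx => _; rewrite ltNge => /negP].
by move=> [[]].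
Qed.

Lemma common_boundary_tip : S `&` C = set0.
Proof. by apply/seteqP; split => // x [[_ h] [_]]; rewrite ltNge h. Qed.

Lemma common_boundary_cut : S `&` D = set0.
Proof. by apply/seteqP; split => // x [[h _] [+ _]]; rewrite h ltxx. Qed.

Lemma cut_borel : measurable (D : set B).
Proof.
rewrite (_ : D = boundary K `\` S).
  by apply: measurableD; [exact: measurable_boundary|exact: common_boundary_borel].
rewrite (boundary_truncated eps0 rho1); apply/seteqP; split => x.
  move=> Dx; split; first by right.
  by move=> Sx; have : (S `&` D) x by []; rewrite common_boundary_cut.
by move=> [[]].
Qed.

Let fin_le (X : set V) (c : R) : (H X <= c%:E)%E -> H X \is a fin_num.
Proof.
by move=> h; rewrite ge0_fin_numE ?hausdorff_measure_ge0// (le_lt_trans h)// ltry.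
Qed.

Let fin_L : H (boundary L) \is a fin_num.
Proof. exact: fin_le (hausdorff_boundary_bipyramid_le rho eps0 eps1). Qed.

Let fin_K : H (boundary K) \is a fin_num.
Proof. exact: fin_le (hausdorff_boundary_truncated_le eps0 eps1 rho0 rho1). Qed.

Let fin_sub (X Y : set V) : X `<=` Y -> H Y \is a fin_num -> H X \is a fin_num.
Proof.
move=> XY; rewrite !ge0_fin_numE ?hausdorff_measure_ge0//.
exact/le_lt_trans/le_hausdorff_measure.
Qed.

Let S_L : S `<=` boundary L. Proof. by rewrite (boundary_bipyramid rho eps0); left. Qed.
Let C_L : C `<=` boundary L. Proof. by rewrite (boundary_bipyramid rho eps0); right. Qed.
Let S_K : S `<=` boundary K. Proof. by rewrite (boundary_truncated eps0 rho1); left. Qed.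
Let D_K : D `<=` boundary K. Proof. by rewrite (boundary_truncated eps0 rho1); right. Qed.

Let fineU (X Y : set V) : measurable (X : set B) -> X `&` Y = set0 ->
  H X \is a fin_num -> H Y \is a fin_num ->
  fine (H (X `|` Y)) = fine (H X) + fine (H Y).
Proof.
move=> mX XY fX fY; rewrite (hausdorff_measureU m (X `|` Y) mX) setUK setDUl setDv set0U.
by rewrite (setDidPl _ _).2 ?fineD// setIC.
Qed.

Lemma area_difference : fine (H (boundary L)) - fine (H (boundary K)) =
  fine (H C) - fine (H D).
Proof.
rewrite (boundary_bipyramid rho eps0) (boundary_truncated eps0 rho1).
rewrite !fineU ?common_boundary_tip ?common_boundary_cut//;
  try exact: common_boundary_borel; try exact: (fin_sub S_L); try exact: (fin_sub C_L);
  try exact: (fin_sub D_K).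
ring.
Qed.

Lemma common_boundary_gt0 : (0 < H S)%E.
Proof.
have h0 : height (0 : V) = 0 by rewrite /height mxE.
have z2 : `|0 : V| <= 2^-1 by rewrite normr0 invr_ge0.
have := hausdorff_common_ge eps0 rho1 eps2 (lexx _) h0 z2.
move=> h; have := le_trans h (le_hausdorff_measure m (@subIsetr _ _ _)).
by apply: lt_le_trans; rewrite hausdorff_closedb_gt0// invr_gt0.
Qed.

Lemma boundary_bipyramid_gt0 : (0 < H (boundary L))%E.
Proof. exact: lt_le_trans common_boundary_gt0 (le_hausdorff_measure m S_L). Qed.

Lemma boundary_truncated_gt0 : (0 < H (boundary K))%E.
Proof. exact: lt_le_trans common_boundary_gt0 (le_hausdorff_measure m S_K). Qed.

Section one_body.
Variable X : set V.
Hypotheses (X0 : (0 < H (boundary X))%E) (Xfin : H (boundary X) \is a fin_num).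

Let law A : uniform_boundary X A = (H (A `&` boundary X) * (fine (H (boundary X)))^-1%:E)%E.
Proof. by apply: uniform_boundaryE => //; rewrite -ge0_fin_numE// ltW. Qed.

Let X0' : 0 < fine (H (boundary X)).
Proof. by rewrite fine_gt0// X0 -ge0_fin_numE// ltW. Qed.

Lemma uniform_boundary_sub (A : set V) : A `<=` boundary X ->
  uniform_boundary X A = (fine (H A) / fine (H (boundary X)))%:E.
Proof.
by move=> AX; rewrite law (setIidl AX) EFinM fineK//; exact: fin_sub AX Xfin.
Qed.

Lemma uniform_boundary_full (A : set V) : boundary X `<=` A -> uniform_boundary X A = 1%E.
Proof.
by move=> XA; rewrite law (setIidr XA) -[X in (X * _)%E]fineK// -EFinM divff// gt_eqF.
Qed.

Lemma uniform_boundary_ge (A : set V) (x y : R) : fine (H (boundary X)) <= y -> 0 <= x ->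
  (x%:E <= H (A `&` boundary X))%E -> ((x / y)%:E <= uniform_boundary X A)%E.
Proof.
move=> Xy x0 xA; rewrite law EFinM.
have y0 : 0 < y by exact: lt_le_trans Xy.
by rewrite lee_pmul ?lee_fin ?invr_ge0 ?(ltW y0)// lef_pV2.
Qed.

End one_body.

Lemma uniform_common_boundary (X : set V) : X `<=` S ->
  ((fine (H (boundary K)))%:E * uniform_boundary K X =
   (fine (H (boundary L)))%:E * uniform_boundary L X)%E.
Proof.
move=> XS; rewrite !uniform_boundary_sub ?boundary_truncated_gt0 ?boundary_bipyramid_gt0//.
- rewrite -!EFinM; congr EFin.
  have a0 : fine (H (boundary L)) != 0.
    by rewrite gt_eqF// fine_gt0// boundary_bipyramid_gt0 -ge0_fin_numE ?hausdorff_measure_ge0.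
  have b0 : fine (H (boundary K)) != 0.
    by rewrite gt_eqF// fine_gt0// boundary_truncated_gt0 -ge0_fin_numE ?hausdorff_measure_ge0.
  by field; rewrite a0 b0.
- exact: subset_trans XS S_L.
- exact: subset_trans XS S_K.
Qed.

Lemma gauge_norm_le (x : V) : bipyramid_gauge eps x <= 1 -> `|x| <= 1.
Proof.
rewrite /bipyramid_gauge => x1; have z0 : 0 <= `|rsubmx x| by [].
have h0 : 0 <= `|height x| / eps by rewrite divr_ge0// ltW.
apply: norm_le_height_rsubmx; last by lra.
have : `|height x| / eps <= 1 by lra.
by rewrite ler_pdivrMr// mul1r => /le_trans; apply.
Qed.

Lemma boundary_bipyramid_norm : boundary L `<=` [set x : V | `|x| <= 1].
Proof.
rewrite (boundary_bipyramid rho eps0) => x Lx; apply: gauge_norm_le.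
by case: Lx => -[->].
Qed.

Lemma boundary_truncated_norm : boundary K `<=` [set x : V | `|x| <= 1].
Proof.
rewrite (boundary_truncated eps0 rho1) => x Kx; apply: gauge_norm_le.
by case: Kx => -[]; [move=> ->|move=> /ltW].
Qed.

Lemma uniform_bipyramid_sym (X : set B) : measurable X ->
  uniform_boundary L ((fun x : V => - x) @^-1` X) = uniform_boundary L X.
Proof.
move=> mX; rewrite !uniform_boundaryE ?boundary_bipyramid_gt0 -?ge0_fin_numE//;
  try exact: hausdorff_measure_ge0.
congr (_ * _)%E.
have LE x : boundary L x <-> bipyramid_gauge eps x = 1.
  rewrite (boundary_bipyramid rho eps0); split; first by case=> -[].
  by move=> x1; case: (leP (height x) w0) => h; [left|right].
have LN x : boundary L x -> boundary L (- x).
  rewrite !LE => <-; rewrite /bipyramid_gauge linearN/= normrN.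
  by rewrite heightN normrN.
rewrite -[X in _ = H X]image_id -(@hausdorff_isometry _ _ _ _ _ _ id (fun x : V => - x)).
  congr (H _); apply/seteqP; split => [x [Xx Lx]|_ [x [Xx Lx] <-]].
    by exists (- x); rewrite ?opprK//; split => //; exact: LN.
  by split; [rewrite /= opprK|exact: LN].
by move=> x y _ _; rewrite -opprD enormN.
Qed.

Local Notation apex := (at_height eps 0 : V).

Lemma apex_norm : `|apex| <= 1.
Proof. by apply: norm_le_height_rsubmx; rewrite ?height_at ?rsubmx_at ?normr0// gtr0_norm. Qed.

Lemma height_apex_near (x : V) : `|rsubmx x| <= rho -> w0 <= height x -> height x <= eps ->
  enorm (x - apex) <= m.+2%:R * rho.
Proof.
move=> x1 x2 x3; apply: (le_trans (enorm_le_norm _)); rewrite ler_wpM2l//.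
apply: norm_le_height_rsubmx; last by rewrite linearB/= rsubmx_at subr0.
rewrite heightD heightN height_at.
have er : eps * rho <= 1 * rho by rewrite ler_wpM2r// ltW.
rewrite ler0_norm ?subr_le0//; lra.
Qed.

Lemma tip_apex_near (x : V) : C x -> `|x| <= 1 /\ enorm (x - apex) <= m.+2%:R * rho.
Proof.
move=> [x1 xw]; split; first by apply: gauge_norm_le; rewrite x1.
have h0 : 0 < height x by rewrite (lt_trans _ xw)// mulr_gt0// subr_gt0.
move: x1; rewrite /bipyramid_gauge gtr0_norm// => x1.
have h1 : 1 - rho < height x / eps by rewrite ltr_pdivlMr// mulrC.
have z0 : 0 <= `|rsubmx x| by [].
apply: height_apex_near; [by lra|exact: ltW|].
by rewrite -[leRHS]mul1r -ler_pdivrMr//; lra.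
Qed.

Lemma cut_apex_near (x : V) : D x -> `|x| <= 1 /\ enorm (apex - x) <= m.+2%:R * rho.
Proof.
move=> [x1 xw]; split; first by apply: gauge_norm_le; rewrite ltW.
rewrite enorm_distC; have h0 : 0 < w0 by rewrite mulr_gt0// subr_gt0.
move: x1; rewrite /bipyramid_gauge xw gtr0_norm// mulrAC divff ?gt_eqF// mul1r => x1.
by apply: height_apex_near; rewrite ?xw; [by lra|exact: lexx|rewrite ler_piMr ?ltW// ltrBlDr ltrDl].
Qed.

Let area_tip : R := fine (H (cone (0 : R) (- eps) @` @openb R m 1)).
Let area_cut : R := fine (H (@openb R m 1)).

(** The areas of tip and cut share the factor [rho ^+ m], which cancels from the smallness condition
    of [integral_lt_transfer]; [rho] remains only in the oscillation of [F] near the apex. *)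
Lemma truncation_mean_lt (F : B -> \bar R) (Lam M gap : R) :
  measurable_fun [set: B] F -> (forall x, 0 <= F x)%E -> (forall x, F x <= M%:E)%E ->
  0 <= Lam ->
  (forall x x' : V, `|x| <= 1 -> `|x'| <= 1 ->
     (F x <= F x' + (Lam * enorm (x - x'))%:E)%E) ->
  (F apex + gap%:E <= \int[uniform_boundary L]_x F x)%E ->
  area_cut <= area_tip ->
  (area_tip + area_cut) * (Lam * (m.+2%:R * rho)) < (area_tip - area_cut) * gap ->
  (\int[uniform_boundary L]_x F x < \int[uniform_boundary K]_x F x)%E.
Proof.
move=> mF F0 FM L0 lip gapP ct small.
have fF x : F x \is a fin_num by rewrite ge0_fin_numE// (le_lt_trans (FM x))// ltry.
have fine_boundary_gt0 X : (0 < H (boundary X))%E -> H (boundary X) \is a fin_num ->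
    0 < fine (H (boundary X)).
  by move=> h f; rewrite fine_gt0// h -ge0_fin_numE// ltW.
have L_gt0 := boundary_bipyramid_gt0; have K_gt0 := boundary_truncated_gt0.
have rm : 0 < rho ^+ m by rewrite exprn_gt0.
have tipE : fine (H C) = rho ^+ m * area_tip.
  by rewrite hausdorff_tip// fineM// ge0_fin_numE ?hausdorff_measure_ge0//
    (le_lt_trans (hausdorff_cone_le _ _ _)) ?normrN ?gtr0_norm//
    lte_mul_pinfty ?lee_fin ?hausdorff_openb_fin.
have cutE : fine (H D) = rho ^+ m * area_cut.
  by rewrite hausdorff_cut// fineM// ge0_fin_numE ?hausdorff_measure_ge0// hausdorff_openb_fin.
apply: (@integral_lt_transfer _ B R _ _ S C D F (fine (H (boundary L))) (fine (H (boundary K)))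
  (fine (H C)) (fine (H D)) (fine (F apex)) (Lam * (m.+2%:R * rho)) gap M).
- exact: common_boundary_borel.
- exact: tip_borel.
- exact: cut_borel.
- exact: common_boundary_tip.
- exact: common_boundary_cut.
- exact: fine_boundary_gt0.
- exact: fine_boundary_gt0.
- exact: area_difference.
- by rewrite tipE cutE ler_wpM2l// ltW.
- by apply: uniform_boundary_full => //; rewrite (boundary_bipyramid rho eps0).
- exact: uniform_boundary_sub.
- exact: uniform_boundary_sub.
- by move=> X _; exact: uniform_common_boundary.
- exact: mF.
- exact: F0.
- exact: FM.
- move=> x /tip_apex_near[x1 xa]; apply: (le_trans (lip _ _ x1 apex_norm)).
  by rewrite EFinD fineK// leeD2l// lee_fin ler_wpM2l.
- move=> x /cut_apex_near[x1 xa]; rewrite fineK//; apply: (le_trans (lip _ _ apex_norm x1)).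
  by rewrite leeD2l// lee_fin ler_wpM2l.
- exact: fine_ge0.
- by rewrite !mulr_ge0// ltW.
- by rewrite EFinD fineK.
- by rewrite tipE cutE -mulrDr -mulrBr -!mulrA ltr_pM2l.
Qed.

End truncation_law.

Section truncation_moments.
Context {R : realType} {m : nat}.
Local Notation V := 'rV[R]_(1 + m).
Local Notation B := (borel_rV R (1 + m)).
Local Notation H := (@hausdorff_measure R _ m).

(** [beta] is the area of a ball of radius [eta] divided by [area_bound], so it is chosen before
    [eps] and [rho] and serves both bodies. *)
Lemma ball_mass_gt0 eta : 0 < eta ->
  exists2 beta : R, 0 < beta & forall eps rho (c : V), 0 < eps -> eps <= eta -> eta <= 2^-1 ->
    0 < rho -> rho < 1 -> height c = 0 -> `|c| <= 2^-1 ->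
    (beta%:E <= uniform_boundary (@bipyramid R m eps) (ball_at eta c))%E /\
    (beta%:E <= uniform_boundary (@truncated_bipyramid R m eps rho) (ball_at eta c))%E.
Proof.
move=> eta0.
have cb_gt0 r : 0 < r -> 0 < fine (H (@closedb R m r)).
  by move=> r0; rewrite fine_gt0// hausdorff_closedb_gt0// hausdorff_closedb_fin.
have A0 : 0 < @area_bound R m.
  by rewrite mulr_gt0 ?cb_gt0// ltr_wpDl// mulr_ge0// exprn_ge0.
exists (fine (H (@closedb R m eta)) / @area_bound R m); first by rewrite divr_gt0 ?cb_gt0.
move=> eps rho c eps0 epseta eta2 rho0 rho1 c0 c2.
have eps2 := le_trans epseta eta2; have eps1 : eps <= 1 by lra.
have hS := hausdorff_common_ge eps0 rho1 epseta eta2 c0 c2.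
have key (X : set V) : (0 < H (boundary X))%E -> (H (boundary X) <= (@area_bound R m)%:E)%E ->
    @common_boundary R m eps rho `<=` boundary X ->
    ((fine (H (@closedb R m eta)) / @area_bound R m)%:E <= uniform_boundary X (ball_at eta c))%E.
  move=> X0 XA SX.
  have Xf : H (boundary X) \is a fin_num.
    by rewrite ge0_fin_numE ?hausdorff_measure_ge0// (le_lt_trans XA)// ltry.
  apply: uniform_boundary_ge => //.
  - by rewrite -lee_fin fineK.
  - exact/ltW/cb_gt0.
  rewrite fineK ?ge0_fin_numE ?hausdorff_measure_ge0 ?hausdorff_closedb_fin//.
  by apply: (le_trans hS); apply: le_hausdorff_measure; exact: setIS.
split; apply: key.
- exact: boundary_bipyramid_gt0 eps0 eps2 rho1.
- exact: hausdorff_boundary_bipyramid_le rho eps0 eps1.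
- by rewrite (boundary_bipyramid rho eps0); left.
- exact: (boundary_truncated_gt0 eps0 eps2 rho1).
- exact: hausdorff_boundary_truncated_le.
- by rewrite (boundary_truncated eps0 rho1); left.
Qed.

Lemma exists_small (x y : R) : 0 <= x -> 0 < y -> exists2 t : R, 0 < t & x * t < y.
Proof.
move=> x0 y0; exists (y / (x + 1)); first by rewrite divr_gt0// ltr_wpDl.
rewrite mulrA ltr_pdivrMr ?ltr_wpDl// mulrC ltr_pM2l// ltrDl//.
Qed.

Lemma height_nodes p (c : V) : c \in nodes p -> height c = 0.
Proof.
by rewrite inE => /predU1P[->|/mapP[i _ ->]]; rewrite /height mxE.
Qed.

Lemma truncation_moment_lt k p : (0 < k)%N -> (p.+1 <= m)%N ->
  exists eps rho : R, [/\ 0 < eps, eps <= 1, 0 < rho, rho < 1 &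
   (moment p.+2 k (@bipyramid R m eps) < moment p.+2 k (@truncated_bipyramid R m eps rho))%E].
Proof.
move=> k0 pm; have i0 : 'I_m by exact: Ordinal pm.
have [Lam L0 lip] := @cond_mean_lipschitz R m k p.
have [M M0 hM] := @cond_mean_bound R m k p.
have [w w_gt0 [eta /andP[eta0 eta2] gain]] := @cond_mean_gain R m k p k0 pm.
have [beta beta0 mass] := ball_mass_gt0 eta0.
(* Half of the gain from [cond_mean_gain]; the other half pays for moving from 0 to the apex, at
   distance [eps]. *)
pose gap := w / 4 * beta ^+ p.+2.
have gap0 : 0 < gap by rewrite mulr_gt0 ?divr_gt0 ?exprn_gt0.
have [t t0 Lt] := exists_small L0 gap0.
pose eps := Num.min eta t.
have eps0 : 0 < eps by rewrite lt_min eta0.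
have epseta : eps <= eta by rewrite ge_min lexx.
have eps2 := le_trans epseta eta2; have eps1 : eps <= 1 by lra.
have Leps : Lam * eps <= gap.
  by rewrite (le_trans _ (ltW Lt))// ler_wpM2l// ge_min lexx orbT.
pose area_cut : R := fine (H (@openb R m 1)).
pose area_tip : R := fine (H (cone (0 : R) (- eps) @` @openb R m 1)).
have area_lt : 0 <= area_cut < area_tip.
  have ne : - eps != 0 by rewrite oppr_eq0 gt_eqF.
  have [tau tau0 h] := hausdorff_cone_gt i0 0 ne.
  have fo : H (@openb R m 1) \is a fin_num.
    by rewrite ge0_fin_numE ?hausdorff_measure_ge0// hausdorff_openb_fin.
  have fc : H (cone (0 : R) (- eps) @` @openb R m 1) \is a fin_num.
    rewrite ge0_fin_numE ?hausdorff_measure_ge0//.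
    rewrite (le_lt_trans (hausdorff_cone_le _ _ _)) ?normrN ?gtr0_norm//.
    by rewrite lte_mul_pinfty ?lee_fin ?exprn_ge0// hausdorff_openb_fin.
  rewrite fine_ge0 ?hausdorff_measure_ge0//=.
  rewrite -[X in (X + _ <= _)%E]fineK// -[X in (_ <= X)%E]fineK// -EFinD lee_fin in h.
  by apply: lt_le_trans h; rewrite ltrDl.
have /andP[ac0 acat] := area_lt.
have [u u0 Lu] := @exists_small ((area_tip + area_cut) * (Lam * m.+2%:R)) ((area_tip - area_cut) * gap)
  (mulr_ge0 (addr_ge0 (ltW (le_lt_trans ac0 acat)) ac0) (mulr_ge0 L0 (ler0n _ _)))
  (mulr_gt0 (eq_ind_r is_true acat (subr_gt0 _ _)) gap0).
pose rho := Num.min u 2^-1.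
have rho0 : 0 < rho by rewrite lt_min u0 invr_gt0 /=.
have rho1 : rho < 1 by rewrite gt_min invf_lt1// ltr1n orbT.
have small : (area_tip + area_cut) * (Lam * (m.+2%:R * rho)) < (area_tip - area_cut) * gap.
  apply: le_lt_trans Lu; rewrite -!mulrA ler_wpM2l ?addr_ge0 ?(ltW (le_lt_trans ac0 acat))//.
  by rewrite ler_wpM2l// ler_wpM2l// ge_min lexx.
exists eps, rho; split => //.
pose PL := uniform_boundary (@bipyramid R m eps).
pose PK := uniform_boundary (@truncated_bipyramid R m eps rho).
have finL : H (boundary (@bipyramid R m eps)) \is a fin_num.
  rewrite ge0_fin_numE ?hausdorff_measure_ge0//.
  by rewrite (le_lt_trans (hausdorff_boundary_bipyramid_le rho eps0 eps1))// ltry.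
have finK : H (boundary (@truncated_bipyramid R m eps rho)) \is a fin_num.
  rewrite ge0_fin_numE ?hausdorff_measure_ge0//.
  by rewrite (le_lt_trans (hausdorff_boundary_truncated_le eps0 eps1 rho0 rho1))// ltry.
have PL1 : PL [set x : V | `|x| <= 1] = 1%E.
  apply: uniform_boundary_full => //; first exact: boundary_bipyramid_gt0 eps0 eps2 rho1.
  exact: (boundary_bipyramid_norm rho eps0 eps2).
have PK1 : PK [set x : V | `|x| <= 1] = 1%E.
  apply: uniform_boundary_full => //; first exact: (boundary_truncated_gt0 eps0 eps2 rho1).
  exact: (boundary_truncated_norm eps0 eps2 rho1).
rewrite !moment_ball_power//.
apply: (@iid_integral_lt _ B R PL PK p.+1 (fun s : seq B => (ball_power k s)%:E)).
- by move=> s; exact: ball_power_EFin_ge0.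
- exact: measurable_ball_power.
- by move=> s s' ss'; rewrite (ball_power_perm k ss').
move=> i j ij.
pose pr (b : bool) : probability B R := if b then PK else PL.
(* [true] marks the vertices already distributed on the truncated body. *)
pose bs := nseq i true ++ nseq j false.
have bsE : nseq i PK ++ nseq j PL = map pr bs by rewrite map_cat !map_nseq.
have sbs : size bs = p.+1 by rewrite size_cat !size_nseq.
have sPs : size (map pr bs) = p.+1 by rewrite size_map.
rewrite bsE; set Ps := map pr bs in sPs *.
have mass' c : height c = 0 -> `|c| <= 2^-1 -> forall b, (beta%:E <= pr b (ball_at eta c))%E.
  by move=> c0 c2 []; have [? ?] := mass eps rho c eps0 epseta eta2 rho0 rho1 c0 c2.
have gainP : (cond_mean k Ps (0%R : V) + (w / 2 * beta ^+ p.+2)%:E <=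
    \int[PL]_x cond_mean k Ps x)%E.
  apply: gain => //; first exact: ltW.
  - by move=> b c cn; apply: mass'; [exact: height_nodes cn|exact: nodes_norm cn].
  - by apply: (mass' _ _ _ false); [rewrite /height mxE|exact: node_norm].
  - exact: (uniform_bipyramid_sym eps0 eps2 rho1).
have apex1 : `|at_height eps 0 : V| <= 1 by exact: (apex_norm eps0 eps2).
have enorm_apex : enorm ((at_height eps 0 : V) - 0) = eps.
  apply/eqP; rewrite -(@eqrXn2 _ 2)// ?enorm_ge0 ?(ltW eps0)//.
  have -> : (0 : V) = at_height 0 0 by rewrite -(at_heightK 0) /height mxE linear0.
  by rewrite enorm_at_height subr0 subrr enorm0 expr0n addr0.
have z1 : `|0 : V| <= 1 by rewrite normr0.
apply: (@truncation_mean_lt R m eps rho eps0 eps2 rho0 rho1 (cond_mean k Ps) Lam M gap).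
- exact: measurable_cond_mean sPs.
- by move=> x; exact: cond_mean_ge0.
- by move=> x; exact: hM.
- exact: L0.
- by move=> x x' x1 x'1; exact: lip.
- apply: le_trans gainP.
  have -> : w / 2 * beta ^+ p.+2 = gap + gap by rewrite /gap; field.
  move: (lip _ _ _ sPs apex1 z1); rewrite enorm_apex.
  move: (cond_mean k Ps _) (cond_mean k Ps _) => F1 F2 h.
  by rewrite EFinD addeA leeD2r// (le_trans h)// leeD2l// lee_fin.
- exact: ltW.
- exact: small.
Qed.

End truncation_moments.

Theorem theorem3 (R : realType) (d n k : nat)
    (d_ge3 : (3 <= d)%N) (n_bounds : (2 <= n <= d)%N) (k_gt0 : (0 < k)%N)
    (not_exceptional : ~ [/\ d = 3%N, n = 3%N & k = 1%N \/ k = 2%N]) :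
  exists K L : set 'rV[R]_d,
    [/\ convex_body K, convex_body L, K `<=` L &
        (moment n k L < moment n k K)%E].
Proof.
(* With [d = m.+1] and [n = p.+2], the bound [n <= d] becomes [p.+1 <= m]. *)
case: d n n_bounds d_ge3 not_exceptional => [//|m] [//|[//|p]] /andP[_ pm] _ _.
have [eps [rho [eps0 eps1 rho0 rho1 lt_moment]]] := @truncation_moment_lt R m k p k_gt0 pm.
exists (truncated_bipyramid eps rho), (@bipyramid R m eps); split => //.
- exact: truncated_convex_body.
- exact: bipyramid_convex_body.
- exact: truncated_subset.
Qed.
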